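(* Let $G=\mathrm{OSp}(V)$ and $d=m-2n$. There is a unique additive covariant functor $F:\mathcal{B}(d)\to\mathcal{T}_G(V)$ such that (i) $F$ sends the object $r$ to $V^{\otimes_\Lambda r}$, and sends the elementary diagrams to $F(I)=\mathrm{id}_V$, $F(X)=\tau$, $F(U)=\check C$, $F(A)=\hat C$; (ii) $F$ respects tensor products: $F(r\otimes r')=V^{\otimes_\Lambda r}\otimes_\Lambda V^{\otimes_\Lambda r'}$ and $F(D\otimes D')=F(D)\otimes_\Lambda F(D')$ for all morphisms $D,D'$.
   Context: $\Lambda=\varinjlim\wedge(\mathbb{C}^N)$ is the infinite Grassmann algebra ($\mathbb{Z}_2$-graded, supercommutative; modules are $\mathbb{Z}_2$-graded with $\lambda v=(-1)^{[\lambda][v]}v\lambda$). $V_{\mathbb{C}}$ has superdimension $(m|2n)$, nondegenerate even supersymmetric form, and homogeneous basis $e_1,\dots,e_{m+2n}$ ($e_1,\dots,e_m$ even) with $(e_a,e_b)=\eta_{ab}$, $\eta=\mathrm{diag}(I_m,J)$, $J$ block diagonal with $n$ blocks $\begin{pmatrix}0&-1\\1&0\end{pmatrix}$; $\eta^{ab}$ denote the entries of $\eta^{-1}$. $V=V_{\mathbb{C}}\otimes\Lambda$ with the $\Lambda$-bilinear extension of the form; $\mathrm{OSp}(V)$ is the group of invertible even $\Lambda$-linear endomorphisms preserving the form. Maps: $\tau:V\otimes V\to V\otimes V$, $v\otimes w\mapsto(-1)^{[v][w]}w\otimes v$; $\check C:\Lambda\to V\otimes V$, $1\mapsto c_0=\sum_{a,b}e_a\otimes\eta^{ab}e_b$;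 $\hat C:V\otimes V\to\Lambda$, $v\otimes w\mapsto(v,w)$. Brauer category $\mathcal{B}(\delta)$ ($\delta\in\Lambda_{\bar0}$): objects $0,1,2,\dots$; $\mathrm{Hom}(k,\ell)=B_k^\ell(\delta)$, the free $\Lambda$-module with even basis the $(k,\ell)$ Brauer diagrams (partitions of $k$ bottom and $\ell$ top points into pairs); composition is concatenation of diagrams, each closed loop removed being replaced by a factor $\delta$, extended $\Lambda$-bilinearly; tensor product on objects is $k\otimes\ell=k+\ell$ and on diagrams is juxtaposition. The elementary diagrams are $I$ (the $(1,1)$ identity), $X$ (the $(2,2)$ crossing), $A$ (the $(2,0)$ cap) and $U$ (the $(0,2)$ cup); they generate all diagrams under composition and tensor product. $\mathcal{T}_G(V)$ is the full subcategory of $G$-modules with objects $V^{\otimes_\Lambda r}$, $r\ge0$, whose morphisms are $G$-equivariant $\Lambda$-linear maps, with tensor product over $\Lambda$.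
   Formalization: ''Additive'' is taken to include Λ-linearity, F(λD) = λF(D): with additivity alone uniqueness fails, since twisting the coefficients of diagrams by the parity automorphism of Λ gives a second functor with the same values on I, X, U, A. *)

(* Defs.v *)
From HB Require Import structures.
From mathcomp Require Import all_boot all_order all_algebra all_fingroup.
From mathcomp Require Import finmap.
From mathcomp Require Import reals complex.
Set Implicit Arguments. Unset Strict Implicit. Unset Printing Implicit Defensive.
Import GRing.Theory Num.Theory.

Section GrassmannAlgebra.
Local Open Scope ring_scope.
Variable R : realType.
Local Notation C := (R[i]).

(* The infinite Grassmann algebra Lambda = lim-> wedge(C^N).  An element is  *)
(* a finite C-linear combination of monomials e_S = e_{s1} ... e_{sk}        *)
(* (s1 < ... < sk), S a finite subset of nat; it is stored as the finitely   *)
(* supported coefficient function S |-> coefficient of e_S.                  *)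
Definition Grass := {fsfun {fset nat} -> C with 0}.

Definition mkG (D : {fset {fset nat}}) (h : {fset nat} -> C) : Grass :=
  [fsfun S in D => h S | 0].

Definition gzero : Grass := mkG fset0 (fun _ => 0).
Definition gone : Grass := mkG [fset fset0]%fset (fun _ => 1).
Definition gadd (f g : Grass) : Grass :=
  mkG (finsupp f `|` finsupp g)%fset (fun S => f S + g S).
Definition gscale (c : C) (f : Grass) : Grass :=
  mkG (finsupp f) (fun S => c * f S).
Definition gopp (f : Grass) : Grass := gscale (-1) f.

(* sign of e_T e_U = sgn T U * e_(T u U) for disjoint T, U *)
Definition gsgn (T U : {fset nat}) : C :=
  (-1) ^+ (\sum_(t <- T) \sum_(u <- U) (u < t)%N)%N.

Definition gmul (f g : Grass) : Grass :=
  mkG ([fset (T `|` U) | T in finsupp f, U in finsupp g])%fset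
      (fun S => \sum_(T <- fpowerset S) gsgn T (S `\` T)%fset * f T * g (S `\` T)%fset).

Definition geven (f : Grass) : Grass :=
  mkG (finsupp f) (fun S => if odd #|` S|%fset then 0 else f S).
Definition godd (f : Grass) : Grass :=
  mkG (finsupp f) (fun S => if odd #|` S|%fset then f S else 0).
Definition ginv (f : Grass) : Grass :=
  mkG (finsupp f) (fun S => (-1) ^+ #|` S|%fset * f S).
Definition gpart (p : bool) (f : Grass) : Grass := if p then godd f else geven f.

Definition gsum (I : finType) (F : I -> Grass) : Grass :=
  foldr (fun i acc => gadd (F i) acc) gzero (enum I).

End GrassmannAlgebra.

Section SuperSpace.
Variables (R : realType) (m n : nat).
Local Notation C := (R[i]).
Local Notation Grass := (Grass R).

(* basis e_0, ..., e_{m+2n-1} (0-based); e_a is odd iff a >= m *)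
Definition Dm := (m + n.*2)%N.
Definition bpar (a : 'I_Dm) : bool := (m <= a)%N.

(* eta = diag(I_m, J), J block diagonal with n blocks [[0,-1],[1,0]] *)
Definition eta : 'M[C]_Dm := (
  \matrix_(a, b)
    if (a < m)%N && (b < m)%N then (a == b)%:R
    else if (m <= a)%N && (m <= b)%N then
      (if ((a - m)./2 == (b - m)./2)%N then
         (if ~~ odd (a - m) && odd (b - m) then -1
          else if odd (a - m) && ~~ odd (b - m) then 1 else 0)
       else 0)
    else 0)%R.
Definition etainv : 'M[C]_Dm := invmx eta.

(* multi-indices A = (a_1,...,a_r); basis tensor e_A = e_{a_1} (x) ... (x) e_{a_r} *)
Definition Idx (r : nat) := {ffun 'I_r -> 'I_Dm}.
Definition ipar (r : nat) (A : Idx r) : bool := odd (\sum_(i < r) bpar (A i)).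

(* V^{(x)r}: an element v is  sum_A e_A v(A)  (coefficients written on the
   right, v(A) in Lambda).  V^{(x)0} = Lambda, V^{(x)1} = V. *)
Definition Vt (r : nat) := Idx r -> Grass.

Definition vzero r : Vt r := fun _ => gzero R.
Definition vadd r (v w : Vt r) : Vt r := fun A => gadd (v A) (w A).
Definition vopp r (v : Vt r) : Vt r := fun A => gopp (v A).
Definition vsum r (I : finType) (F : I -> Vt r) : Vt r :=
  fun A => gsum (fun i => F i A).
Definition vrmul r (v : Vt r) (mu : Grass) : Vt r := fun A => gmul (v A) mu.
(* left action  lambda v  (lambda e_A x = (-1)^{[lambda][A]} e_A lambda x) *)
Definition vlmul r (lam : Grass) (v : Vt r) : Vt r :=
  fun A => gmul (if ipar A then ginv lam else lam) (v A).
Definition vhom r (p : bool) (v : Vt r) : Prop :=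
  forall A, gpart (~~ (ipar A (+) p)) (v A) = gzero R.
(* (e_A x has parity [A] + [x]; so v has parity p iff the component of
   v(A) of parity [A] + p + 1 vanishes) *)

Definition ebasis r (A : Idx r) : Vt r := fun B => if B == A then gone R else gzero R.
Definition e1 (a : 'I_Dm) : Vt 1 := ebasis [ffun _ => a].
Definition vunit0 : Vt 0 := fun _ => gone R.

(* tensor product over Lambda of elements:
   (sum e_A v_A) (x) (sum e_B w_B) = sum e_A (x) e_B (-1)^{[v_A][B]} v_A w_B *)
Definition vtens k l (v : Vt k) (w : Vt l) : Vt (k + l) :=
  fun AB => let A : Idx k := [ffun i => AB (lshift l i)] in
            let B : Idx l := [ffun j => AB (rshift k j)] in
            gmul (if ipar B then ginv (v A) else v A) (w B).

Definition extend k l (col : Idx k -> Vt l) : Vt k -> Vt l :=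
  fun v => vsum (fun A : Idx k => vrmul (col A) (v A)).

(* Lambda-linear maps (morphisms of Lambda-modules; a Lambda-linear map of
   parity p satisfies phi(lambda v) = (-1)^{p[lambda]} lambda phi(v); this is
   equivalent to right linearity phi(v mu) = phi(v) mu) *)
Definition lam_linear k l (phi : Vt k -> Vt l) : Prop :=
  (forall v w, phi (vadd v w) = vadd (phi v) (phi w)) /\
  (forall v mu, phi (vrmul v mu) = vrmul (phi v) mu).

Definition mscale k l (lam : Grass) (phi : Vt k -> Vt l) : Vt k -> Vt l :=
  fun v => vlmul lam (phi v).
Definition madd k l (phi psi : Vt k -> Vt l) : Vt k -> Vt l :=
  fun v => vadd (phi v) (psi v).

Definition mpart k l (p : bool) (phi : Vt k -> Vt l) : Vt k -> Vt l :=
  extend (fun B => fun A => gpart (ipar A (+) ipar B (+) p) (phi (ebasis B) A)).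

(* tensor product of Lambda-linear maps, with the Koszul sign rule
   (f (x) g)(v (x) w) = (-1)^{[g][v]} f(v) (x) g(w) *)
Definition mtens k l k' l' (f : Vt k -> Vt l) (g : Vt k' -> Vt l') :
    Vt (k + k') -> Vt (l + l') :=
  extend (fun AB : Idx (k + k') =>
    let A : Idx k := [ffun i => AB (lshift k' i)] in
    let B : Idx k' := [ffun j => AB (rshift k j)] in
    vadd (vtens (f (ebasis A)) (mpart false g (ebasis B)))
         ((if ipar A then @vopp _ else id)
            (vtens (f (ebasis A)) (mpart true g (ebasis B))))).

(* the Lambda-bilinear extension of the form to V:
   (e_a x, e_b y) = (-1)^{[x][b]} eta_ab x y *)
Definition vform (v w : Vt 1) : Grass :=
  gsum (fun a : 'I_Dm => gsum (fun b : 'I_Dm =>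
    gscale (eta a b)
      (gmul (if bpar b then ginv (v [ffun _ => a]) else v [ffun _ => a])
            (w [ffun _ => b])))).

Definition in_OSp (g : Vt 1 -> Vt 1) : Prop :=
  [/\ lam_linear g,
      (forall p v, vhom p v -> vhom p (g v)),
      bijective g
    & forall v w, vform (g v) (g w) = vform v w].

Fixpoint tpow (r : nat) : ('I_r -> Vt 1) -> Vt r :=
  match r with
  | 0 => fun _ => vunit0
  | r'.+1 => fun u => vtens (u ord0) (tpow (fun i => u (lift ord0 i)))
  end.

Definition gact (r : nat) (g : Vt 1 -> Vt 1) : Vt r -> Vt r :=
  extend (fun A : Idx r => tpow (fun i => g (e1 (A i)))).

Definition is_TG_mor k l (phi : Vt k -> Vt l) : Prop :=
  lam_linear phi /\
  forall g, in_OSp g -> forall v, phi (gact g v) = gact g (phi v).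

Definition tau : Vt 2 -> Vt 2 :=
  extend (fun AB : Idx 2 =>
    let a := AB ord0 in let b := AB ord_max in
    (if bpar a && bpar b then @vopp _ else id) (vtens (e1 b) (e1 a))).

Definition c0 : Vt 2 :=
  vsum (fun ab : 'I_Dm * 'I_Dm =>
    vtens (e1 ab.1) (fun B => gscale (etainv ab.1 ab.2) (e1 ab.2 B))).
Definition Ccheck : Vt 0 -> Vt 2 := extend (fun _ => c0).

Definition Chat : Vt 2 -> Vt 0 :=
  extend (fun AB : Idx 2 =>
    fun _ => vform (e1 (AB ord0)) (e1 (AB ord_max))).

End SuperSpace.

Section Brauer.
Variable R : realType.
Local Notation C := (R[i]).
Local Notation Grass := (Grass R).

(* A (k,l) Brauer diagram: a fixed-point-free involution of the k+l points; *)
(* points 0..k-1 are the bottom (source) row, points k..k+l-1 the top row.   *)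
Definition diag_ok k l (f : {ffun 'I_(k + l) -> 'I_(k + l)}) : bool :=
  [forall i, (f (f i) == i) && (f i != i)].
Definition Diag k l := {f : {ffun 'I_(k + l) -> 'I_(k + l)} | diag_ok f}.

Definition partner k l (D : Diag k l) (x : nat) : nat :=
  odflt x (omap (fun i : 'I_(k + l) => nat_of_ord (sval D i)) (insub x)).

(* concatenation graph on k + l + p points: bottom row of D1 = 0..k-1,
   middle row = k..k+l-1 (top of D1 = bottom of D2), top of D2 = k+l.. *)
Definition cedge k l p (D1 : Diag k l) (D2 : Diag l p) : rel 'I_(k + l + p) :=
  fun x y =>
    [&& (x < k + l)%N, (y < k + l)%N & partner D1 x == y] ||
    [&& (k <= x)%N, (k <= y)%N & partner D2 (x - k) == (y - k)%N].

Definition cemb k l p (i : 'I_(k + p)) : 'I_(k + l + p) :=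
  match split i with
  | inl j => lshift p (lshift l j)
  | inr t => rshift (k + l) t
  end.
Arguments cemb : clear implicits.

Definition rawcomp k l p (D1 : Diag k l) (D2 : Diag l p) : {ffun 'I_(k + p) -> 'I_(k + p)} :=
  [ffun i => odflt i [pick j | (j != i) && connect (cedge D1 D2) (cemb k l p i) (cemb k l p j)]].

Definition cmiddle k l p (x : 'I_(k + l + p)) : bool := (k <= x < k + l)%N.
Arguments cmiddle : clear implicits.

(* number of closed loops: components of the graph lying in the middle row,
   counted by their minimal point *)
Definition nloops k l p (D1 : Diag k l) (D2 : Diag l p) : nat :=
  #|[pred x : 'I_(k + l + p) | cmiddle k l p x &&
      [forall y, connect (cedge D1 D2) x y ==> cmiddle k l p y && (x <= y)%N]]|.

Definition rawtens k l k' l' (D1 : Diag k l) (D2 : Diag k' l') :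
    {ffun 'I_((k + k') + (l + l')) -> 'I_((k + k') + (l + l'))} :=
  [ffun i : 'I_((k + k') + (l + l')) =>
    let x := nat_of_ord i in
    let back1 y := if (y < k)%N then y else (y + k')%N in
    let back2 z := if (z < k')%N then (k + z)%N else (k + l + z)%N in
    insubd i (if (x < k)%N then back1 (partner D1 x)
              else if (x < k + k')%N then back2 (partner D2 (x - k))
              else if (x < k + k' + l)%N then back1 (partner D1 (x - k'))
              else back2 (partner D2 (x - k - l)))].

Definition rawid k : {ffun 'I_(k + k) -> 'I_(k + k)} :=
  [ffun i : 'I_(k + k) => insubd i (if (i < k)%N then (i + k)%N else (i - k)%N)].
Definition rawX : {ffun 'I_(2 + 2) -> 'I_(2 + 2)} :=
  [ffun i : 'I_(2 + 2) => insubd i (3 - i)%N].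
Definition rawA : {ffun 'I_(2 + 0) -> 'I_(2 + 0)} :=
  [ffun i : 'I_(2 + 0) => insubd i (1 - i)%N].
Definition rawU : {ffun 'I_(0 + 2) -> 'I_(0 + 2)} :=
  [ffun i : 'I_(0 + 2) => insubd i (1 - i)%N].

(* morphisms: Hom(k,l) = B_k^l(delta), the free Lambda-module on the (k,l)
   diagrams; an element is  sum_D a(D) D. *)
Definition HomB k l := Diag k l -> Grass.

Definition bdiag k l (f : {ffun 'I_(k + l) -> 'I_(k + l)}) : HomB k l :=
  fun D => if sval D == f then gone R else gzero R.

Definition idB k : HomB k k := bdiag (rawid k).
Definition Ib : HomB 1 1 := bdiag (rawid 1).
Definition Xb : HomB 2 2 := bdiag rawX.
Definition Ab : HomB 2 0 := bdiag rawA.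
Definition Ub : HomB 0 2 := bdiag rawU.

Definition addB k l (a b : HomB k l) : HomB k l := fun D => gadd (a D) (b D).
Definition scaleB k l (lam : Grass) (a : HomB k l) : HomB k l :=
  fun D => gmul lam (a D).

Definition compB (delta : C) k l p (b : HomB l p) (a : HomB k l) : HomB k p :=
  fun D => gsum (fun D12 : Diag k l * Diag l p =>
    if sval D == rawcomp D12.1 D12.2
    then gscale (delta ^+ nloops D12.1 D12.2)%R (gmul (b D12.2) (a D12.1))
    else gzero R).

Definition tensB k l k' l' (a : HomB k l) (b : HomB k' l') : HomB (k + k') (l + l') :=
  fun D => gsum (fun D12 : Diag k l * Diag k' l' =>
    if sval D == rawtens D12.1 D12.2 then gmul (a D12.1) (b D12.2)
    else gzero R).

End Brauer.

Definition FunctorType (R : realType) (m n : nat) :=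
  forall k l : nat, HomB R k l -> Vt R m n k -> Vt R m n l.

Definition is_thm54_functor (R : realType) (m n : nat) (F : FunctorType R m n) : Prop :=
  let d : R[i] := (m%:R - (n.*2)%:R)%R in
  (forall k l (a : HomB R k l), is_TG_mor (F k l a)) /\
  (forall k l (a b : HomB R k l), F k l (addB a b) = madd (F k l a) (F k l b)) /\
  (forall k l (lam : Grass R) (a : HomB R k l),
      F k l (scaleB lam a) = mscale lam (F k l a)) /\
  (forall k, F k k (@idB R k) = id) /\
  (forall k l p (b : HomB R l p) (a : HomB R k l),
      F k p (compB d b a) = F l p b \o F k l a) /\
  (F 1 1 (@Ib R) = id /\ F 2 2 (@Xb R) = @tau R m n /\
   F 0 2 (@Ub R) = @Ccheck R m n /\ F 2 0 (@Ab R) = @Chat R m n) /\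
  (forall k l k' l' (a : HomB R k l) (b : HomB R k' l'),
      F (k + k') (l + l') (tensB a b) = mtens (F k l a) (F k' l' b)).

(* Main.v *)
Require Import Defs.
From HB Require Import structures.
From mathcomp Require Import all_boot all_order all_algebra all_fingroup.
From mathcomp Require Import finmap.
From mathcomp Require Import reals complex.
From mathcomp Require Import boolp ring zify.
Set Implicit Arguments. Unset Strict Implicit. Unset Printing Implicit Defensive.
Import GRing.Theory.

(* The functor is given by explicit matrix coefficients. Order the end points of a diagram
   around its boundary; the coefficient of a coloring of these points by basis vectors is
   the product over the strands of the values of the form on their two ends, times -1 for
   every crossing of two strands of odd color. Composition is summation over the colors of
   adjacent pairs of points, and one such summation joins two strands, or removes a closed
   loop at the price of a factor m - 2n. The same contractions occur for every (m|n); for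
   (2|0) the coefficients are indicator functions of colorings constant on strands, and
   counting these identifies the outcome as the concatenated diagram with its number of
   loops. Colourings also verify the identities by which each diagram is built from I, X, A, U
   without closed loops. This gives uniqueness, and reduces equivariance to the invariance of
   the braiding, of the form and of c_0. *)

(** * The Grassmann algebra as a supercommutative ring *)

(** Defining the functor on generators would require a presentation of the Brauer category by
    relations; a formula valid for every diagram avoids this. The crossing sign is a sum of
    comparisons in a linear order of the end points, so it depends on the matching alone and not on
    a drawing of it. Composition is controllable because two adjacent points compare alike with
    every other point: joining the strands that end there adds crossing parities.

    Contractions by themselves say nothing about paths in the concatenation graph, by which the
    composite and its loops are defined. But the matching and the exponent that they produce are the
    same for every form, so a form without signs may be used to read them off: the powers of 2 are
    distinct, and the sets of points that are unions of strands determine the strands. The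
    orthosymplectic form itself could not give the exponent, since m - 2n may be 0 or 1. *)

Section GrassmannRing.
Local Open Scope ring_scope.
Variable R : realType.
Local Notation C := (R[i]).
Local Notation Grass := (Grass R).
Implicit Types (f g h : Grass) (S T U : {fset nat}).

Lemma mkGE (D : {fset {fset nat}}) (h : {fset nat} -> C) S :
  mkG D h S = if S \in D then h S else 0.
Proof. exact: fsfun_fun. Qed.

Lemma mkG_supp (D : {fset {fset nat}}) (h : {fset nat} -> C) S :
  (S \notin D -> h S = 0) -> mkG D h S = h S.
Proof. by rewrite mkGE; case: ifP => // _ ->. Qed.

Lemma grassP f g : (forall S, f S = g S) -> f = g.
Proof. by move=> fg; apply/fsfunP. Qed.

Lemma gzeroE S : gzero R S = 0.
Proof. by rewrite mkG_supp. Qed.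

Lemma goneE S : gone R S = (S == fset0)%:R.
Proof. by rewrite mkGE inE; case: eqP. Qed.

Lemma gaddE f g S : gadd f g S = f S + g S.
Proof.
by rewrite mkG_supp // inE negb_or => /andP[/fsfun_dflt -> /fsfun_dflt ->]; rewrite addr0.
Qed.

Lemma gscaleE (c : C) f S : gscale c f S = c * f S.
Proof. by rewrite mkG_supp // => /fsfun_dflt ->; rewrite mulr0. Qed.

(** A nonzero term has T and its complement in the two supports, so S is one of the unions to which
    [gmul] is restricted: the cutoff loses nothing. *)
Lemma gmulE f g S :
  gmul f g S = \sum_(T <- fpowerset S) gsgn R T (S `\` T)%fset * f T * g (S `\` T)%fset.
Proof.
rewrite mkG_supp // => /imfset2P nS.
rewrite big_seq big1 // => T; rewrite fpowersetE => TS.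
case: (finsuppP f T) => [_|fT]; first by rewrite mulr0 mul0r.
case: (finsuppP g (S `\` T)%fset) => [_|gT]; first by rewrite mulr0.
by case: nS; exists T => //; exists (S `\` T)%fset; rewrite // -{1}(fsetID T S) (fsetIidPr TS).
Qed.

Lemma gpartE p f S : gpart p f S = if odd #|` S|%fset == p then f S else 0.
Proof.
by case: p; rewrite mkG_supp => [|/fsfun_dflt ->]; case: odd.
Qed.

Lemma ginvE f S : ginv f S = (-1) ^+ #|` S|%fset * f S.
Proof. by rewrite mkG_supp // => /fsfun_dflt ->; rewrite mulr0. Qed.

Lemma big_fpowerset_sub (M : nmodType) S T (F : {fset nat} -> M) : (T `<=` S)%fset ->
  \sum_(U <- fpowerset T) F U = \sum_(U <- fpowerset S | (U `<=` T)%fset) F U.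
Proof.
move=> TS; rewrite -[RHS]big_filter; apply: perm_big; apply: uniq_perm.
- exact: fset_uniq.
- exact/filter_uniq/fset_uniq.
move=> U; rewrite mem_filter !fpowersetE.
by case UT: (U `<=` T)%fset => //=; rewrite (fsubset_trans UT TS).
Qed.

Lemma big_seq_bij (M : nmodType) (I J : eqType) (r : seq I) (r' : seq J)
    (h : I -> J) (h' : J -> I) (F : J -> M) :
  uniq r -> uniq r' ->
  (forall i, i \in r -> h i \in r') -> (forall j, j \in r' -> h' j \in r) ->
  {in r, cancel h h'} -> {in r', cancel h' h} ->
  \sum_(j <- r') F j = \sum_(i <- r) F (h i).
Proof.
move=> ur ur' hr hr' hK h'K; rewrite -(big_map h predT); apply: perm_big; apply: uniq_perm => //.
  by rewrite map_inj_in_uniq // => x y xr yr xy; rewrite -(hK x) // xy hK.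
move=> j; apply/idP/mapP => [jr|[i ir ->]]; last exact: hr.
by exists (h' j); rewrite ?hr' ?h'K.
Qed.

Lemma big_fsetU (M : nmodType) (I : choiceType) (T U : {fset I}) (F : I -> M) :
  [disjoint T & U]%fset ->
  \sum_(i <- (T `|` U)%fset) F i = \sum_(i <- T) F i + \sum_(i <- U) F i.
Proof.
move=> TU; rewrite -big_cat /=; apply: perm_big; apply: uniq_perm.
- exact: fset_uniq.
- rewrite cat_uniq !fset_uniq andbT /=; apply/hasPn => x xU.
  by apply: contraL TU => xT; apply/negP => /fdisjointP /(_ x xT); rewrite xU.
by move=> x; rewrite mem_cat inE.
Qed.

Lemma gsgnUl T U W : [disjoint T & U]%fset ->
  gsgn R (T `|` U)%fset W = gsgn R T W * gsgn R U W.
Proof. by move=> TU; rewrite /gsgn -exprD big_fsetU. Qed.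

Lemma gsgnUr T U W : [disjoint U & W]%fset ->
  gsgn R T (U `|` W)%fset = gsgn R T U * gsgn R T W.
Proof.
move=> UW; rewrite /gsgn -exprD -big_split /=; congr (_ ^+ _).
by apply: eq_bigr => t _; rewrite big_fsetU.
Qed.

Lemma gsgn0l U : gsgn R fset0 U = 1.
Proof. by rewrite /gsgn big_seq_fset0 expr0. Qed.

Lemma gsgn0r U : gsgn R U fset0 = 1.
Proof. by rewrite /gsgn big1 ?expr0 // => t _; rewrite big_seq_fset0. Qed.

(** For t in T and u in U exactly one of u < t and t < u holds, so the two exponents add up to the
    number of pairs. *)
Lemma gsgnM T U : [disjoint T & U]%fset ->
  gsgn R T U * gsgn R U T = (-1) ^+ (#|` T|%fset * #|` U|%fset).
Proof.
move=> TU; rewrite /gsgn [X in _ * (-1) ^+ X]exchange_big /= -exprD -big_split /=.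
congr (_ ^+ _); rewrite -[#|` T|%fset]muln1 -sum1_size big_distrl /= big_distrl /=.
rewrite big_seq [RHS]big_seq; apply: eq_bigr => t tT; rewrite -big_split /=.
rewrite muln1 mul1n -sum1_size big_seq [RHS]big_seq; apply: eq_bigr => u uU.
case: ltngtP => // tu; move: (fdisjointP TU t tT); by rewrite -tu uU.
Qed.

Lemma gsgnC T U : [disjoint T & U]%fset ->
  gsgn R U T = (-1) ^+ (#|` T|%fset * #|` U|%fset) * gsgn R T U.
Proof.
by move=> TU; rewrite -gsgnM // mulrAC /gsgn -expr2 sqrr_sign mul1r.
Qed.

Fact gadd_assoc : associative (@gadd R).
Proof. by move=> f g h; apply: grassP => S; rewrite !gaddE addrA. Qed.
Fact gadd_comm : commutative (@gadd R).
Proof. by move=> f g; apply: grassP => S; rewrite !gaddE addrC. Qed.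
Fact gadd0 : left_id (gzero R) (@gadd R).
Proof. by move=> f; apply: grassP => S; rewrite gaddE gzeroE add0r. Qed.
Fact gaddN : left_inverse (gzero R) (@gopp R) (@gadd R).
Proof. by move=> f; apply: grassP => S; rewrite gaddE gscaleE gzeroE mulN1r addNr. Qed.

Lemma fsubD_disj S T : [disjoint T & S `\` T]%fset.
Proof. by apply/fdisjointP => x xT; rewrite inE xT. Qed.

(** Both sides are sums over ordered partitions of S into three parts U, V, W, with the product of
    the three pairwise signs. One side picks U and then V in its complement, the other picks the
    union T of U and V and then U inside T. *)
Fact gmul_assoc : associative (@gmul R).
Proof.
move=> f g h; apply: grassP => S; rewrite !gmulE.
pose s (U V W : {fset nat}) := gsgn R U V * gsgn R U W * gsgn R V W * (f U * g V * h W).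
transitivity (\sum_(U <- fpowerset S) \sum_(V <- fpowerset (S `\` U)%fset)
    s U V (S `\` (U `|` V))%fset).
  rewrite big_seq [RHS]big_seq; apply: eq_bigr => U; rewrite fpowersetE => US.
  rewrite gmulE mulr_sumr big_seq [RHS]big_seq; apply: eq_bigr => V; rewrite fpowersetE => VS.
  rewrite /s -fsetDDl.
  have -> : gsgn R U (S `\` U)%fset = gsgn R U V * gsgn R U ((S `\` U) `\` V)%fset.
    by rewrite -gsgnUr ?fsubD_disj // -{1}(fsetID V (S `\` U)%fset) (fsetIidPr VS).
  ring.
transitivity (\sum_(T <- fpowerset S) \sum_(U <- fpowerset T) s U (T `\` U)%fset (S `\` T)%fset);
    last first.
  rewrite big_seq [RHS]big_seq; apply: eq_bigr => T; rewrite fpowersetE => TS.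
  rewrite gmulE mulr_sumr mulr_suml big_seq [RHS]big_seq; apply: eq_bigr => U; rewrite fpowersetE => UT.
  have -> : gsgn R T (S `\` T)%fset = gsgn R U (S `\` T)%fset * gsgn R (T `\` U)%fset (S `\` T)%fset.
    by rewrite -gsgnUl ?fsubD_disj // -{1}(fsetID U T) (fsetIidPr UT).
  by rewrite /s; ring.
under [RHS]eq_big_seq => T do [rewrite fpowersetE => TS; rewrite (big_fpowerset_sub _ TS)].
rewrite (exchange_big_dep xpredT) //=.
rewrite big_seq [RHS]big_seq; apply: eq_bigr => U; rewrite fpowersetE => US.
rewrite -[RHS]big_filter [RHS](@big_seq_bij _ _ _ (fpowerset (S `\` U)%fset) _
    (fun V => U `|` V)%fset (fun T => T `\` U)%fset).
- rewrite big_seq [RHS]big_seq; apply: eq_bigr => V; rewrite fpowersetE => VS.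
  congr (s _ _ _); rewrite fsetDUl fsetDv fset0U; apply/esym/fsetDidPl.
  by rewrite fdisjoint_sym; apply: fdisjointWr VS (fsubD_disj _ _).
- exact: fset_uniq.
- exact/filter_uniq/fset_uniq.
- move=> V; rewrite mem_filter !fpowersetE fsubsetUl fsubUset US /= => VS.
  exact: fsubset_trans VS (fsubsetDl _ _).
- by move=> T; rewrite mem_filter !fpowersetE => /andP[_ TS]; apply: fsetSD.
- move=> V; rewrite fpowersetE => VS; rewrite fsetDUl fsetDv fset0U; apply/fsetDidPl.
  by rewrite fdisjoint_sym; apply: fdisjointWr VS (fsubD_disj _ _).
- by move=> T; rewrite mem_filter => /andP[UT _]; rewrite -{2}(fsetID U T) (fsetIidPr UT).
Qed.

Fact gmul1g : left_id (gone R) (@gmul R).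
Proof.
move=> f; apply: grassP => S; rewrite gmulE (big_fsetD1 fset0) ?fpowersetE ?fsub0set //=.
rewrite big_seq big1 ?addr0 => [|T]; first by rewrite goneE eqxx fsetD0 gsgn0l !mul1r.
by rewrite !inE goneE => /andP[/negPf -> _]; rewrite mulr0 mul0r.
Qed.

Fact gmulg1 : right_id (gone R) (@gmul R).
Proof.
move=> f; apply: grassP => S; rewrite gmulE (big_fsetD1 S) ?fpowersetE //=.
rewrite big_seq big1 ?addr0 => [|T].
  by rewrite goneE fsetDv eqxx gsgn0r mul1r mulr1.
rewrite !inE fpowersetE goneE fsetD_eq0 => /andP[nTS TS].
case: (boolP (S `<=` T)%fset) => [ST|_]; last by rewrite mulr0.
by rewrite eqEfsubset TS ST in nTS.
Qed.

Fact gmulDl : left_distributive (@gmul R) (@gadd R).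
Proof.
move=> f g h; apply: grassP => S; rewrite gaddE !gmulE -big_split /=.
by apply: eq_bigr => T _; rewrite gaddE; ring.
Qed.

Fact gmulDr : right_distributive (@gmul R) (@gadd R).
Proof.
move=> f g h; apply: grassP => S; rewrite gaddE !gmulE -big_split /=.
by apply: eq_bigr => T _; rewrite gaddE; ring.
Qed.

Fact gone_neq0 : gone R != gzero R.
Proof.
by apply/eqP => /(congr1 (fun f : Grass => f fset0)) /eqP; rewrite goneE gzeroE eqxx oner_eq0.
Qed.

HB.instance Definition _ := Choice.on Grass.
HB.instance Definition _ := GRing.isZmodule.Build Grass gadd_assoc gadd_comm gadd0 gaddN.
HB.instance Definition _ := GRing.Zmodule_isNzRing.Build Grass
  gmul_assoc gmul1g gmulg1 gmulDl gmulDr gone_neq0.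

Fact gscale_assoc (a b : C) f : gscale a (gscale b f) = gscale (a * b) f.
Proof. by apply: grassP => S; rewrite !gscaleE mulrA. Qed.
Fact gscale1 : left_id (1 : C) (@gscale R).
Proof. by move=> f; apply: grassP => S; rewrite gscaleE mul1r. Qed.
Fact gscaleDr : right_distributive (@gscale R) +%R.
Proof. by move=> a f g; apply: grassP => S; rewrite gscaleE !gaddE !gscaleE mulrDr. Qed.
Fact gscaleDl f : {morph (@gscale R)^~ f : a b / a + b >-> a + b}.
Proof. by move=> a b; apply: grassP => S; rewrite gaddE !gscaleE mulrDl. Qed.

HB.instance Definition _ := GRing.Zmodule_isLmodule.Build C Grass
  gscale_assoc gscale1 gscaleDr gscaleDl.

Fact gscaleAl (a : C) f g : a *: (f * g) = (a *: f) * g.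
Proof.
apply: grassP => S; rewrite gscaleE !gmulE mulr_sumr.
by apply: eq_bigr => T _; rewrite gscaleE; ring.
Qed.
HB.instance Definition _ := GRing.Lmodule_isLalgebra.Build C Grass gscaleAl.

Fact gscaleAr (a : C) f g : a *: (f * g) = f * (a *: g).
Proof.
apply: grassP => S; rewrite gscaleE !gmulE mulr_sumr.
by apply: eq_bigr => T _; rewrite gscaleE; ring.
Qed.
HB.instance Definition _ := GRing.Lalgebra_isAlgebra.Build C Grass gscaleAr.

Lemma gsumE (I : finType) (F : I -> Grass) : gsum F = \sum_i F i.
Proof. by rewrite unlock /reducebig /index_enum -enumT. Qed.

Fact ginv_is_zmod_morphism : zmod_morphism (@ginv R).
Proof. by move=> f g; apply: grassP => S; rewrite !(ginvE, gaddE, gscaleE); ring. Qed.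
HB.instance Definition _ := GRing.isZmodMorphism.Build Grass Grass (@ginv R) ginv_is_zmod_morphism.

Fact ginv_is_monoid_morphism : monoid_morphism (@ginv R).
Proof.
split=> [|f g]; apply: grassP => S.
  rewrite ginvE goneE; case: eqP => [->|_]; rewrite ?mulr0 // cardfs0 expr0 mul1r.
  by [].
rewrite ginvE !gmulE mulr_sumr big_seq [RHS]big_seq; apply: eq_bigr => T.
rewrite fpowersetE => TS; rewrite !ginvE -(cardfsID T S) (fsetIidPr TS) exprD; ring.
Qed.
HB.instance Definition _ := GRing.isMonoidMorphism.Build Grass Grass (@ginv R) ginv_is_monoid_morphism.

Lemma ginvZ (a : C) f : ginv (a *: f) = a *: ginv f.
Proof. by apply: grassP => S; rewrite !(ginvE, gscaleE); ring. Qed.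

Lemma ginvK : involutive (@ginv R).
Proof. by move=> f; apply: grassP => S; rewrite !ginvE signrMK. Qed.

(** The sign of moving a scalar past something of parity b, convertible with the conditional [ginv]
    of the definitions. Indexing by a parity makes signs compose by addition mod 2. *)
Definition ginvn (b : bool) f : Grass := if b then ginv f else f.

Fact ginvn_is_zmod_morphism b : zmod_morphism (ginvn b).
Proof. by case: b => f g //; apply: raddfB. Qed.
HB.instance Definition _ b :=
  GRing.isZmodMorphism.Build Grass Grass (ginvn b) (ginvn_is_zmod_morphism b).
Fact ginvn_is_monoid_morphism b : monoid_morphism (ginvn b).
Proof. by case: b; [exact: ginv_is_monoid_morphism | split]. Qed.
HB.instance Definition _ b :=
  GRing.isMonoidMorphism.Build Grass Grass (ginvn b) (ginvn_is_monoid_morphism b).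

Lemma ginvnZ b (a : C) f : ginvn b (a *: f) = a *: ginvn b f.
Proof. by case: b => //; apply: ginvZ. Qed.

Lemma ginvnA b1 b2 f : ginvn b1 (ginvn b2 f) = ginvn (b1 (+) b2) f.
Proof. by case: b1 b2 => [] [] //=; apply: ginvK. Qed.

Definition ghom (q : bool) f : Prop := gpart (~~ q) f = 0.

Lemma ghomP q f : ghom q f <-> forall S, odd #|` S|%fset != q -> f S = 0.
Proof.
split=> [fq S Sq|fq]; last first.
  apply: grassP => S; rewrite gpartE gzeroE; case: ifP => // Sq.
  by apply: fq; move: Sq; case: odd; case: (q).
have /(congr1 (fun h : Grass => h S)) := fq; rewrite gpartE gzeroE.
by move: Sq; case: odd; case: (q).
Qed.

Lemma ghom0 q : ghom q 0.
Proof. by apply/ghomP => S _; rewrite gzeroE. Qed.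

Lemma ghom1 : ghom false 1.
Proof. by apply/ghomP => S; rewrite goneE; case: (S =P fset0) => [->|//]; rewrite cardfs0. Qed.

Lemma ghomZ q (a : C) f : ghom q f -> ghom q (a *: f).
Proof. by move=> /ghomP fq; apply/ghomP => S Sq; rewrite gscaleE fq ?mulr0. Qed.

Lemma ghomM p q f g : ghom p f -> ghom q g -> ghom (p (+) q) (f * g).
Proof.
move=> /ghomP fp /ghomP gq; apply/ghomP => S Spq.
rewrite gmulE big_seq big1 // => T; rewrite fpowersetE => TS.
have := congr1 odd (cardfsID T S); rewrite (fsetIidPr TS) oddD => Sodd.
have [Tp|/fp ->] := boolP (odd #|` T|%fset == p); last by rewrite mulr0 mul0r.
have [Tq|/gq ->] := boolP (odd #|` S `\` T|%fset == q); last by rewrite mulr0.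
by rewrite -Sodd (eqP Tp) (eqP Tq) eqxx in Spq.
Qed.

Lemma ghom_part q f : ghom q (gpart q f).
Proof. by apply/ghomP => S Sq; rewrite gpartE (negPf Sq). Qed.

Lemma gpart_hom p q f : ghom q f -> gpart p f = if p == q then f else 0.
Proof.
move=> /ghomP fq; apply: grassP => S; rewrite gpartE.
have [-> | npq] := eqVneq p q; first by have [//|/fq ->] := eqVneq (odd #|` S|%fset) q.
by rewrite gzeroE; have [Sp|//] := eqVneq (odd #|` S|%fset) p; apply: fq; rewrite Sp.
Qed.

Lemma gpart_sum f : f = gpart false f + gpart true f.
Proof. by apply: grassP => S; rewrite gaddE !gpartE; case: odd; rewrite ?addr0 ?add0r. Qed.

Lemma gpartZ p (a : C) f : gpart p (a *: f) = a *: gpart p f.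
Proof. by apply: grassP => S; rewrite gscaleE !gpartE gscaleE; case: eqP; rewrite ?mulr0. Qed.

Lemma gpartD p f g : gpart p (f + g) = gpart p f + gpart p g.
Proof. by apply: grassP => S; rewrite gaddE !gpartE gaddE; case: eqP; rewrite ?addr0. Qed.

Lemma ginvn_hom b q f : ghom q f -> ginvn b f = (-1) ^+ (b && q) *: f.
Proof.
move=> /ghomP fq; case: b; last by rewrite scale1r.
apply: grassP => S; rewrite ginvE gscaleE -signr_odd.
by have [->|/fq ->] := eqVneq (odd #|` S|%fset) q; rewrite ?mulr0.
Qed.

Lemma ghom_inv b q f : ghom q f -> ghom q (ginvn b f).
Proof. by move=> fq; rewrite (ginvn_hom b fq); apply: ghomZ. Qed.

(** Supercommutativity with only one factor homogeneous: exchanging T with its complement costs -1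
    to the product of their sizes, and T has parity q wherever f is nonzero, which leaves the sign
    of [ginvn q] on g. *)
Lemma gmulC_hom q f g : ghom q f -> f * g = ginvn q g * f.
Proof.
move=> /ghomP fq; apply: grassP => S; rewrite !gmulE.
rewrite [RHS](@big_seq_bij _ _ _ (fpowerset S) _
    (fun T => S `\` T)%fset (fun T => S `\` T)%fset); first last.
- by move=> T; rewrite fpowersetE => TS; rewrite fsetDK.
- by move=> T; rewrite fpowersetE => TS; rewrite fsetDK.
- by move=> T _; rewrite fpowersetE fsubsetDl.
- by move=> T _; rewrite fpowersetE fsubsetDl.
- exact: fset_uniq.
- exact: fset_uniq.
rewrite big_seq [RHS]big_seq; apply: eq_bigr => T; rewrite fpowersetE => TS.
rewrite fsetDK // (gsgnC (fsubD_disj S T)).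
have [Tq|/fq ->] := eqVneq (odd #|` T|%fset) q; last by rewrite !(mulr0, mul0r).
rewrite exprM -[(-1) ^+ #|` T|%fset]signr_odd Tq.
have -> : ginvn q g (S `\` T)%fset = ((-1) ^+ q) ^+ #|` S `\` T|%fset * g (S `\` T)%fset.
  by case: q {fq Tq} => /=; rewrite ?expr1n ?mul1r ?ginvE ?expr1.
rewrite !mulrA -[_ * _ * _ * _ in RHS]mulrA; set e := _ ^+ _.
have ee : e * e = 1.
  by rewrite /e -exprMn; case: q {fq Tq e}; rewrite /= ?expr1 ?mulrNN ?mulr1 expr1n.
rewrite -[LHS]mul1r -ee; ring.
Qed.
End GrassmannRing.

(** * Signed weights of colored matchings *)

Section MatchingWeights.
Local Open Scope ring_scope.

(* The form on the span of lower vectors e_a (flag false) and upper dual vectors e^a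
   (flag true): supersymmetric, even, and with sum_a e^a (x) e_a acting as the copairing. *)
Record superform := SuperForm {
  sfR : comNzRingType;
  sfT : finType;
  sfp : sfT -> bool;
  sfG : bool -> bool -> sfT -> sfT -> sfR;
  sfd : sfR;
  sf_even : forall s t a b, sfp a != sfp b -> sfG s t a b = 0;
  sf_sym : forall s t a b, sfG s t a b = (-1) ^+ (sfp a) * sfG t s b a;
  sf_contr : forall s t a b, \sum_x sfG s true a x * sfG false t x b = sfG s t a b;
  sf_dual : forall a b, sfG false true a b = (a == b)%:R;
  sf_loop : \sum_x sfG true false x x = sfd }.

Variable B : superform.
Local Notation K := (sfR B).
Local Notation T := (sfT B).
Local Notation p := (@sfp B).
Local Notation G := (@sfG B).

(* Parity of the number of crossings of the strands {u, v} and {z, w}: as a sum of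
   comparisons it is symmetric in u, v and additive under joining strands end to end. *)
Definition cross (P : Type) (pos : P -> nat) (u v z w : P) : bool :=
  (pos u < pos z)%N (+) (pos v < pos z)%N (+) (pos u < pos w)%N (+) (pos v < pos w)%N.

Section OnePointSet.
Variables (P : finType) (pos : P -> nat) (ty : P -> bool).

(** A form that is symmetric only up to sign needs an orientation of the strand; the order of the
    end points supplies it. *)
Definition pairw (c : P -> T) (u v : P) : K :=
  if (pos u < pos v)%N then G (ty u) (ty v) (c u) (c v) else G (ty v) (ty u) (c v) (c u).

Definition strand_odd (f : P -> P) (c : P -> T) (z : P) : bool := p (c z) && p (c (f z)).

Definition crossw (f : P -> P) (c : P -> T) (z w : P) : K :=
  (-1) ^+ (strand_odd f c z && strand_odd f c w && cross pos z (f z) w (f w)).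

(** One end per strand. The strict inequality leaves out the fixed points of f, which represent
    erased points. *)
Definition lefts (f : P -> P) : {set P} := [set z | (pos z < pos (f z))%N].

Definition weight_on (L : {set P}) (f : P -> P) (c : P -> T) : K :=
  \prod_(z in L) pairw c z (f z) *
  \prod_(z in L) \prod_(w in L | (pos z < pos w)%N) crossw f c z w.

(* Signed state weight of the matching given by the involution f on its moved points:
   a product over strands, with a sign for each crossing of two odd strands. *)
Definition weight (f : P -> P) (c : P -> T) : K := weight_on (lefts f) f c.

Hypothesis pos_inj : injective pos.

Lemma pairwC c u v : pairw c u v = pairw c v u.
Proof. by rewrite /pairw; case: ltngtP => // /pos_inj ->. Qed.

Lemma pairw_even c u v : p (c u) != p (c v) -> pairw c u v = 0.
Proof. by rewrite /pairw => npp; case: ifP => _; rewrite sf_even // eq_sym. Qed.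

Lemma pairwE c u v :
  pairw c u v = (-1) ^+ (p (c u) && (pos v < pos u)%N) * G (ty u) (ty v) (c u) (c v).
Proof.
rewrite /pairw; case: ltngtP => [_|_|/pos_inj ->]; rewrite ?andbF ?andbT ?mul1r //.
have [e|n] := eqVneq (p (c u)) (p (c v)); last by rewrite !sf_even ?mulr0 // eq_sym.
by rewrite e -sf_sym.
Qed.

Lemma eq_weight_on (L : {set P}) f f' (c c' : P -> T) :
  (forall z, z \in L -> [/\ f z = f' z, c z = c' z & c (f z) = c' (f' z)]) ->
  weight_on L f c = weight_on L f' c'.
Proof.
move=> ff'; congr (_ * _).
  by apply: eq_bigr => z /ff' [<- cz cfz]; rewrite /pairw -cfz cz.
apply: eq_bigr => z zL; apply: eq_bigr => w /andP[wL _].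
have [fz cz cfz] := ff' _ zL; have [fw cw cfw] := ff' _ wL.
by rewrite /crossw /strand_odd -cfz -cfw -fz -fw cz cw.
Qed.

(** * Splitting off one strand *)

Section Extract.
Variables (f : P -> P) (c : P -> T).
Hypothesis fK : involutive f.

Lemma crosswfl z w : crossw f c (f z) w = crossw f c z w.
Proof.
rewrite /crossw /strand_odd fK [p (c (f z)) && _]andbC; congr (_ ^+ nat_of_bool _).
by congr (_ && _); rewrite /cross; do 4!case: (_ < _)%N.
Qed.

Lemma crosswfr z w : crossw f c z (f w) = crossw f c z w.
Proof.
rewrite /crossw /strand_odd fK [p (c (f w)) && _]andbC; congr (_ ^+ nat_of_bool _).
by congr (_ && _); rewrite /cross; do 4!case: (_ < _)%N.
Qed.

(** Between disjoint strands, interchanging the roles negates four comparisons of distinct points,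
    an even number. *)
Lemma crosswC z w : w != z -> w != f z -> crossw f c z w = crossw f c w z.
Proof.
move=> wz wfz; rewrite /crossw [strand_odd f c z && _]andbC; congr (_ ^+ nat_of_bool _).
have fwz : f w != z by apply: contra_neq wfz => <-; rewrite fK.
have fwfz : f w != f z by rewrite (inj_eq (can_inj fK)).
have sw u v : u != v -> (pos u < pos v)%N = ~~ (pos v < pos u)%N.
  by move=> uv; case: ltngtP => // /pos_inj e; rewrite e eqxx in uv.
congr (_ && _); rewrite /cross (sw w z) // (sw (f w) z) // (sw w (f z)) // (sw (f w) (f z)) //.
by do 4!case: (_ < _)%N.
Qed.

(** Crossing signs are symmetric, so the product over ordered pairs is one over unordered pairs.
    Hence any strand can be taken out, read from either of its ends x. *)
Lemma weight_on_extract (L : {set P}) u x :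
  (forall z, z \in L -> f z \notin L) -> u \in L -> (u == x) || (u == f x) ->
  weight_on L f c =
  pairw c x (f x) * \prod_(w in L :\ u) crossw f c x w * weight_on (L :\ u) f c.
Proof.
move=> Ltr uL ux.
have ->: pairw c x (f x) = pairw c u (f u).
  by case/orP: ux => /eqP ->; rewrite // fK pairwC.
have -> : \prod_(w in L :\ u) crossw f c x w = \prod_(w in L :\ u) crossw f c u w.
  by apply: eq_bigr => w _; case/orP: ux => /eqP ->; rewrite // crosswfl.
rewrite /weight_on (big_setD1 u) //= [X in _ * X](big_setD1 u) //=.
have -> : \prod_(w in L | (pos u < pos w)%N) crossw f c u w
        = \prod_(w in L :\ u | (pos u < pos w)%N) crossw f c u w.
  by apply: eq_bigl => w; rewrite !inE; case: eqVneq => [->|]; rewrite ?ltnn ?andbF.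
have -> : \prod_(z in L :\ u) \prod_(w in L | (pos z < pos w)%N) crossw f c z w
   = \prod_(z in L :\ u) (if (pos z < pos u)%N then crossw f c z u else 1)
   * \prod_(z in L :\ u) \prod_(w in L :\ u | (pos z < pos w)%N) crossw f c z w.
  rewrite -big_split /=; apply: eq_bigr => z zL.
  rewrite big_mkcondr (big_setD1 u) //=; congr (_ * _).
  by rewrite [RHS]big_mkcondr.
have -> : \prod_(w in L :\ u) crossw f c u w =
   \prod_(w in L :\ u | (pos u < pos w)%N) crossw f c u w
   * \prod_(z in L :\ u) (if (pos z < pos u)%N then crossw f c z u else 1).
  rewrite big_mkcondr -big_split /=; apply: eq_bigr => w; rewrite !inE => /andP[wu wL].
  have wfu : w != f u by apply: contraTneq wL => ->; apply: Ltr.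
  case: ltngtP => [_|_|/pos_inj e]; [by rewrite mulr1 | by rewrite mul1r crosswC |].
  by rewrite e eqxx in wu.
ring.
Qed.
End Extract.

(* Erases the points q and q' and joins the two strands ending there; when these are one
   and the same strand, it disappears as a closed loop. *)
Definition contract (f : P -> P) (q q' z : P) : P :=
  if (z == q) || (z == q') then z
  else if f z == q then f q' else if f z == q' then f q else f z.

Section ContractInvolution.
Variables (f : P -> P) (q q' : P).
Hypotheses (fK : involutive f) (fq : f q != q) (fq' : f q' != q') (qq' : q != q').

Lemma contract_inv : involutive (contract f q q').
Proof.
move=> z; rewrite {2}/contract !(inv_eq fK).
have [->|zq] := eqVneq z q; first by rewrite /contract eqxx.
have [->|zq'] := eqVneq z q'; first by rewrite /contract eqxx orbT.
have [zfq|zfq] := eqVneq z (f q).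
  have fq'q : f q' == q = false by rewrite (inv_eq fK) -zfq eq_sym (negPf zq').
  by rewrite /contract fq'q (negPf fq') fK eq_sym (negPf qq') eqxx.
have [zfq'|zfq'] := eqVneq z (f q').
  have fqq' : f q == q' = false by rewrite (inv_eq fK) -zfq' eq_sym (negPf zq).
  by rewrite /contract fqq' (negPf fq) fK eqxx.
by rewrite /contract fK !(inv_eq fK) (negPf zfq) (negPf zfq') (negPf zq) (negPf zq').
Qed.

Lemma contract_moved z :
  (contract f q q' z != z) = [&& z != q, z != q' & f z != z].
Proof.
rewrite /contract !(inv_eq fK).
have [->|zq] := eqVneq z q; first by rewrite eqxx.
have [->|zq'] := eqVneq z q'; first by rewrite eqxx.
have [->|zfq] := eqVneq z (f q).
  by rewrite fK (inj_eq (can_inj fK)) eq_sym qq' fq.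
have [->|zfq'] := eqVneq z (f q').
  by rewrite fK (inj_eq (can_inj fK)) qq' fq'.
by rewrite eq_sym.
Qed.
End ContractInvolution.

Definition recolor (c : P -> T) (q q' : P) (a : T) (z : P) : T :=
  if (z == q) || (z == q') then a else c z.

Lemma lefts_transversal f : involutive f -> forall z, z \in lefts f -> f z \notin lefts f.
Proof. by move=> fK z; rewrite !inE fK -leqNgt => /ltnW. Qed.

(** * Contraction of two adjacent points *)

Section Contraction.
Variables (f : P -> P) (q q' : P) (c : P -> T).
Hypotheses (fK : involutive f) (fq : f q != q) (fq' : f q' != q').
Hypotheses (qq' : (pos q < pos q')%N) (tq : ty q) (tq' : ty q' = false).
Hypothesis adj : forall z, f z != z -> ~~ ((pos q < pos z) && (pos z < pos q'))%N.
Local Notation f' := (contract f q q').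
Local Notation ca := (recolor c q q').

Let nqq' : q != q'. Proof. by apply: contraTneq qq' => ->; rewrite ltnn. Qed.

(** No remaining point lies between q and q', so both compare alike with every other one. The
    cancellation of crossing signs below comes from this. *)
Let adjE z : f z != z -> z != q -> z != q' -> (pos q' < pos z)%N = (pos q < pos z)%N.
Proof.
move=> /adj nz zq zq'; case: (ltngtP (pos q') (pos z)) => [h|h|/pos_inj e]; last by rewrite e eqxx in zq'.
  by rewrite (ltn_trans qq' h).
by apply/esym/negbTE; move: nz; rewrite h andbT.
Qed.

Let caE a z : z != q -> z != q' -> ca a z = c z.
Proof. by rewrite /recolor => /negPf -> /negPf ->. Qed.
Let caq a : ca a q = a. Proof. by rewrite /recolor eqxx. Qed.
Let caq' a : ca a q' = a. Proof. by rewrite /recolor eqxx orbT. Qed.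

Let ltn_moved z w : z != w -> (pos z < pos w)%N = ~~ (pos w < pos z)%N.
Proof. by move=> zw; case: ltngtP => // /pos_inj e; rewrite e eqxx in zw. Qed.

Let lefts_moved z : z \in lefts f -> f z != z.
Proof. by rewrite inE; apply: contraTneq => ->; rewrite ltnn. Qed.

(** A strand with adjacent ends has crossing parity 0 with every other strand; only its own value
    remains, and the sum of that over the color is [sfd B]. *)
Lemma contract_loop : f q = q' -> \sum_a weight f (ca a) = sfd B * weight f' c.
Proof.
move=> fqq'; have fq'q : f q' = q by rewrite -fqq' fK.
have qL : q \in lefts f by rewrite inE fqq'.
have f'E z : z != q -> z != q' -> f' z = f z.
  by move=> zq zq'; rewrite /contract !(inv_eq fK) fqq' fq'q (negPf zq) (negPf zq').
have eL : lefts f :\ q = lefts f'.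
  apply/setP => z; rewrite !inE.
  have [->|zq] := eqVneq z q; first by rewrite /contract eqxx ltnn.
  have [->|zq'] := eqVneq z q'; last by rewrite f'E.
  by rewrite /contract eqxx orbT fq'q ltnn ltnNge ltnW.
rewrite -sf_loop mulr_suml; apply: eq_bigr => a _.
rewrite /weight (weight_on_extract _ fK (lefts_transversal fK) qL (x := q)) ?eqxx // -eL.
rewrite fqq' /pairw qq' tq tq' caq caq'; congr (_ * _).
  rewrite big1 ?mulr1 // => w; rewrite !inE => /andP[wq wL].
  have wm : f w != w by apply: lefts_moved; rewrite inE.
  have wq' : w != q' by apply: contraTneq wL => ->; rewrite fq'q -leqNgt ltnW.
  have fwm : f (f w) != f w by rewrite fK eq_sym.
  rewrite /crossw /cross fqq' (adjE wm) // (adjE fwm) ?(inv_eq fK) ?fqq' ?fq'q //.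
  by rewrite addbb addFb addbb andbF.
apply: eq_weight_on => w; rewrite inE in_set1 => /andP[wq wL].
have wq' : w != q'.
  by apply: contraTneq wL => ->; rewrite inE fq'q -leqNgt ltnW.
by rewrite f'E // !caE // ?(inv_eq fK) ?fqq' ?fq'q.
Qed.

(** The strands {x, q} and {q', y} become {x, y}. Against a third strand the comparisons with q and
    q' cancel, so the two crossing signs multiply to that of {x, y}; the sum over the color is
    [sf_contr], and the sign that remains is one of orientation. *)
Lemma contract_join : f q != q' -> \sum_a weight f (ca a) = weight f' c.
Proof.
move=> fqq'; set x := f q; set y := f q'.
have fx : f x = q by rewrite /x fK.
have fy : f y = q' by rewrite /y fK.
have xq : x != q by []. 
have xq' : x != q' by [].
have yq' : y != q' by [].
have yq : y != q by rewrite /y (inv_eq fK) eq_sym.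
have xy : x != y by rewrite /x /y (inj_eq (can_inj fK)).
have yx : y != x by rewrite eq_sym.
have xm : f x != x by rewrite fx eq_sym.
have ym : f y != y by rewrite fy eq_sym.
have f'x : f' x = y by rewrite /contract (negPf xq) (negPf xq') fx eqxx.
have f'y : f' y = x by rewrite /contract (negPf yq) (negPf yq') fy eqxx eq_sym (negPf nqq').
have f'E z : z != q -> z != q' -> z != x -> z != y -> f' z = f z.
  by move=> zq zq' zx zy; rewrite /contract !(inv_eq fK) (negPf zq) (negPf zq') (negPf zx) (negPf zy).
(* Left ends of the strand through q, of the strand through q', and of the strand joining x to y. *)
pose u1 := if (pos x < pos q)%N then x else q.
pose u2 := if (pos y < pos q')%N then y else q'.
pose u3 := if (pos x < pos y)%N then x else y.
have u1P : (u1 == q) || (u1 == f q) by rewrite /u1 -/x; case: ifP; rewrite eqxx ?orbT.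
have u2P : (u2 == q') || (u2 == f q') by rewrite /u2 -/y; case: ifP; rewrite eqxx ?orbT.
have u1L : u1 \in lefts f.
  by rewrite /u1 inE; case: ifP => h; rewrite ?fx // -/x ltn_moved ?h // eq_sym.
have u2L : u2 \in lefts f :\ u1.
  rewrite !inE; apply/andP; split.
    by rewrite /u1 /u2; case: ifP => _; case: ifP => _ //; rewrite eq_sym.
  by rewrite /u2; case: ifP => h; rewrite ?fy // -/y ltn_moved ?h // eq_sym.
have f'K := contract_inv fK fq fq' nqq'.
have u3P : (u3 == x) || (u3 == f' x) by rewrite /u3 f'x; case: ifP; rewrite eqxx ?orbT.
have u3L : u3 \in lefts f'.
  by rewrite /u3 inE; case: ifP => h; rewrite ?f'x ?f'y // ltn_moved ?h // eq_sym.
pose L0 := lefts f :\ u1 :\ u2.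
have L0P z : z \in L0 -> [/\ z != q, z != q', z != x & z != y].
  rewrite !inE => /and3P[zu2 zu1 zL]; split.
  - apply: contraNneq zu1 => e; rewrite /u1; move: zL; rewrite e -/x.
    by rewrite ltn_moved 1?eq_sym // => /negPf ->.
  - apply: contraNneq zu2 => e; rewrite /u2; move: zL; rewrite e -/y.
    by rewrite ltn_moved 1?eq_sym // => /negPf ->.
  - by apply: contraNneq zu1 => e; rewrite /u1; move: zL; rewrite e fx => ->.
  - by apply: contraNneq zu2 => e; rewrite /u2; move: zL; rewrite e fy => ->.
have eL0 : lefts f' :\ u3 = L0.
  apply/setP => z.
  have [zq|zq] := eqVneq z q.
    by rewrite zq; apply/idP/idP => [|/L0P[]]; rewrite ?eqxx // !inE /contract eqxx ltnn andbF.
  have [zq'|zq'] := eqVneq z q'.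
    by rewrite zq'; apply/idP/idP => [|/L0P[]]; rewrite ?eqxx // !inE /contract eqxx orbT ltnn andbF.
  have [zx|zx] := eqVneq z x.
    rewrite zx; apply/idP/idP => [|/L0P[]]; rewrite ?eqxx // !inE f'x /u3.
    by case: ifP; rewrite ?eqxx ?andbF.
  have [zy|zy] := eqVneq z y.
    rewrite zy; apply/idP/idP => [|/L0P[]]; rewrite ?eqxx // !inE f'y /u3 (ltn_moved yx).
    by case: ifP; rewrite ?eqxx ?andbF.
  rewrite !inE f'E // /u1 /u2 /u3.
  by do 3!case: ifP => _; rewrite ?zq ?zq' ?zx ?zy.
have trL1 z : z \in lefts f :\ u1 -> f z \notin lefts f :\ u1.
  by rewrite in_setD1 => /andP[_ /(lefts_transversal fK)]; apply: contra; rewrite in_setD1 => /andP[].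
rewrite [RHS]/weight (weight_on_extract c f'K (lefts_transversal f'K) u3L u3P) eL0 f'x.
have wE a : weight f (ca a) =
    pairw (ca a) q x * pairw (ca a) q' y * crossw f (ca a) q q' *
    \prod_(w in L0) (crossw f (ca a) q w * crossw f (ca a) q' w) * weight_on L0 f' c.
  rewrite /weight (weight_on_extract _ fK (lefts_transversal fK) u1L u1P).
  rewrite (weight_on_extract _ fK trL1 u2L u2P) -/x -/y -/L0.
  rewrite (big_setD1 u2 u2L) /= -/L0 big_split /=.
  have -> : crossw f (ca a) q u2 = crossw f (ca a) q q'.
    by rewrite /u2; case: ifP => // _; rewrite crosswfr.
  have -> : weight_on L0 f (ca a) = weight_on L0 f' c.
    apply: eq_weight_on => z zL0; have [zq zq' zx zy] := L0P z zL0.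
    by rewrite f'E // !caE // (inv_eq fK).
  ring.
(* If the colors of x and y differ in parity, no color a matches both, and both sides vanish. *)
have [exy|nxy] := eqVneq (p (c x)) (p (c y)); last first.
  rewrite pairw_even // !mul0r big1 // => a _; rewrite wE.
  have [ax|ax] := eqVneq (p a) (p (c x)).
    by rewrite [pairw _ q' y]pairw_even ?(mulr0, mul0r) // caq' caE // ax.
  by rewrite pairw_even ?mul0r // caq caE.
rewrite pairwE -(sf_contr (ty x) (ty y)) !(mulr_sumr, mulr_suml).
apply: eq_bigr => a _; rewrite wE; congr (_ * _).
have [ax|ax] := eqVneq (p a) (p (c x)); last first.
  rewrite [pairw _ q x]pairw_even ?caq ?caE // sf_even ?(mulr0, mul0r) //.
  by rewrite eq_sym.
have cE w : w \in L0 -> crossw f (ca a) q w * crossw f (ca a) q' w = crossw f' c x w.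
  move=> wL0; have [wq wq' wx wy] := L0P w wL0.
  have wm : f w != w by apply: lefts_moved; move: wL0; rewrite !in_setD1 => /and3P[].
  have fwm : f (f w) != f w by rewrite fK eq_sym.
  rewrite /crossw /strand_odd -/x -/y f'x f'E // caq caq' !caE // ?(inv_eq fK) // ax -exy !andbb.
  rewrite -signr_addb; congr (_ ^+ nat_of_bool _).
  rewrite -andb_addr; congr (_ && _); rewrite /cross -/x -/y.
  rewrite (adjE wm) // (adjE fwm) ?(inv_eq fK) //.
  by do 6!case: (_ < _)%N.
rewrite (eq_bigr _ cE); congr (_ * _).
rewrite [pairw _ q x]pairwC !pairwE caq caq' !caE // tq tq' ax /crossw /strand_odd.
rewrite -/x -/y caq caq' !caE // ax -exy !andbb /cross qq'.
rewrite (ltn_moved xq') (adjE xm) // (ltn_moved yq') (adjE ym) //.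
rewrite (ltn_moved yx).
set e := p (c x); set b1 := (pos q < pos x)%N; set b2 := (pos q < pos y)%N; set b3 := (pos x < pos y)%N.
(* The orientation of {x, y} against those of the two old strands: the discrepancy is exactly the
   sign of their mutual crossing. *)
have -> : (-1) ^+ (e && ~~ b3) = (-1) ^+ (e && b1) * (-1) ^+ (e && ~~ b2) *
   (-1) ^+ (e && (true (+) ~~ b1 (+) b2 (+) b3)) :> K.
  by rewrite -!signr_addb; case: e b1 b2 b3 => [] [] [] [].
ring.
Qed.

Lemma weight_contract :
  \sum_a weight f (ca a) = sfd B ^+ (f q == q') * weight f' c.
Proof.
have [/contract_loop ->|/contract_join ->] := eqVneq (f q) q'; first by [].
by rewrite mul1r.
Qed.
End Contraction.
End OnePointSet.

(** The weight sees only the order of the points that f moves. So [h] has to respect positions and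
    to reach the left ends, and erased points may be dropped. *)
Lemma weight_transfer (P P' : finType) (pos : P -> nat) (pos' : P' -> nat)
    (ty : P -> bool) (ty' : P' -> bool) (f : P -> P) (f' : P' -> P') (c : P -> T)
    (c' : P' -> T) (h : P' -> P) :
  injective h ->
  (forall x y, (pos' x < pos' y)%N = (pos (h x) < pos (h y))%N) ->
  (forall x, ty (h x) = ty' x) -> (forall x, f (h x) = h (f' x)) ->
  (forall x, c (h x) = c' x) ->
  (forall z, z \in lefts pos f -> z \in codom h) ->
  weight pos ty f c = weight pos' ty' f' c'.
Proof.
move=> h_inj posh tyh fh ch hP.
have eL : lefts pos f = h @: lefts pos' f'.
  apply/setP => z; apply/idP/imsetP => [zL|[x xL ->]].
    by have /codomP[x zx] := hP z zL; exists x; rewrite // inE posh -fh -zx; move: zL; rewrite inE.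
  by move: xL; rewrite !inE posh fh.
rewrite /weight /weight_on eL !(big_imset _ (in2W h_inj)) /=; congr (_ * _).
  by apply: eq_bigr => x _; rewrite /pairw fh !tyh !ch -!posh.
apply: eq_bigr => x xL; rewrite big_mkcondr (big_imset _ (in2W h_inj)) [RHS]big_mkcondr /=.
apply: eq_bigr => y _; rewrite -posh; case: ifP => // _.
by rewrite /crossw /strand_odd /cross !fh !ch -!posh.
Qed.

Definition sum_map (A1 A2 : Type) (f1 : A1 -> A1) (f2 : A2 -> A2) (z : A1 + A2) : A1 + A2 :=
  match z with inl x => inl (f1 x) | inr y => inr (f2 y) end.

Lemma weight_sum (P1 P2 : finType) (pos : P1 + P2 -> nat) (ty : P1 + P2 -> bool)
    (f1 : P1 -> P1) (f2 : P2 -> P2) (c : P1 + P2 -> T) :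
  injective pos -> involutive f1 -> involutive f2 ->
  (forall x y, cross pos (inl x) (inl (f1 x)) (inr y) (inr (f2 y)) = false) ->
  weight pos ty (sum_map f1 f2) c =
  weight (pos \o inl) (ty \o inl) f1 (c \o inl) * weight (pos \o inr) (ty \o inr) f2 (c \o inr).
Proof.
move=> pos_inj f1K f2K ncr.
have fK : involutive (sum_map f1 f2) by case=> x /=; rewrite ?f1K ?f2K.
have nc x y : crossw pos (sum_map f1 f2) c (inl x) (inr y) = 1.
  by rewrite /crossw /= ncr andbF.
rewrite /weight /weight_on !big_sumType /= mulrACA.
congr (_ * _).
  congr (_ * _); apply: eq_big => [x|x _]; rewrite ?inE //.
  rewrite big_sumType /= [X in _ * X]big1 ?mulr1 => [|y _]; last by rewrite nc.
  by apply: eq_bigl => y; rewrite !inE.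
congr (_ * _); apply: eq_big => [y|y _]; rewrite ?inE //.
rewrite big_sumType /= [X in X * _]big1 ?mul1r => [|x _].
  by apply: eq_bigl => x; rewrite !inE.
by rewrite crosswC // nc.
Qed.
End MatchingWeights.

(** * Composition of diagrams by successive contractions *)

Section DiagramWeights.
Local Open Scope ring_scope.

(* Bottom points are read from left to right, then top points from right to left, so that
   the geometric crossings of the diagram are the interleavings in this linear order. *)
Definition posd (k l : nat) (x : 'I_(k + l)) : nat :=
  if (x < k)%N then x : nat else (k + k + l - x.+1)%N.
(** Top points carry dual vectors: the coefficient at an output basis vector is a pairing with the
    dual basis. *)
Definition tyd (k l : nat) (x : 'I_(k + l)) : bool := (k <= x)%N.
Definition join (T : Type) (k l : nat) (A : 'I_k -> T) (C : 'I_l -> T) (x : 'I_(k + l)) : T :=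
  match split x with inl i => A i | inr j => C j end.

Definition dweight (B : superform) (k l : nat) (f : 'I_(k + l) -> 'I_(k + l))
  (c : 'I_(k + l) -> sfT B) : sfR B := weight (@posd k l) (@tyd k l) f c.

Lemma posd_inj k l : injective (@posd k l).
Proof.
move=> x y; rewrite /posd => xy; apply: val_inj => /=; move: xy (ltn_ord x) (ltn_ord y).
by do 2!case: ifP; lia.
Qed.

Lemma posd_lshift k l (i : 'I_k) : posd (lshift l i) = i.
Proof. by rewrite /posd /= ltn_ord. Qed.

Lemma posd_rshift k l (i : 'I_l) : posd (rshift k i) = (k + l - i.+1)%N.
Proof. by rewrite /posd /= ltnNge leq_addr /=; lia. Qed.

Lemma tyd_lshift k l (i : 'I_k) : tyd (lshift l i) = false.
Proof. by rewrite /tyd /= leqNgt ltn_ord. Qed.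

Lemma tyd_rshift k l (i : 'I_l) : tyd (rshift k i) = true.
Proof. by rewrite /tyd /= leq_addr. Qed.

Definition posdE := (posd_lshift, posd_rshift).
Definition tydE := (tyd_lshift, tyd_rshift).

Lemma join_lshift (T : Type) k l (A : 'I_k -> T) (C : 'I_l -> T) i : join A C (lshift l i) = A i.
Proof. by rewrite /join (unsplitK (inl i)). Qed.

Lemma join_rshift (T : Type) k l (A : 'I_k -> T) (C : 'I_l -> T) i : join A C (rshift k i) = C i.
Proof. by rewrite /join (unsplitK (inr i)). Qed.

Lemma diagK k l (D : Diag k l) : involutive (sval D).
Proof. by move=> x; have /forallP/(_ x)/andP[/eqP] := svalP D. Qed.

Lemma diag_neq k l (D : Diag k l) x : sval D x != x.
Proof. by have /forallP/(_ x)/andP[] := svalP D. Qed.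

Lemma restrict_diag (P : finType) k l (f : P -> P) (h : 'I_(k + l) -> P) :
  injective h -> involutive f -> (forall x, f (h x) != h x) ->
  (forall x, f (h x) \in codom h) ->
  exists D : Diag k l, forall x, h (sval D x) = f (h x).
Proof.
move=> h_inj fK fh fhP.
pose g := [ffun x => iinv (fhP x)].
have gE x : h (g x) = f (h x) by rewrite ffunE f_iinv.
have gP : diag_ok g.
  apply/forallP => x; apply/andP; split; first by apply/eqP/h_inj; rewrite !gE fK.
  by apply: contra (fh x) => /eqP e; rewrite -gE e.
by exists (exist _ g gP).
Qed.

Section Composition.
Variables (k l p : nat) (D1 : Diag k l) (D2 : Diag l p).
Local Notation P := ('I_(k + l) + 'I_(l + p))%type.

(** The middle row occurs twice, reversed at the end of [D1] and in order at the start of [D2], so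
    its pairs are nested around the seam with pair 0 innermost. *)
Definition pos2 (z : P) : nat :=
  match z with inl x => posd x | inr y => (k + l + posd y)%N end.
Definition ty2 (z : P) : bool := match z with inl x => tyd x | inr y => tyd y end.
Definition midL (i : 'I_l) : P := inl (rshift k i).
Definition midR (i : 'I_l) : P := inr (lshift p i).
Definition outer (x : 'I_(k + p)) : P :=
  match split x with inl i => inl (lshift l i) | inr t => inr (rshift l t) end.
Definition join2 (T : Type) (A : 'I_k -> T) (Z : 'I_p -> T) (C : 'I_l -> T) (z : P) : T :=
  match z with inl x => join A C x | inr y => join C Z y end.

Lemma pos2_inj : injective pos2.
Proof.
have bound x : (posd (k := k) (l := l) x < k + l)%N.
  by rewrite /posd; have := ltn_ord x; case: ifP; lia.
move=> [x|x] [y|y] /=.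
- by move=> /posd_inj ->.
- by have := bound x; lia.
- by have := bound y; lia.
- by move=> /addnI /posd_inj ->.
Qed.

Lemma join2_recolor (B : superform) (A : 'I_k -> sfT B) (Z : 'I_p -> sfT B)
    (C : {ffun 'I_l -> sfT B}) i a z :
  recolor (join2 A Z C) (midL i) (midR i) a z =
  join2 A Z [ffun j => if j == i then a else C j] z.
Proof.
rewrite /recolor; case: z => x /=; rewrite /eq_op /= ?orbF -/(_ == _) /join.
  by case: split_ordP => j ->; rewrite ?eq_lrshift ?eq_rshift ?ffunE.
by case: split_ordP => j ->; rewrite ?eq_rlshift ?eq_lshift ?ffunE.
Qed.

Lemma weight_join2 (B : superform) (A : 'I_k -> sfT B) (Z : 'I_p -> sfT B)
    (C : 'I_l -> sfT B) :
  weight pos2 ty2 (sum_map (sval D1) (sval D2)) (join2 A Z C) =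
  dweight (sval D1) (join A C) * dweight (sval D2) (join C Z).
Proof.
rewrite weight_sum; [|exact: pos2_inj|exact: diagK|exact: diagK|]; last first.
  move=> x y; rewrite /cross /=.
  have lt u v : (posd (k := k) (l := l) u < k + l + posd (k := l) (l := p) v)%N.
    by rewrite /posd; have := ltn_ord u; case: ifP; lia.
  by rewrite !lt.
congr (_ * _); apply: (weight_transfer (h := id)) => //= [x y|z _].
  by rewrite ltn_add2l.
by apply/codomP; exists z.
Qed.

(* The j-th top point of D1 and the j-th bottom point of D2 become adjacent in pos2 once
   the previous pairs are contracted. The result does not depend on the form B. *)
Lemma contract_steps j : (j <= l)%N -> exists (f : P -> P) (e : nat),
  [/\ involutive f,
    forall z, (f z != z) = [forall i : 'I_l, (i < j)%N ==> (z != midL i) && (z != midR i)] &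
    forall (B : superform) (A : 'I_k -> sfT B) (Z : 'I_p -> sfT B) (C0 : {ffun 'I_l -> sfT B}),
      \sum_(C : {ffun 'I_l -> sfT B} | [forall i : 'I_l, (j <= i)%N ==> (C i == C0 i)])
        weight pos2 ty2 (sum_map (sval D1) (sval D2)) (join2 A Z C) =
      sfd B ^+ e * weight pos2 ty2 f (join2 A Z C0)].
Proof.
elim: j => [_|j IH jl].
  exists (sum_map (sval D1) (sval D2)), 0%N; split=> [[x|x]|z|B A Z C0] /=; rewrite ?diagK //.
    rewrite [RHS](_ : _ = true); last by apply/forallP.
    by case: z => x; rewrite /eq_op /=; apply: diag_neq.
  rewrite mul1r (big_pred1 C0) // => C; apply/forallP/eqP => [CC|-> //].
  by apply/ffunP => i; apply/eqP/CC.
have {IH} [f [e [fK fm fW]]] := IH (ltnW jl).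
pose i := Ordinal jl.
have fq : f (midL i) != midL i.
  rewrite fm; apply/forallP => i'; apply/implyP => i'j.
  rewrite /eq_op /= -/(_ == _) eq_rshift andbT.
  by apply: contraTneq i'j => <-; rewrite ltnn.
have fq' : f (midR i) != midR i.
  rewrite fm; apply/forallP => i'; apply/implyP => i'j.
  rewrite /eq_op /= -/(_ == _) eq_lshift.
  by apply: contraTneq i'j => <-; rewrite ltnn.
have qq' : (pos2 (midL i) < pos2 (midR i))%N by rewrite /= !posdE /=; lia.
(* Between the two points of pair j lie only the pairs of smaller index, which are already
   erased. *)
have adj z : f z != z -> ~~ ((pos2 (midL i) < pos2 z) && (pos2 z < pos2 (midR i)))%N.
  rewrite fm => /forallP fz; apply/negP => /andP[]; rewrite /= !posdE /=.
  case: z fz => x; case: (split_ordP x) => i' -> fz; rewrite /= posdE; try by have := ltn_ord i'; lia.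
    have /implyP := fz i' => H h1 h2; have /H : (i' < j)%N by have := ltn_ord i'; lia.
    by rewrite eqxx.
  have /implyP := fz i' => H h1 h2; have /H : (i' < j)%N by lia.
  by rewrite eqxx andbF.
exists (contract f (midL i) (midR i)), (e + (f (midL i) == midR i))%N; split.
- exact: contract_inv.
- move=> z; rewrite contract_moved // fm.
  apply/and3P/forallP => [[zq zq' /forallP H] i'|H].
    rewrite ltnS leq_eqVlt; apply/implyP => /orP[/eqP e'|]; last exact/implyP.
    have -> : i' = i by apply: val_inj.
    by rewrite zq.
  have /andP[] := implyP (H i) (leqnn _); split=> //.
  by apply/forallP => i'; apply/implyP => i'j; apply: (implyP (H i')); apply: ltnW.
move=> B A Z C0; rewrite exprD -mulrA -weight_contract //; try exact: pos2_inj.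
- rewrite (partition_big (fun C : {ffun 'I_l -> sfT B} => C i) xpredT) //= mulr_sumr.
  apply: eq_bigr => a _.
  have -> : recolor (join2 A Z C0) (midL i) (midR i) a
      = join2 A Z [ffun i' => if i' == i then a else C0 i'].
    by apply: funext => z; apply: join2_recolor.
  rewrite -fW; apply: eq_bigl => C; apply/andP/forallP => [[/forallP H /eqP Ci] i'|H].
    rewrite ffunE; apply/implyP => ji'; case: (eqVneq i' i) => [->|ne]; first by rewrite Ci.
    apply: (implyP (H i')); rewrite ltn_neqAle ji' andbT eq_sym.
    by apply: contra ne => /eqP e'; apply/eqP/val_inj.
  split; last by have := implyP (H i) (leqnn _); rewrite ffunE eqxx.
  apply/forallP => i'; apply/implyP => ji'.
  have := implyP (H i') (ltnW ji'); rewrite ffunE; case: (eqVneq i' i) => // e'.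
  by rewrite e' ltnn in ji'.
- by rewrite /= tydE.
- by rewrite /= tydE.
Qed.

(** [D3] and [e] are fixed before the form is chosen, so any convenient form may be used to compute
    them. The coloring [C0] is an argument because the set of colors may be empty. *)
Lemma compose_exists : exists (D3 : Diag k p) (e : nat),
  forall (B : superform) (A : 'I_k -> sfT B) (Z : 'I_p -> sfT B) (C0 : 'I_l -> sfT B),
    \sum_(C : {ffun 'I_l -> sfT B}) dweight (sval D1) (join A C) * dweight (sval D2) (join C Z) =
    sfd B ^+ e * dweight (sval D3) (join A Z).
Proof.
have [f [e [fK fm fW]]] := contract_steps (leqnn l).
have outer_inj : injective outer.
  move=> x y; rewrite /outer; case: split_ordP => i ->; case: split_ordP => j -> //.
    by move=> [/val_inj ->].
  by move=> [] /addnI /val_inj ->.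
have outerP z : (z \in codom outer) = [forall i : 'I_l, (z != midL i) && (z != midR i)].
  apply/codomP/forallP => [[x ->] i|H].
    by rewrite /outer; case: split_ordP => j _; rewrite /eq_op /= -!/(_ == _) eq_shift.
  case: z H => x; case: (split_ordP x) => j -> H.
  - by exists (lshift p j); rewrite /outer (unsplitK (inl j)).
  - by have := H j; rewrite eqxx.
  - by have := H j; rewrite eqxx andbF.
  - by exists (rshift k j); rewrite /outer (unsplitK (inr j)).
have fm' z : (f z != z) = (z \in codom outer).
  by rewrite fm outerP; apply: eq_forallb => i; rewrite ltn_ord.
have [D3 D3E] : exists D3 : Diag k p, forall x, outer (sval D3 x) = f (outer x).
  apply: restrict_diag => // x; first by rewrite fm' codom_f.
  by rewrite -fm' fK eq_sym fm' codom_f.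
exists D3, e => B A Z C0; transitivity
  (\sum_(C : {ffun 'I_l -> sfT B} | [forall i : 'I_l, (l <= i)%N ==> (C i == [ffun i => C0 i] i)])
        weight pos2 ty2 (sum_map (sval D1) (sval D2)) (join2 A Z C)).
  apply: eq_big => [C|C _]; last by rewrite weight_join2.
  by apply/esym/forallP => i; rewrite leqNgt ltn_ord.
rewrite fW; congr (_ * _); apply: (weight_transfer (h := outer)) => //.
- move=> x y; rewrite /outer.
  by case: split_ordP => i ->; case: split_ordP => j ->; rewrite /= !posdE;
    have := ltn_ord i; have := ltn_ord j; lia.
- by move=> x; rewrite /outer; case: split_ordP => i ->; rewrite /= !tydE.
- move=> x; rewrite /outer /=; case: split_ordP => i -> /=.
    by rewrite !join_lshift.
  by rewrite !join_rshift.
- by move=> z; rewrite -fm' inE; apply: contraTneq => ->; rewrite ltnn.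
Qed.
End Composition.
End DiagramWeights.

(** * Identification of the composite by counting colorings *)

Section BooleanColorings.
Local Open Scope ring_scope.

Fact boolform_contr (a b : bool) : \sum_x (a == x)%:R * (x == b)%:R = (a == b)%:R :> int.
Proof. by rewrite big_bool; case: a b => [] []. Qed.
Fact boolform_loop : \sum_(x : bool) (x == x)%:R = 2%:R :> int.
Proof. by rewrite big_bool. Qed.
Fact boolform_sym (a b : bool) : (a == b)%:R = (-1) ^+ false * (b == a)%:R :> int.
Proof. by rewrite mul1r eq_sym. Qed.

(* The case (m|n) = (2|0): the weights are indicator functions of colorings, and they
   determine the diagram and the number of loops. *)
Definition boolform : superform :=
  @SuperForm int bool (fun=> false) (fun _ _ a b => (a == b)%:R) 2%:R
    (fun _ _ _ _ e => match notF e with end)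
    (fun _ _ => boolform_sym) (fun _ _ => boolform_contr) (fun _ _ => erefl) boolform_loop.

Definition strandwise (P : finType) (f : P -> P) (c : P -> bool) : bool :=
  [forall x, c x == c (f x)].

Lemma dweight_bool k l (D : Diag k l) (c : 'I_(k + l) -> bool) :
  dweight (B := boolform) (sval D) c = (strandwise (sval D) c)%:R.
Proof.
rewrite /dweight /weight /weight_on [X in _ * X]big1 ?mulr1 => [|z _]; last first.
  by rewrite big1 // => w _; rewrite /crossw expr0.
rewrite (eq_bigr (fun z => (c z == c (sval D z))%:R)) => [|z _]; last first.
  by rewrite /pairw /=; case: ifP; rewrite // eq_sym.
have [/forallP H|/forallPn[x nx]] := boolP (strandwise _ _).
  by rewrite big1 // => z _; rewrite H.
have [lx|gx] := boolP (x \in lefts (@posd k l) (sval D)).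
  by rewrite (bigD1 x) //= (negPf nx) mul0r.
rewrite (bigD1 (sval D x)) /=; first by rewrite diagK eq_sym (negPf nx) mul0r.
move: gx; rewrite !inE diagK -leqNgt leq_eqVlt => /orP[/eqP/posd_inj/eqP|//].
by rewrite (negPf (diag_neq _ _)).
Qed.

(** The indicator of one strand of D is constant on the strands of D', which forces D' to have that
    strand. *)
Lemma strandwise_inj k l (D D' : Diag k l) :
  (forall c, strandwise (sval D) c = strandwise (sval D') c) -> D = D'.
Proof.
move=> DD'; apply: val_inj; apply/ffunP => x; apply/esym/eqP.
have : strandwise (sval D) (pred2 x (sval D x)).
  by apply/forallP => y /=; rewrite !(inv_eq (diagK D)) diagK orbC.
rewrite DD' => /forallP/(_ x); rewrite /= eqxx (negPf (diag_neq _ _)) /=.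
by move/eqP => <-.
Qed.

Lemma strandwise_cst k l (D : Diag k l) : strandwise (sval D) (fun=> true).
Proof. exact/forallP. Qed.

Lemma partnerE k l (D : Diag k l) (x : 'I_(k + l)) : partner D x = sval D x.
Proof. by rewrite /partner valK. Qed.

(** * Colorings of the concatenation graph *)

Section Count.
Variables (k l p : nat) (D1 : Diag k l) (D2 : Diag l p).
Local Notation e := (cedge D1 D2).

Definition emb2 (y : 'I_(l + p)) : 'I_(k + l + p) := cast_ord (addnA k l p) (rshift k y).

Lemma cedgeP x y : e x y ->
  (exists u, x = lshift p u /\ y = lshift p (sval D1 u)) \/
  (exists v, x = emb2 v /\ y = emb2 (sval D2 v)).
Proof.
case/orP => /and3P[hx hy /eqP xy]; [left|right].
  by exists (Ordinal hx); split; apply: val_inj; rewrite //= -xy -partnerE.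
have xlt : (x - k < l + p)%N by have := ltn_ord x; lia.
exists (Ordinal xlt); split; apply: val_inj => /=; first by lia.
by rewrite -partnerE /= xy; lia.
Qed.

Lemma cedge1 u : e (lshift p u) (lshift p (sval D1 u)).
Proof. by apply/orP; left; rewrite /= !ltn_ord partnerE eqxx. Qed.

Lemma cedge2 v : e (emb2 v) (emb2 (sval D2 v)).
Proof. by apply/orP; right; rewrite /= !leq_addr !addKn partnerE eqxx. Qed.

Lemma cedge_sym : symmetric e.
Proof.
suff sym x y : e x y -> e y x by move=> x y; apply/idP/idP; apply: sym.
case/cedgeP => [] [u [-> ->]].
  by rewrite -[in X in e _ X](diagK D1 u); apply: cedge1.
by rewrite -[in X in e _ X](diagK D2 u); apply: cedge2.
Qed.

Definition fullcol (A : 'I_k -> bool) (Z : 'I_p -> bool) (C : 'I_l -> bool) :=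
  join (join A C) Z.

Lemma fullcol_emb2 A Z C v : fullcol A Z C (emb2 v) = join C Z v.
Proof.
rewrite /fullcol /emb2; case: (split_ordP v) => j ->.
  rewrite (_ : cast_ord _ _ = lshift p (rshift k j)); last exact: val_inj.
  by rewrite !(join_lshift, join_rshift).
rewrite (_ : cast_ord _ _ = rshift (k + l) j); last by apply: val_inj => /=; lia.
by rewrite !(join_lshift, join_rshift).
Qed.

Lemma fullcol_cemb A Z C i : fullcol A Z C (cemb l i) = join A Z i.
Proof.
rewrite /cemb [RHS]/join; case: split_ordP => j _;
  by rewrite /fullcol !(join_lshift, join_rshift).
Qed.

Lemma strandwise_fullcol A Z C :
  strandwise (sval D1) (join A C) && strandwise (sval D2) (join C Z) ->
  forall x y, connect e x y -> fullcol A Z C x = fullcol A Z C y.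
Proof.
move=> /andP[/forallP H1 /forallP H2] x y xy.
apply: (@closed_connect _ e (fullcol A Z C) _ x y xy) => {xy}x {}y.
case/cedgeP => [] [u [-> ->]]; rewrite /in_mem /= ?fullcol_emb2.
  by rewrite /fullcol !join_lshift; apply/eqP.
exact/eqP.
Qed.

Lemma fullcol_strandwise A Z C :
  (forall x y, e x y -> fullcol A Z C x = fullcol A Z C y) ->
  strandwise (sval D1) (join A C) && strandwise (sval D2) (join C Z).
Proof.
move=> H; apply/andP; split; apply/forallP => u; apply/eqP.
  by have := H _ _ (cedge1 u); rewrite /fullcol !join_lshift.
by have := H _ _ (cedge2 u); rewrite !fullcol_emb2.
Qed.

Definition loopset : {set 'I_(k + l + p)} :=
  [set x | cmiddle x && [forall y, connect e x y ==> cmiddle y && (x <= y)%N]].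

Lemma card_loopset : #|loopset| = nloops D1 D2.
Proof. by apply: eq_card => x; rewrite !inE. Qed.

Definition midpt (i : 'I_l) : 'I_(k + l + p) := lshift p (rshift k i).

Lemma middleP x : (exists i, x = midpt i /\ cmiddle x) \/
  (exists i, x = cemb l i /\ cmiddle x = false).
Proof.
rewrite /cmiddle; case: (split_ordP x) => y ->; last first.
  right; exists (rshift k y); split; first by rewrite /cemb (unsplitK (inr _)).
  by rewrite /=; lia.
case: (split_ordP y) => j ->; [right; exists (lshift p j)|left; exists j]; split => //=.
- by rewrite /cemb (unsplitK (inl _)).
- by have := ltn_ord j; lia.
- by have := ltn_ord j; lia.
Qed.

(** A component without outer points lies in the middle row and is represented by its least point,
    as in [nloops]. *)
Lemma component_cases x : (exists o, connect e x (cemb l o)) \/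
  (exists2 r, r \in loopset & connect e x r).
Proof.
have [/existsP|/existsPn no] := boolP [exists o, connect e x (cemb l o)]; [by left|right].
have mid y : connect e x y -> cmiddle y.
  by case: (middleP y) => [[i []] //|[i [-> _]]]; rewrite (negPf (no i)).
case: (arg_minnP (fun y : 'I_(k + l + p) => val y) (connect0 e x)) => r xr rmin.
exists r => //; rewrite inE mid //=; apply/forallP => y; apply/implyP => ry.
have xy := connect_trans xr ry; by rewrite mid //=; apply: rmin.
Qed.

(** A component meeting the outer rows takes its color from there, provided the outer colors on it
    agree; a closed loop is colored freely. So the admissible middle colorings correspond to the
    subsets of [loopset]. *)
Lemma card_colorings (A : 'I_k -> bool) (Z : 'I_p -> bool) :
  #|[set C : {ffun 'I_l -> bool} | strandwise (sval D1) (join A C)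
                                   && strandwise (sval D2) (join C Z)]| =
  ([forall i, forall j, connect e (cemb l i) (cemb l j) ==> (join A Z i == join A Z j)]
    * 2 ^ nloops D1 D2)%N.
Proof.
have esym : connect_sym e := sym_connect_sym cedge_sym.
set good := [set C | _].
have goodP C : C \in good -> forall x y, connect e x y -> fullcol A Z C x = fullcol A Z C y.
  by rewrite inE; apply: strandwise_fullcol.
set cst := [forall i, _]; have [/forallP H|nH] := boolP cst; last first.
  rewrite mul0n; apply/eqP; rewrite cards_eq0 -subset0; apply/subsetP => C CG; case/negP: nH.
  apply/forallP => i; apply/forallP => j; apply/implyP => ij.
  by have := goodP C CG _ _ ij; rewrite !fullcol_cemb => ->.
rewrite mul1n -card_loopset -card_powerset.
pose phi (C : {ffun 'I_l -> bool}) := [set x in loopset | fullcol A Z C x].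
have phi_inj : {in good &, injective phi}.
  move=> C C' CG C'G eq_phi; apply/ffunP => i.
  have fE C0 : fullcol A Z C0 (midpt i) = C0 i by rewrite /fullcol !(join_lshift, join_rshift).
  rewrite -(fE C) -(fE C').
  case: (component_cases (midpt i)) => [[o io]|[r rL ir]].
    by rewrite (goodP C CG _ _ io) (goodP C' C'G _ _ io) !fullcol_cemb.
  rewrite (goodP C CG _ _ ir) (goodP C' C'G _ _ ir).
  by have /setP/(_ r) := eq_phi; rewrite !inE; move: rL; rewrite inE => ->.
rewrite -(card_in_imset phi_inj); congr #|pred_of_set _|; apply/setP => Y.
rewrite powersetE; apply/imsetP/idP => [[C CG ->]|YL].
  by apply/subsetP => x; rewrite inE => /andP[].
(* The coloring in which Y is the set of loops colored true: outer colors propagate along their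
   components, and loops follow Y. *)
pose g x := if [pick o | connect e x (cemb l o)] is Some o then join A Z o
            else [exists r in Y, connect e x r].
pose C := [ffun i => g (midpt i)].
have gE x : fullcol A Z C x = g x.
  case: (middleP x) => [[i [-> _]]|[i [-> _]]].
    by rewrite /fullcol !(join_lshift, join_rshift) ffunE.
  rewrite fullcol_cemb /g; case: pickP => [o io|/(_ i)]; last by rewrite connect0.
  by apply/eqP; have /forallP/(_ o)/implyP := H i; apply.
have gC x y : connect e x y -> g x = g y.
  move=> xy; rewrite /g (eq_pick (Q := fun o => connect e y (cemb l o))) => [|o]; last first.
    exact: same_connect.
  case: pickP => // _; apply: eq_existsb => r; congr (_ && _); exact: same_connect.
exists C.
  rewrite inE; apply: fullcol_strandwise => x y xy; rewrite !gE; apply: gC.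
  exact: connect1.
apply/setP => x; rewrite inE gE; apply/idP/andP => [xY|[xL]].
  have xL := subsetP YL x xY; split=> //; rewrite /g; case: pickP => [o xo|_].
    move: xL; rewrite inE => /andP[_ /forallP/(_ (cemb l o))]; rewrite xo /=.
    by case: (middleP (cemb l o)) => [[i [e1 _]]|[i [_ ->]]] //; move: e1; rewrite /cemb;
       case: split_ordP => j _ /eqP; rewrite /midpt ?eq_shift.
  by apply/existsP; exists x; rewrite xY connect0.
rewrite /g; case: pickP => [o xo|_].
  move: xL; rewrite inE => /andP[_ /forallP/(_ (cemb l o))]; rewrite xo /=.
  by case: (middleP (cemb l o)) => [[i [e1 _]]|[i [_ ->]]] //; move: e1; rewrite /cemb;
     case: split_ordP => j _ /eqP; rewrite /midpt ?eq_shift.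
move=> /existsP[r /andP[rY xr]]; suff -> : x = r by [].
have rL := subsetP YL r rY; apply: val_inj; apply/eqP; rewrite eqn_leq.
move: xL rL; rewrite !inE => /andP[_ /forallP/(_ r)] + /andP[_ /forallP/(_ x)].
by rewrite xr esym xr /= => /andP[_ ->] /andP[_ ->].
Qed.

Lemma join_lrshift (T : Type) (c : 'I_(k + p) -> T) :
  join (fun i => c (lshift p i)) (fun j => c (rshift k j)) = c.
Proof. by apply: funext => x; rewrite /join; case: split_ordP => i ->. Qed.

Lemma sum_dweight_bool (A : 'I_k -> bool) (Z : 'I_p -> bool) :
  \sum_(C : {ffun 'I_l -> bool}) dweight (B := boolform) (sval D1) (join A C)
     * dweight (B := boolform) (sval D2) (join C Z) =
  ([forall i, forall j, connect e (cemb l i) (cemb l j) ==> (join A Z i == join A Z j)]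
    * 2 ^ nloops D1 D2)%:R.
Proof.
rewrite -card_colorings cardE -sum1_size natr_sum big_enum [RHS]big_mkcond /=.
by apply: eq_bigr => C _; rewrite !dweight_bool -natrM mulnb inE; case: (_ && _).
Qed.

(** At [boolform], [compose_exists] is an equality of counts with [card_colorings]. Constant
    colorings give the exponent; once it is cancelled, indicators of strands and of components give
    the two directions of [connE]. *)
Theorem compose_dweight : exists2 D3 : Diag k p, sval D3 = rawcomp D1 D2 &
  forall (B : superform) (A : 'I_k -> sfT B) (Z : 'I_p -> sfT B),
    \sum_(C : {ffun 'I_l -> sfT B}) dweight (sval D1) (join A C) * dweight (sval D2) (join C Z) =
    sfd B ^+ nloops D1 D2 * dweight (sval D3) (join A Z).
Proof.
have [D3 [n D3E]] := compose_exists D1 D2.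
have count A Z :
  ([forall i, forall j, connect e (cemb l i) (cemb l j) ==> (join A Z i == join A Z j)]
    * 2 ^ nloops D1 D2 = 2 ^ n * strandwise (sval D3) (join A Z))%N.
  apply/eqP; rewrite -(Num.Theory.eqr_nat int) -sum_dweight_bool (D3E boolform _ _ (fun=> true)) dweight_bool.
  by rewrite natrM natrX.
have en : n = nloops D1 D2.
  have := count (fun=> true) (fun=> true).
  rewrite (_ : join _ _ = fun=> true); last first.
    by apply: funext => x; rewrite /join; case: split.
  rewrite strandwise_cst [X in (nat_of_bool X * _)%N](_ : _ = true); last first.
    by apply/forallP => i; apply/forallP => j; apply/implyP.
  by rewrite mul1n muln1 => /eqP; rewrite eqn_exp2l // => /eqP.
have conn c : [forall i, forall j, connect e (cemb l i) (cemb l j) ==> (c i == c j)]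
      = strandwise (sval D3) c.
  have := count (fun i => c (lshift p i)) (fun j => c (rshift k j)).
  rewrite join_lrshift -en mulnC => /eqP; rewrite eqn_pmul2l ?expn_gt0 //.
  by case: [forall i, _]; case: strandwise.
have connE i j : connect e (cemb l i) (cemb l j) = (j == i) || (j == sval D3 i).
  apply/idP/idP => [ij|].
    have : strandwise (sval D3) (pred2 i (sval D3 i)).
      by apply/forallP => y /=; rewrite !(inv_eq (diagK D3)) diagK orbC.
    rewrite -conn => /forallP/(_ i)/forallP/(_ j); rewrite ij /= eqxx /=.
    by move/eqP => <-.
  case/orP => /eqP ->; first exact: connect0.
  have : strandwise (sval D3) (fun x => connect e (cemb l i) (cemb l x)).
    rewrite -conn; apply/forallP => a; apply/forallP => b; apply/implyP => ab.
    apply/eqP; apply/idP/idP => [ia|ib]; first exact: connect_trans ab.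
    apply: connect_trans ib _.
    by rewrite (sym_connect_sym cedge_sym).
  by move=> /forallP/(_ i); rewrite connect0 => /eqP <-.
exists D3.
  apply/ffunP => i; rewrite ffunE; case: pickP => [j /andP[ji]|/(_ (sval D3 i))].
    by rewrite connE (negPf ji) /= => /eqP ->.
  by rewrite connE eqxx orbT diag_neq.
move=> B A Z; rewrite -en.
(* A base coloring is missing only if there is a middle point but no color. Then the left side is an
   empty sum, and there is no outer point, which would have a color. So the middle point lies on a
   loop, whose value is an empty sum too, and the right side is 0. *)
case: (pickP (fun _ : 'I_l => true)) => [i0 _|nol]; last first.
  by apply: D3E => i; have := nol i.
case: (pickP (fun _ : sfT B => true)) => [t _|noT]; first exact: (D3E _ _ _ (fun=> t)).
rewrite big1 => [|C _]; last by have := noT (C i0).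
rewrite -sf_loop [X in X ^+ _]big1 => [|x]; last by have := noT x.
rewrite expr0n en -card_loopset; case: (component_cases (midpt i0)) => [[o]|[r rL _]].
  by have := noT (join A Z o).
by rewrite (_ : #|_| == 0%N = false) ?mul0r //; apply/negbTE; rewrite -lt0n; apply/card_gt0P; exists r.
Qed.

(** A test for loop-free factorizations: a single middle coloring extends each admissible outer
    coloring, so the power of 2 that counts the loops is 1. *)
Lemma compose_bool (D : Diag k p) :
  (forall (A : 'I_k -> bool) (Z : 'I_p -> bool), exists C0 : {ffun 'I_l -> bool}, forall C : {ffun 'I_l -> bool},
     strandwise (sval D1) (join A C) && strandwise (sval D2) (join C Z)
     = (C == C0) && strandwise (sval D) (join A Z)) ->
  sval D = rawcomp D1 D2 /\ nloops D1 D2 = 0%N.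
Proof.
have [D3 <- D3E] := compose_dweight => H.
have count A Z : (strandwise (sval D) (join A Z) = 2 ^ nloops D1 D2 * strandwise (sval D3) (join A Z) :> nat)%N.
  apply/eqP; rewrite -(Num.Theory.eqr_nat int) natrM natrX; apply/eqP.
  transitivity (sfd boolform ^+ nloops D1 D2 * dweight (B := boolform) (sval D3) (join A Z));
    last by rewrite dweight_bool.
  rewrite -D3E.
  have [C0 C0P] := H A Z; rewrite (bigD1 C0) //= big1 => [|C nC].
    by rewrite !dweight_bool -natrM mulnb C0P eqxx addr0.
  by rewrite !dweight_bool -natrM mulnb C0P (negPf nC).
have n0 : nloops D1 D2 = 0%N.
  have := count (fun=> true) (fun=> true).
  rewrite (_ : join _ _ = fun=> true); last first.
    by apply: funext => x; rewrite /join; case: split.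
  by rewrite !strandwise_cst muln1 => /esym/eqP; rewrite (@eqn_exp2l 2 _ 0) // => /eqP.
split=> //; congr sval; apply: strandwise_inj => c.
have := count (fun i => c (lshift p i)) (fun j => c (rshift k j)).
by rewrite join_lrshift n0 mul1n; do 2!case: strandwise.
Qed.
End Count.
End BooleanColorings.

(** * Tensor products and elementary diagrams *)

Section ElementaryDiagrams.
Local Open Scope ring_scope.

Lemma diag_exists k l (f : {ffun 'I_(k + l) -> 'I_(k + l)}) :
  diag_ok f -> exists D : Diag k l, sval D = f.
Proof. by move=> ok; exists (exist _ f ok). Qed.

Section Tensor.
Variables (k l k' l' : nat) (D1 : Diag k l) (D2 : Diag k' l').

Definition tens_pt (z : 'I_(k + l) + 'I_(k' + l')) : 'I_((k + k') + (l + l')) :=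
  match z with
  | inl x => match split x with
      inl i => lshift (l + l') (lshift k' i) | inr j => rshift (k + k') (lshift l' j) end
  | inr y => match split y with
      inl i => lshift (l + l') (rshift k i) | inr j => rshift (k + k') (rshift l j) end
  end.

Lemma tens_pt_inj : injective tens_pt.
Proof.
by move=> [x|x] [y|y]; rewrite /tens_pt; case: split_ordP => i ->; case: split_ordP => j -> /eqP;
  rewrite !eq_shift // => /eqP ->.
Qed.

Lemma tens_pt_onto z : z \in codom tens_pt.
Proof.
apply/codomP; case: (split_ordP z) => x ->; case: (split_ordP x) => i ->.
- by exists (inl (lshift l i)); rewrite /= (unsplitK (inl i)).
- by exists (inr (lshift l' i)); rewrite /= (unsplitK (inl i)).
- by exists (inl (rshift k i)); rewrite /= (unsplitK (inr i)).
- by exists (inr (rshift k' i)); rewrite /= (unsplitK (inr i)).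
Qed.

Lemma rawtensE z : rawtens D1 D2 (tens_pt z) = tens_pt (sum_map (sval D1) (sval D2) z).
Proof.
have val1 x : val (tens_pt (inl x)) = (if (x < k)%N then x : nat else (x + k')%N).
  by rewrite /tens_pt; case: split_ordP => i -> //=; lia.
have val2 y : val (tens_pt (inr y)) = (if (y < k')%N then (k + y)%N else (k + l + y)%N).
  by rewrite /tens_pt; case: split_ordP => i -> //=; lia.
apply: val_inj; rewrite ffunE val_insubd.
set v := (if (tens_pt z < k)%N then _ else _).
suff -> : v = val (tens_pt (sum_map (sval D1) (sval D2) z)) by rewrite ltn_ord.
rewrite /v; case: z {v} => x; have xb := ltn_ord x.
  rewrite [RHS]val1 [nat_of_ord _]val1; case: (ltnP x k) => xk.
    by rewrite xk partnerE.
  have -> : (x + k' < k)%N = false by lia.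
  have -> : (x + k' < k + k')%N = false by lia.
  have -> : (x + k' < k + k' + l)%N by lia.
  by rewrite addnK partnerE.
rewrite [RHS]val2 [nat_of_ord _]val2; case: (ltnP x k') => xk.
  have -> : (k + x < k)%N = false by lia.
  have -> : (k + x < k + k')%N by lia.
  by rewrite addKn partnerE.
have -> : (k + l + x < k)%N = false by lia.
have -> : (k + l + x < k + k')%N = false by lia.
have -> : (k + l + x < k + k' + l)%N = false by lia.
by rewrite -addnA !addKn partnerE.
Qed.

Lemma tens_diag : exists D : Diag (k + k') (l + l'), sval D = rawtens D1 D2.
Proof.
apply: diag_exists.
apply/forallP => z; have /codomP[x ->] := tens_pt_onto z.
rewrite !rawtensE !(inj_eq tens_pt_inj); case: x => x; rewrite /= diagK eqxx /=.
  by rewrite /eq_op /= diag_neq.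
by rewrite /eq_op /= diag_neq.
Qed.

(** In the boundary order the points of [D2] form one block, with those of [D1] around it. A point
    of [D1] thus compares alike with all points of [D2], and the crossing parities vanish. *)
Lemma dweight_tens (B : superform) (c : 'I_((k + k') + (l + l')) -> sfT B) :
  dweight (rawtens D1 D2) c =
  dweight (sval D1) (c \o tens_pt \o inl) * dweight (sval D2) (c \o tens_pt \o inr).
Proof.
pose pos z := posd (tens_pt z); pose ty z := tyd (tens_pt z).
have posi : injective pos by move=> x y /posd_inj /tens_pt_inj.
rewrite /dweight (@weight_transfer B _ _ _ pos _ ty _ (sum_map (sval D1) (sval D2)) _ (c \o tens_pt) tens_pt) //.
- rewrite weight_sum //; try exact: diagK.
    congr (_ * _); apply: (weight_transfer (h := id)) => // [x y|x|z _].
    + rewrite /pos /=; case: split_ordP => i ->; case: split_ordP => j ->; rewrite !posdE /=;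
        by have := ltn_ord i; have := ltn_ord j; lia.
    + by rewrite /ty /=; case: split_ordP => i ->; rewrite !tydE.
    + by apply/codomP; exists z.
    + rewrite /pos /=; case: split_ordP => i ->; case: split_ordP => j ->; rewrite !posdE /=;
        by have := ltn_ord i; have := ltn_ord j; lia.
    + by rewrite /ty /=; case: split_ordP => i ->; rewrite !tydE.
    + by apply/codomP; exists z.
  move=> x y; have sep u v w : (pos (inl u) < pos (inr v))%N = (pos (inl u) < pos (inr w))%N.
    rewrite /pos /=; case: split_ordP => a _; case: split_ordP => b _; case: split_ordP => d _;
      rewrite !posdE /=; have := ltn_ord a; have := ltn_ord b; have := ltn_ord d; lia.
  rewrite /cross /= (sep x y (sval D2 y)) (sep (sval D1 x) y (sval D2 y)).
  by do 2!case: (_ < _)%N.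
- exact: tens_pt_inj.
- exact: rawtensE.
- by move=> z _; apply: tens_pt_onto.
Qed.

Lemma dweight_tens_join (B : superform) (A : 'I_(k + k') -> sfT B) (C : 'I_(l + l') -> sfT B) :
  dweight (rawtens D1 D2) (join A C) =
  dweight (sval D1) (join (fun i => A (lshift k' i)) (fun j => C (lshift l' j))) *
  dweight (sval D2) (join (fun i => A (rshift k i)) (fun j => C (rshift l j))).
Proof.
rewrite dweight_tens; congr (_ * _); [congr (dweight (sval D1) _)|congr (dweight (sval D2) _)];
  apply: funext => x /=;
  by rewrite [RHS]/join; case: split_ordP => i _; rewrite ?join_lshift ?join_rshift.
Qed.
End Tensor.

Lemma rawidE k (i : 'I_k) : rawid k (lshift k i) = rshift k i.
Proof.
apply: val_inj; rewrite ffunE val_insubd /= ltn_ord.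
by have := ltn_ord i; case: ifP; lia.
Qed.

Lemma rawidE' k (i : 'I_k) : rawid k (rshift k i) = lshift k i.
Proof.
apply: val_inj; rewrite ffunE val_insubd /=.
have -> : (k + i < k)%N = false by lia.
by rewrite addKn ltn_addr.
Qed.

Lemma rawX_val i : rawX i = (3 - i)%N :> nat.
Proof. by rewrite ffunE val_insubd; case: ifP => //; lia. Qed.

Lemma rawA_val i : rawA i = (1 - i)%N :> nat.
Proof. by rewrite ffunE val_insubd; case: ifP => //; lia. Qed.

Lemma rawU_val i : rawU i = (1 - i)%N :> nat.
Proof. by rewrite ffunE val_insubd; case: ifP => //; lia. Qed.

Lemma id_diag k : exists D : Diag k k, sval D = rawid k.
Proof.
apply: diag_exists; apply/forallP => x; case: (split_ordP x) => i ->.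
  by rewrite rawidE rawidE' !eq_shift eqxx.
by rewrite rawidE' rawidE !eq_shift eqxx.
Qed.

Lemma X_diag : exists D : Diag 2 2, sval D = rawX.
Proof.
apply: diag_exists; apply/forallP => i; have := ltn_ord i.
by rewrite -!val_eqE /= !rawX_val; lia.
Qed.

Lemma A_diag : exists D : Diag 2 0, sval D = rawA.
Proof.
apply: diag_exists; apply/forallP => i; have := ltn_ord i.
by rewrite -!val_eqE /= !rawA_val; lia.
Qed.

Lemma U_diag : exists D : Diag 0 2, sval D = rawU.
Proof.
apply: diag_exists; apply/forallP => i; have := ltn_ord i.
by rewrite -!val_eqE /= !rawU_val; lia.
Qed.

(** * Coefficients of the elementary diagrams *)

Section Values.
Variable B : superform.

(** The vertical strands are nested in the boundary order, so no two cross, and each pairs a basis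
    with its dual. *)
Lemma dweight_id k (A C : {ffun 'I_k -> sfT B}) :
  dweight (rawid k) (join A C) = (A == C)%:R :> sfR B.
Proof.
have eL : lefts (@posd k k) (rawid k) = [set lshift k i | i : 'I_k].
  apply/setP => z; rewrite inE; case: (split_ordP z) => i ->.
    rewrite rawidE imset_f // !posdE; by have := ltn_ord i; lia.
  rewrite rawidE' !posdE; apply/idP/imsetP => [|[j _ /eqP]]; last by rewrite eq_shift.
  by have := ltn_ord i; lia.
rewrite /dweight /weight /weight_on eL !(big_imset _ (in2W (@lshift_inj _ _))) /=.
rewrite [X in _ * X]big1 ?mulr1 => [|i _]; last first.
  rewrite big_mkcondr (big_imset _ (in2W (@lshift_inj _ _))) /= big1 // => j _.
  case: ifP => // ij; rewrite /crossw; case: andP => // -[_].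
  rewrite !rawidE /cross !posdE; move: ij; rewrite !posdE.
  have := ltn_ord i; have := ltn_ord j; lia.
rewrite (eq_bigr (fun i => (A i == C i)%:R)) => [|i _]; last first.
  rewrite /pairw rawidE !posdE !tydE join_lshift join_rshift sf_dual.
  by rewrite ifT //; have := ltn_ord i; lia.
have [->|nAC] := eqVneq A C; first by rewrite big1 // => i _; rewrite eqxx.
have [i ni] : exists i, A i != C i.
  by apply/existsP; rewrite -negb_forall; apply: contra nAC => /forallP AC; apply/eqP/ffunP => i; apply/eqP.
by rewrite (bigD1 i) //= (negPf ni) mul0r.
Qed.

Let v0 : 'I_2 := ord0.
Let v1 : 'I_2 := ord_max.

(** The strands join positions 0, 2 and 1, 3 of the boundary order; they interleave, which gives the
    Koszul sign of [tau]. *)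
Lemma dweight_X (A C : 'I_2 -> sfT B) :
  dweight rawX (join A C) =
  (-1) ^+ (sfp (A v0) && sfp (A v1)) * ((A v0 == C v1) && (A v1 == C v0))%:R :> sfR B.
Proof.
have x0 : rawX (lshift 2 v0) = rshift 2 v1 by apply: val_inj; rewrite /= ?rawX_val ?rawA_val ?rawU_val.
have x1 : rawX (lshift 2 v1) = rshift 2 v0 by apply: val_inj; rewrite /= ?rawX_val ?rawA_val ?rawU_val.
have eL : lefts (@posd 2 2) rawX = lshift 2 v0 |: [set lshift 2 v1].
  apply/setP => z; rewrite !inE.
  by case: z => -[|[|[|[|]]]] // h; rewrite /posd !rawX_val.
have nL : lshift 2 v0 \notin [set lshift 2 v1] by rewrite inE eq_shift.
rewrite /dweight /weight /weight_on eL !(big_setU1 _ nL) !big_set1 /=.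
rewrite !big_mkcondr !(big_setU1 _ nL) !big_set1 /=.
rewrite !mul1r !mulr1 /pairw x0 x1 !posdE /= !tydE !join_lshift !join_rshift !sf_dual.
rewrite /crossw /strand_odd x0 x1 !join_lshift !join_rshift /cross !posdE /= andbT.
rewrite mulrC; have [<-|_] := eqVneq (A v0) (C v1); last by rewrite !(mul0r, mulr0).
have [<-|_] := eqVneq (A v1) (C v0); last by rewrite !(mul0r, mulr0).
by rewrite !andbb mul1r.
Qed.

Lemma dweight_A (A : 'I_2 -> sfT B) (C : 'I_0 -> sfT B) :
  dweight rawA (join A C) = sfG false false (A v0) (A v1) :> sfR B.
Proof.
have x0 : rawA (lshift 0 v0) = lshift 0 v1 by apply: val_inj; rewrite /= ?rawX_val ?rawA_val ?rawU_val.
have eL : lefts (@posd 2 0) rawA = [set lshift 0 v0].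
  apply/setP => z; rewrite !inE.
  by case: z => -[|[|]] // h; rewrite /posd !rawA_val.
rewrite /dweight /weight /weight_on eL !big_set1 /= big1 ?mulr1 => [|z].
  by rewrite /pairw x0 !posdE /= !tydE !join_lshift.
by rewrite inE => /andP[/eqP ->]; rewrite ltnn.
Qed.

(** Reading the top row from right to left puts its second point first. This reversal yields the
    transpose of [eta], which is the inverse matrix in [c0]. *)
Lemma dweight_U (A : 'I_0 -> sfT B) (C : 'I_2 -> sfT B) :
  dweight rawU (join A C) = sfG true true (C v1) (C v0) :> sfR B.
Proof.
have x1 : rawU (rshift 0 v1) = rshift 0 v0 by apply: val_inj; rewrite /= ?rawX_val ?rawA_val ?rawU_val.
have eL : lefts (@posd 0 2) rawU = [set rshift 0 v1].
  apply/setP => z; rewrite !inE.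
  by case: z => -[|[|]] // h; rewrite /posd !rawU_val.
rewrite /dweight /weight /weight_on eL !big_set1 /= big1 ?mulr1 => [|z].
  by rewrite /pairw x1 !posdE /= !tydE !join_rshift.
by rewrite inE => /andP[/eqP ->]; rewrite ltnn.
Qed.
End Values.
End ElementaryDiagrams.

(** * Generation by the elementary diagrams *)

Section Generation.
Local Open Scope ring_scope.

(** Only loop-free composites are allowed: then the composite of basis elements is the basis element
    of D, whereas a power of m - 2n could not be cancelled when m = 2n. *)
Inductive generated : forall k l, Diag k l -> Prop :=
| gen_id k (D : Diag k k) : sval D = rawid k -> generated D
| gen_X (D : Diag 2 2) : sval D = rawX -> generated D
| gen_A (D : Diag 2 0) : sval D = rawA -> generated D
| gen_U (D : Diag 0 2) : sval D = rawU -> generated D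
| gen_comp k l p (D1 : Diag k l) (D2 : Diag l p) (D : Diag k p) :
    sval D = rawcomp D1 D2 -> nloops D1 D2 = 0%N ->
    generated D1 -> generated D2 -> generated D
| gen_tens k l k' l' (D1 : Diag k l) (D2 : Diag k' l') (D : Diag (k + k') (l + l')) :
    sval D = rawtens D1 D2 -> generated D1 -> generated D2 -> generated D.

Lemma strandwise_nat (b b' : bool) : b%:R = b'%:R :> int -> b = b'.
Proof. by case: b b' => [] []. Qed.

Lemma sw_tens k l k' l' (D1 : Diag k l) (D2 : Diag k' l') (D : Diag (k + k') (l + l')) A C :
  sval D = rawtens D1 D2 ->
  strandwise (sval D) (join A C) =
  strandwise (sval D1) (join (fun i => A (lshift k' i)) (fun j => C (lshift l' j))) &&
  strandwise (sval D2) (join (fun i => A (rshift k i)) (fun j => C (rshift l j))).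
Proof.
move=> DE; apply: strandwise_nat; rewrite -mulnb natrM -!dweight_bool DE.
exact: (dweight_tens_join D1 D2 (B := boolform)).
Qed.

Lemma sw_id k (D : Diag k k) A C : sval D = rawid k ->
  strandwise (sval D) (join A C) = [forall i, A i == C i].
Proof.
move=> DE; apply: strandwise_nat; rewrite -dweight_bool DE.
have AE (F : 'I_k -> bool) : F = [ffun i => F i] by apply: funext => i; rewrite ffunE.
rewrite [A]AE [C]AE (dweight_id (B := boolform)).
congr (nat_of_bool _)%:R; apply/eqP/forallP => [e i|e]; first by rewrite e.
by apply/ffunP => i; apply/eqP.
Qed.

Lemma sw_X (D : Diag 2 2) A C : sval D = rawX ->
  strandwise (sval D) (join A C) = (A ord0 == C ord_max) && (A ord_max == C ord0).
Proof.
move=> DE; apply: strandwise_nat; rewrite -dweight_bool DE (dweight_X (B := boolform)).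
by rewrite expr0 mul1r.
Qed.

Lemma sw_A (D : Diag 2 0) A C : sval D = rawA ->
  strandwise (sval D) (join A C) = (A ord0 == A ord_max).
Proof. by move=> DE; apply: strandwise_nat; rewrite -dweight_bool DE (dweight_A (B := boolform)). Qed.

Lemma sw_U (D : Diag 0 2) A C : sval D = rawU ->
  strandwise (sval D) (join A C) = (C ord_max == C ord0).
Proof. by move=> DE; apply: strandwise_nat; rewrite -dweight_bool DE (dweight_U (B := boolform)). Qed.

(** [strandwise] does not see the rows, so moving points between them just transports the
    colorings. *)
Lemma relabel k l k' l' (D : Diag k l) (h : 'I_(k' + l') -> 'I_(k + l)) (h' : 'I_(k + l) -> 'I_(k' + l')) :
  cancel h h' -> cancel h' h -> exists2 D' : Diag k' l',
    forall x, h (sval D' x) = sval D (h x) &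
    forall c, strandwise (sval D') (c \o h) = strandwise (sval D) c.
Proof.
move=> hK h'K; have onto x : x \in codom h by apply/codomP; exists (h' x).
have [D' D'E] : exists D' : Diag k' l', forall x, h (sval D' x) = sval D (h x).
  by apply: restrict_diag => // [||x]; [exact: can_inj hK|exact: diagK|exact: diag_neq].
exists D' => // c; apply/forallP/forallP => H x; last by rewrite /= D'E.
by have := H (h' x); rewrite /= D'E h'K.
Qed.

Lemma join_comp (S T : Type) k l (f : S -> T) (A : 'I_k -> S) (C : 'I_l -> S) :
  f \o join A C = join (f \o A) (f \o C).
Proof. by apply: funext => x; rewrite /= /join; case: split. Qed.

Lemma join_eta (T : Type) k l (c : 'I_(k + l) -> T) :
  c = join (c \o lshift l) (c \o @rshift k l).
Proof. by apply: funext => x; rewrite /join; case: split_ordP => i ->. Qed.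

Lemma joinP (T : Type) k l (A A' : 'I_k -> T) (C C' : 'I_l -> T) :
  A = A' -> C = C' -> join A C = join A' C'.
Proof. by move=> -> ->. Qed.

(** * Bending strands between the rows and crossing them at the top *)

Definition bend_down k l : 'I_(k + (1 + l)) -> 'I_((1 + k) + l) :=
  join (fun i => lshift l (rshift 1 i))
       (join (fun i : 'I_1 => lshift l (lshift k i)) (fun j => rshift (1 + k) j)).
Definition bend_up k l : 'I_((1 + k) + l) -> 'I_(k + (1 + l)) :=
  join (join (fun i : 'I_1 => rshift k (lshift l i)) (fun i => lshift (1 + l) i))
       (fun j => rshift k (rshift 1 j)).
Definition swap_top k l : 'I_(k + (1 + (1 + l))) -> 'I_(k + (1 + (1 + l))) :=
  join (fun i => lshift _ i)
   (join (fun i => rshift k (rshift 1 (lshift l i)))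
      (join (fun i => rshift k (lshift (1 + l) i)) (fun j => rshift k (rshift 1 (rshift 1 j))))).

Lemma bend_downK k l : cancel (@bend_down k l) (@bend_up k l).
Proof.
move=> x; rewrite /bend_up /bend_down; case: (split_ordP x) => y ->; rewrite ?(join_lshift, join_rshift) //.
by case: (split_ordP y) => z ->; rewrite !(join_lshift, join_rshift).
Qed.

Lemma bend_upK k l : cancel (@bend_up k l) (@bend_down k l).
Proof.
move=> x; rewrite /bend_up /bend_down; case: (split_ordP x) => y ->; rewrite ?(join_lshift, join_rshift) //.
by case: (split_ordP y) => z ->; rewrite !(join_lshift, join_rshift).
Qed.

Lemma swap_topK k l : involutive (@swap_top k l).
Proof.
move=> x; rewrite /swap_top; case: (split_ordP x) => y ->; rewrite ?(join_lshift, join_rshift) //.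
case: (split_ordP y) => z ->; rewrite !(join_lshift, join_rshift) //.
by case: (split_ordP z) => t ->; rewrite !(join_lshift, join_rshift).
Qed.

Lemma gen_Itens k l (D : Diag k l) : generated D -> exists2 E : Diag (1 + k) (1 + l),
  generated E & forall A C, strandwise (sval E) (join A C) =
    (A (lshift k ord0) == C (lshift l ord0)) && strandwise (sval D) (join (A \o @rshift 1 k) (C \o @rshift 1 l)).
Proof.
move=> gD; have [I IE] := id_diag 1; have [E EE] := tens_diag I D.
exists E; first by apply: gen_tens EE _ gD; apply: gen_id.
move=> A C; rewrite (sw_tens _ _ EE) (sw_id _ _ IE); congr (_ && _).
by apply/forallP/eqP => [/(_ ord0)/eqP //|e i]; rewrite (ord1 i) e.
Qed.

Lemma gen_tens_id k l n (D : Diag k l) : generated D -> exists2 E : Diag (k + n) (l + n),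
  generated E & forall A C, strandwise (sval E) (join A C) =
   strandwise (sval D) (join (A \o lshift n) (C \o lshift n)) &&
   [forall i, A (rshift k i) == C (rshift l i)].
Proof.
move=> gD; have [I IE] := id_diag n; have [E EE] := tens_diag D I.
exists E; first by apply: gen_tens EE gD _; apply: gen_id.
by move=> A C; rewrite (sw_tens _ _ EE) (sw_id _ _ IE).
Qed.

Lemma lshift2_0 n : lshift n (ord0 : 'I_2) = lshift (1 + n) (ord0 : 'I_1) :> 'I_(1 + (1 + n)).
Proof. exact: val_inj. Qed.
Lemma lshift2_1 n : lshift n (ord_max : 'I_2) = rshift 1 (lshift n (ord0 : 'I_1)) :> 'I_(1 + (1 + n)).
Proof. exact: val_inj. Qed.
Lemma rshift2 n (i : 'I_n) : rshift 2 i = rshift 1 (rshift 1 i) :> 'I_(1 + (1 + n)).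
Proof. exact: val_inj. Qed.
Lemma rshift0 n (i : 'I_n) : rshift 0 i = i :> 'I_n.
Proof. exact: val_inj. Qed.
Definition shift2E := (lshift2_0, lshift2_1, rshift2, rshift0).

Definition cons_col (T : Type) n (a : T) (c : 'I_n -> T) : 'I_(1 + n) -> T := join (fun=> a) c.

Lemma cons_col0 (T : Type) n (a : T) (c : 'I_n -> T) : cons_col a c (lshift n ord0) = a.
Proof. exact: join_lshift. Qed.
Lemma cons_colS (T : Type) n (a : T) (c : 'I_n -> T) i : cons_col a c (rshift 1 i) = c i.
Proof. exact: join_rshift. Qed.
Definition cons_colE := (cons_col0, cons_colS).

Lemma cons_col_eqP (T : eqType) n (C : {ffun 'I_(1 + n) -> T}) (a : T) (c : 'I_n -> T) :
  (C == [ffun x => cons_col a c x]) = (a == C (lshift n ord0)) && [forall i, C (rshift 1 i) == c i].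
Proof.
apply/eqP/andP => [->|[/eqP a0 /forallP H]].
  split; first by rewrite ffunE cons_colE.
  by apply/forallP => i; rewrite ffunE cons_colE.
apply/ffunP => x; rewrite ffunE; case: (split_ordP x) => i ->; rewrite ?cons_colE.
  by rewrite (ord1 i) cons_colE.
exact/eqP.
Qed.

(* D = (A (x) id_l) o (I (x) D1), where D1 is D with its first bottom point moved to the top. *)
Lemma gen_bend_down k l (D : Diag (1 + k) l) : exists2 D1 : Diag k (1 + l),
  forall x, bend_down (sval D1 x) = sval D (bend_down x) & generated D1 -> generated D.
Proof.
have [D1 D1E swD1] := relabel D (@bend_downK k l) (@bend_upK k l).
exists D1 => // gD1; have [E1 gE1 swE1] := gen_Itens gD1.
have [cap capE] := A_diag; have [E2 gE2 swE2] := gen_tens_id l (gen_A capE).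
have [DE n0] : sval D = rawcomp (p := l) E1 E2 /\ nloops (p := l) E1 E2 = 0%N; last exact: gen_comp DE n0 gE1 gE2.
apply: compose_bool => A Z; set a := A (lshift k ord0).
(* The identity strand brings the color a to the first middle point and the cap passes it to the
   second; the others copy the top row. *)
exists [ffun x => cons_col a (cons_col a Z) x] => C.
have -> : (C == [ffun x => cons_col a (cons_col a Z) x]) =
   [&& a == C (lshift (1 + l) ord0), a == C (rshift 1 (lshift l ord0))
     & [forall i, C (rshift 1 (rshift 1 i)) == Z i]].
  rewrite cons_col_eqP; congr (_ && _); apply/forallP/andP => [H|[/eqP a1 /forallP H] i].
    have := H (lshift l ord0); rewrite cons_colE eq_sym => ->; split=> //.
    by apply/forallP => i; have := H (rshift 1 i); rewrite cons_colE.
  case: (split_ordP i) => j ->; last by rewrite cons_colE.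
  by rewrite (ord1 j) cons_colE a1.
rewrite swE1 swE2 (sw_A _ _ capE) /= !shift2E -/a.
have [<- /=|_] := eqVneq a (C (lshift (1 + l) ord0)); last by rewrite /= ?andbF.
have [ea /=|_] := eqVneq a (C (rshift 1 (lshift l ord0))); last by rewrite /= ?andbF.
rewrite [X in _ && X](_ : _ = [forall i, C (rshift 1 (rshift 1 i)) == Z i]); last first.
  by apply: eq_forallb => i; rewrite !shift2E.
rewrite andbC; case: forallP => //= CZ; rewrite -swD1; congr strandwise.
rewrite /bend_down !join_comp; apply: joinP; first by apply: funext => i /=; rewrite join_lshift.
apply: funext => x; case: (split_ordP x) => i ->; rewrite /= ?join_lshift ?join_rshift /=.
  by rewrite (ord1 i) -ea join_lshift.
by rewrite join_rshift; apply/eqP.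
Qed.

(* D = (I (x) D1) o (U (x) id_k), where D1 is D with its first top point moved to the bottom. *)
Lemma gen_bend_up k l (D : Diag k (1 + l)) : exists2 D1 : Diag (1 + k) l,
  forall x, bend_up (sval D1 x) = sval D (bend_up x) & generated D1 -> generated D.
Proof.
have [D1 D1E swD1] := relabel D (@bend_upK k l) (@bend_downK k l).
exists D1 => // gD1; have [E2 gE2 swE2] := gen_Itens gD1.
have [cup cupE] := U_diag; have [E1 gE1 swE1] := gen_tens_id k (gen_U cupE).
have [DE n0] : sval D = rawcomp (k := k) (l := 1 + (1 + k)) E1 E2 /\
    nloops (k := k) (l := 1 + (1 + k)) E1 E2 = 0%N; last exact: gen_comp DE n0 gE1 gE2.
apply: compose_bool => A Z; set z := Z (lshift l ord0).
(* The identity strand gives the first middle point the color of the top point, and the cup passes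
   it to the second; the others copy the bottom row. *)
exists [ffun x => cons_col z (cons_col z A) x] => C.
have -> : (C == [ffun x => cons_col z (cons_col z A) x]) =
   [&& z == C (lshift (1 + k) ord0), z == C (rshift 1 (lshift k ord0))
     & [forall i, C (rshift 1 (rshift 1 i)) == A i]].
  rewrite cons_col_eqP; congr (_ && _); apply/forallP/andP => [H|[/eqP a1 /forallP H] i].
    have := H (lshift k ord0); rewrite cons_colE eq_sym => ->; split=> //.
    by apply/forallP => i; have := H (rshift 1 i); rewrite cons_colE.
  case: (split_ordP i) => j ->; last by rewrite cons_colE.
  by rewrite (ord1 j) cons_colE a1.
rewrite swE1 swE2 (sw_U _ _ cupE) /= !shift2E -/z [C _ == z]eq_sym.
have [<- /=|_] := eqVneq z (C (lshift (1 + k) ord0)); last by rewrite /= ?andbF.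
rewrite [C _ == z]eq_sym.
have [ea /=|_] := eqVneq z (C (rshift 1 (lshift k ord0))); last by rewrite /= ?andbF.
rewrite [X in X && _](_ : _ = [forall i, C (rshift 1 (rshift 1 i)) == A i]); last first.
  by apply: eq_forallb => i; rewrite !shift2E eq_sym.
case: forallP => //= CA; rewrite -swD1; congr strandwise.
rewrite /bend_up !join_comp; apply: joinP; last by apply: funext => i /=; rewrite join_rshift.
apply: funext => x; case: (split_ordP x) => i ->; rewrite /= ?join_lshift ?join_rshift /=.
  by rewrite (ord1 i) -ea join_rshift.
by rewrite join_lshift; apply/eqP.
Qed.

(** D is the composite of D1 with X (x) id_l, where D1 is D with its first two top points
    exchanged. *)
Lemma gen_swap_top k l (D : Diag k (1 + (1 + l))) : exists2 D1 : Diag k (1 + (1 + l)),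
  forall x, swap_top (sval D1 x) = sval D (swap_top x) & generated D1 -> generated D.
Proof.
have [D1 D1E swD1] := relabel D (@swap_topK k l) (@swap_topK k l).
exists D1 => // gD1.
have [X XE] := X_diag; have [E2 gE2 swE2] := gen_tens_id l (gen_X XE).
have [DE n0] : sval D = rawcomp (l := 1 + (1 + l)) (p := 1 + (1 + l)) D1 E2 /\ nloops (l := 1 + (1 + l)) (p := 1 + (1 + l)) D1 E2 = 0%N;
  last exact: gen_comp DE n0 gD1 gE2.
apply: compose_bool => A Z.
pose z0 := Z (lshift (1 + l) ord0); pose z1 := Z (rshift 1 (lshift l ord0)).
pose Z' i := Z (rshift 1 (rshift 1 i)).
exists [ffun x => cons_col z1 (cons_col z0 Z') x] => C.
have -> : (C == [ffun x => cons_col z1 (cons_col z0 Z') x]) =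
   [&& z1 == C (lshift (1 + l) ord0), z0 == C (rshift 1 (lshift l ord0))
     & [forall i, C (rshift 1 (rshift 1 i)) == Z' i]].
  rewrite cons_col_eqP; congr (_ && _); apply/forallP/andP => [H|[/eqP a1 /forallP H] i].
    have := H (lshift l ord0); rewrite cons_colE eq_sym => ->; split=> //.
    by apply/forallP => i; have := H (rshift 1 i); rewrite cons_colE.
  case: (split_ordP i) => j ->; last by rewrite cons_colE.
  by rewrite (ord1 j) cons_colE a1.
rewrite swE2 (sw_X _ _ XE) /= !shift2E -/z0 -/z1 ![C _ == _]eq_sym.
have [e1 /=|_] := eqVneq z1 (C (lshift (1 + l) ord0)); last by rewrite /= ?andbF.
have [e0 /=|_] := eqVneq z0 (C (rshift 1 (lshift l ord0))); last by rewrite /= ?andbF.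
rewrite [X in _ && X](_ : _ = [forall i, C (rshift 1 (rshift 1 i)) == Z' i]); last first.
  by apply: eq_forallb => i; rewrite !shift2E.
rewrite andbC; case: forallP => //= CZ; rewrite -swD1; congr strandwise.
rewrite /swap_top !join_comp; apply: joinP; first by apply: funext => i /=; rewrite join_lshift.
apply: funext => x; case: (split_ordP x) => i ->; rewrite /= ?join_lshift ?join_rshift /=.
  by rewrite (ord1 i) -e1 join_rshift.
case: (split_ordP i) => j ->; rewrite /= ?join_lshift ?join_rshift /= ?join_rshift.
  by rewrite (ord1 j) -e0.
by apply/eqP.
Qed.

(** With a vertical first strand, D is the tensor product of I and its restriction to the other
    points. *)
Lemma gen_vertical k l (D : Diag (1 + k) (1 + l)) :
  sval D (rshift (1 + k) (lshift l ord0)) = lshift (1 + l) (lshift k ord0) ->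
  (forall D' : Diag k l, generated D') -> generated D.
Proof.
set t := rshift (1 + k) (lshift l ord0); set b := lshift (1 + l) (lshift k ord0) => Dt gkl.
have Db : sval D b = t by rewrite -Dt diagK.
pose h : 'I_(k + l) -> 'I_((1 + k) + (1 + l)) :=
  join (fun i => lshift (1 + l) (rshift 1 i)) (fun j => rshift (1 + k) (rshift 1 j)).
have h_inj : injective h.
  move=> x y; rewrite /h /join; case: split_ordP => i ->; case: split_ordP => j -> /eqP;
  by rewrite !eq_shift // => /eqP ->.
have hP z : (z \in codom h) = (z != t) && (z != b).
  apply/codomP/andP => [[x ->]|[]].
    by rewrite /h /join; case: split_ordP => i _; rewrite !eq_shift.
  case: (split_ordP z) => y ->; case: (split_ordP y) => i ->; rewrite /t /b ?(ord1 i) ?eqxx // => _ _.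
    by exists (lshift l i); rewrite /h join_lshift.
  by exists (rshift k i); rewrite /h join_rshift.
have [D' D'E] : exists D' : Diag k l, forall x, h (sval D' x) = sval D (h x).
  apply: restrict_diag => // [|x|x]; [exact: diagK|exact: diag_neq|].
  have := codom_f h x; rewrite !hP => /andP[ht hb].
  by rewrite !(inv_eq (diagK D)) Dt Db ht hb.
have [E gE swE] := gen_Itens (gkl D'); suff -> : D = E by [].
apply: strandwise_inj => c; rewrite [in RHS](join_eta c) swE /= -/b -/t.
have -> : join (((c \o lshift (1 + l)) \o @rshift 1 k)) ((c \o @rshift (1 + k) (1 + l)) \o @rshift 1 l) = c \o h.
  by rewrite join_comp.
apply/forallP/andP => [H|[/eqP cbt /forallP H] x].
  split; first by rewrite -Db H.
  by apply/forallP => x; rewrite /= D'E H.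
have [->|xt] := eqVneq x t; first by rewrite Dt cbt.
have [->|xb] := eqVneq x b; first by rewrite Db cbt.
have /codomP[y ->] : x \in codom h by rewrite hP xt xb.
by rewrite -D'E; apply: H.
Qed.

(* Bending the first bottom point up and crossing it with the first top point moves the
   partner of the latter one step to the left, until the strand is vertical. *)
Lemma gen_top0_bottom n :
  (forall k l (D : Diag k l), (k + l < n)%N -> generated D) ->
  forall i k l (D : Diag k (1 + l)) (b : 'I_k), (k + (1 + l) <= n)%N ->
  sval D (rshift k (lshift l ord0)) = lshift (1 + l) b -> b = i :> nat -> generated D.
Proof.
move=> IHn; elim=> [|i IHi] [|k] l D b kln Db bi; try by case: b {Db bi}.
  apply: (gen_vertical (k := k)) => [|D']; last by apply: IHn; lia.
  by rewrite Db; congr lshift; apply: val_inj.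
have [D1 D1E genD] := gen_bend_down (k := k) D; apply: genD.
have [D2 D2E genD1] := gen_swap_top D1; apply: genD1.
have bk : (i < k)%N by have := ltn_ord b; lia.
apply: (IHi _ _ D2 (Ordinal bk)) => //; first by lia.
apply: (can_inj (@swap_topK k l)); rewrite D2E /swap_top !join_rshift ?join_lshift.
apply: (can_inj (@bend_downK k (1 + l))); rewrite D1E /bend_down !join_rshift ?join_lshift.
rewrite (_ : rshift (1 + k) _ = rshift k.+1 (lshift l ord0)) // Db.
by congr lshift; apply: val_inj; rewrite /= bi.
Qed.

(** Induction on the number of points, then on the top row, which is bent down until it is empty.
    One bottom point is then bent up again: its partner must be a bottom point, and moving that to
    the left end makes the strand vertical, so that two points can be removed. *)
Theorem diagrams_generated k l (D : Diag k l) : generated D.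
Proof.
have [n] := ubnP (k + l); elim: n k l D => // n IHn k l D kln.
elim: l k D kln => [|l IHl] k D kln; last first.
  have [D1 _ genD] := gen_bend_up (k := k) D; apply: genD; apply: IHl; lia.
case: k D kln => [|k] D kln.
  by apply: gen_id; apply/ffunP => -[].
have [D1 _ genD] := gen_bend_down (k := k) D; apply: genD.
case: (split_ordP (sval D1 (rshift k (lshift 0 ord0)))) => b Db; last first.
  have /eqP := diag_neq D1 (rshift k (lshift 0 ord0)); rewrite Db; case.
  by congr rshift; rewrite (ord1 b); apply: val_inj.
by apply: (gen_top0_bottom (n := n) IHn (i := b)) Db _ => //; lia.
Qed.
End Generation.

(** * The orthosymplectic form *)

Section OrthosymplecticForm.
Local Open Scope ring_scope.
Variables (R : realType) (m n : nat).
Local Notation C := (R[i]).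
Local Notation idx := ('I_(Dm m n)).
Local Notation eta := (Defs.eta R m n).
Local Notation bpar := (@bpar m n).

(** The only column where row a of [eta] is nonzero. For an odd basis vector, an even offset [a - m]
    marks the first of its block, whose mate is the next index. *)
Definition dual_nat (a : nat) : nat :=
  if (a < m)%N then a else if odd (a - m) then a.-1 else a.+1.

Lemma dual_nat_lt (a : idx) : (dual_nat a < Dm m n)%N.
Proof.
rewrite /dual_nat /Dm; have := ltn_ord a; rewrite /Dm; case: ifP => am alt.
  by lia.
by case: ifP => oa; lia.
Qed.

Definition dual_idx (a : idx) : idx := Ordinal (dual_nat_lt a).

Definition eta_sign (a : idx) : C := if (a < m)%N || odd (a - m) then 1 else -1.

Lemma etaE a b : eta a b = eta_sign a * (b == dual_idx a)%:R.
Proof.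
have -> : (b == dual_idx a) = (b == dual_nat a :> nat) by rewrite -val_eqE.
rewrite mxE /eta_sign /dual_nat -val_eqE /=.
have [am|am] := ltnP a m; have [bm|bm] := ltnP b m; rewrite /= ?mul1r.
- by rewrite eq_sym.
- by rewrite (_ : (_ == _) = false) //; apply/negbTE; lia.
- by rewrite (_ : (_ == _ :> nat) = false) ?mulr0 //; apply/negbTE; case: ifP => oa; lia.
case oa: (odd (a - m)); case ob: (odd (b - m)); rewrite /= ?mul1r.
- by rewrite if_same (_ : (_ == _ :> nat) = false) //; apply/negbTE; lia.
- rewrite (_ : (b == a.-1 :> nat) = ((a - m)./2 == (b - m)./2)); first by case: ifP.
  by apply/eqP/eqP; lia.
- rewrite (_ : (b == a.+1 :> nat) = ((a - m)./2 == (b - m)./2)); first by case: ifP; rewrite ?mulr1 ?mulr0.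
  by apply/eqP/eqP; lia.
- by rewrite if_same (_ : (_ == _ :> nat) = false) ?mulr0 //; apply/negbTE; lia.
Qed.

Lemma dual_idxK : involutive dual_idx.
Proof.
move=> a; apply: val_inj; rewrite /= /dual_nat.
have [am|am] := ltnP a m; first by rewrite am.
by case oa: (odd (a - m)); case: ifP => ?; try lia; case: ifP => ?; lia.
Qed.

Lemma bpar_dual a : bpar (dual_idx a) = bpar a.
Proof.
rewrite /bpar /= /dual_nat; have [am|am] := ltnP a m; first by rewrite leqNgt am.
by case oa: (odd (a - m)); lia.
Qed.

Lemma eta_sign_dual a : eta_sign a * eta_sign (dual_idx a) = (-1) ^+ (bpar a).
Proof.
rewrite /eta_sign /bpar /= /dual_nat.
have [am|am] := ltnP a m; first by rewrite am mulr1 /=.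
case oa: (odd (a - m)).
  by rewrite ifF ?mul1r ?expr1 //; apply/negbTE; rewrite negb_or; apply/andP; split; lia.
by rewrite ifT ?mulr1 ?expr1 //; apply/orP; right; lia.
Qed.

Lemma eta_even a b : bpar a != bpar b -> eta a b = 0.
Proof.
rewrite etaE; have [->|_] := eqVneq b (dual_idx a); last by rewrite mulr0.
by rewrite bpar_dual eqxx.
Qed.

Lemma eta_sym a b : eta a b = (-1) ^+ (bpar a) * eta b a.
Proof.
rewrite !etaE; have [->|nab] := eqVneq b (dual_idx a).
  rewrite dual_idxK eqxx !mulr1 -eta_sign_dual -mulrA.
  by rewrite /eta_sign; case: ifP; case: ifP; rewrite ?mulr1 // ?mul1r ?mulrNN ?mulr1.
rewrite (_ : (a == dual_idx b) = false) ?mulr0 //; apply: contraNF nab => /eqP ->.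
by rewrite dual_idxK.
Qed.

Lemma eta_sq a b : \sum_x eta a x * eta x b = (-1) ^+ (bpar a) * (a == b)%:R.
Proof.
rewrite (bigD1 (dual_idx a)) //= big1 ?addr0 => [|x /negPf nx]; last by rewrite etaE nx mulr0 mul0r.
by rewrite !etaE eqxx mulr1 mulrA eta_sign_dual dual_idxK eq_sym.
Qed.

(** [eta] is a signed permutation matrix, so its transpose inverts it; this follows here from
    supersymmetry and the square of [eta]. *)
Lemma etainvE a b : etainv R m n a b = eta b a.
Proof.
have eta1 : Defs.eta R m n *m (Defs.eta R m n)^T = 1%:M.
  apply/matrixP => x y; rewrite mxE [RHS]mxE.
  transitivity ((-1) ^+ (bpar x) * \sum_z eta x z * eta z y).
    rewrite mulr_sumr; apply: eq_bigr => z _; rewrite [_^T _ _]mxE.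
    have [e|e] := eqVneq (bpar x) (bpar z); last by rewrite (eta_even e) !(mul0r, mulr0).
    rewrite [eta y z]eta_sym; have [e'|e'] := eqVneq (bpar y) (bpar z).
      by rewrite e -e' mulrCA.
    by rewrite [eta z y]eta_even 1?eq_sym // !mulr0.
  by rewrite eta_sq mulrA -expr2 sqrr_sign mul1r.
have [u _] := mulmx1_unit eta1.
by rewrite /etainv -[invmx _]mulmx1 -eta1 mulKmx // mxE.
Qed.

(** Lower and upper vectors pair among themselves by [eta]; mixed, they pair as dual bases, with the
    sign (-1)^[a] forced by supersymmetry when the upper one comes first. Summed over the basis,
    that sign gives the loop value m - 2n. *)
Definition osp_pairing (s t : bool) (a b : idx) : C :=
  if s == t then eta a b else (-1) ^+ (s && bpar a) * (a == b)%:R.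

Fact osp_even s t a b : bpar a != bpar b -> osp_pairing s t a b = 0.
Proof.
rewrite /osp_pairing => nab; case: (s =P t) => _; first exact: eta_even.
by have [e|_] := eqVneq a b; rewrite ?mulr0 // e eqxx in nab *.
Qed.

Fact osp_sym s t a b : osp_pairing s t a b = (-1) ^+ (bpar a) * osp_pairing t s b a.
Proof.
rewrite /osp_pairing [s == t]eq_sym; case: (t =P s) => [_|/eqP]; first exact: eta_sym.
rewrite [b == a]eq_sym; have [->|_] := eqVneq a b; last by rewrite !mulr0.
by case: s t => [] [] //= _; rewrite !mulr1 ?mul1r // -expr2 sqrr_sign.
Qed.

Fact osp_contr s t a b :
  \sum_x osp_pairing s true a x * osp_pairing false t x b = osp_pairing s t a b.
Proof.
case: s; last first.
  rewrite (bigD1 a) //= big1 ?addr0 => [|x /negPf nx]; first by rewrite /osp_pairing /= eqxx !mul1r.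
  by rewrite {1}/osp_pairing /= eq_sym nx mulr0 mul0r.
case: t; last by rewrite /osp_pairing /= eta_sq.
rewrite (bigD1 b) //= big1 ?addr0 => [|x /negPf nx]; first by rewrite /osp_pairing /= eqxx mul1r mulr1.
by rewrite /osp_pairing /= nx !mulr0.
Qed.

Fact osp_dual a b : osp_pairing false true a b = (a == b)%:R.
Proof. by rewrite /osp_pairing mul1r. Qed.

Fact osp_loop : \sum_x osp_pairing true false x x = m%:R - (n.*2)%:R.
Proof.
under eq_bigr => x _ do rewrite /osp_pairing /= eqxx mulr1.
rewrite /Dm big_split_ord /=; congr (_ + _).
  rewrite (eq_bigr (fun=> 1)) => [|i _]; first by rewrite sumr_const card_ord.
  by rewrite /bpar /= leqNgt ltn_ord.
rewrite (eq_bigr (fun=> -1)) => [|i _]; last by rewrite /bpar /= leq_addr.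
by rewrite sumr_const card_ord mulNrn.
Qed.

Definition ospform : superform :=
  SuperForm osp_even osp_sym osp_contr osp_dual osp_loop.
End OrthosymplecticForm.

(** * Linear maps over the Grassmann algebra *)

Section LambdaMatrices.
Local Open Scope ring_scope.
Variables (R : realType) (m n : nat).
Local Notation C := (R[i]).
Local Notation Grass := (Grass R).
Local Notation Vt := (Vt R m n).
Local Notation Idx := (Idx m n).

Lemma vaddE r (v w : Vt r) A : vadd v w A = v A + w A. Proof. by []. Qed.
Lemma vsumE r (I : finType) (F : I -> Vt r) A : Defs.vsum F A = \sum_i F i A.
Proof. exact: gsumE. Qed.
Lemma vrmulE r (v : Vt r) mu A : vrmul v mu A = v A * mu. Proof. by []. Qed.
Lemma vlmulE r lam (v : Vt r) A : vlmul lam v A = ginvn (ipar A) lam * v A. Proof. by []. Qed.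
Lemma voppE r (v : Vt r) A : vopp v A = - v A.
Proof. by rewrite -[LHS]/((-1) *: v A) scaleN1r. Qed.
Lemma extendE k l (col : Idx k -> Vt l) v B : extend col v B = \sum_A col A B * v A.
Proof. exact: gsumE. Qed.
Lemma ebasisE r (A B : Idx r) : ebasis R A B = (A == B)%:R :> Grass.
Proof. by rewrite /ebasis eq_sym; case: eqP. Qed.

Definition idxl k l (X : Idx (k + l)) : Idx k := [ffun i => X (lshift l i)].
Definition idxr k l (X : Idx (k + l)) : Idx l := [ffun i => X (rshift k i)].

Lemma vtensE k l (v : Vt k) (w : Vt l) X :
  vtens v w X = ginvn (ipar (idxr X)) (v (idxl X)) * w (idxr X).
Proof. by []. Qed.

Definition idx_cat k l (A : Idx k) (B : Idx l) : Idx (k + l) := [ffun x => join A B x].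

Lemma idxl_cat k l (A : Idx k) (B : Idx l) : idxl (idx_cat A B) = A.
Proof. by apply/ffunP => i; rewrite !ffunE join_lshift. Qed.
Lemma idxr_cat k l (A : Idx k) (B : Idx l) : idxr (idx_cat A B) = B.
Proof. by apply/ffunP => i; rewrite !ffunE join_rshift. Qed.
Lemma idx_catK k l (X : Idx (k + l)) : idx_cat (idxl X) (idxr X) = X.
Proof.
by apply/ffunP => x; rewrite ffunE /join; case: split_ordP => i ->; rewrite ffunE.
Qed.

Lemma ipar_cat k l (X : Idx (k + l)) : ipar X = ipar (idxl X) (+) ipar (idxr X).
Proof.
rewrite /ipar big_split_ord oddD; congr (odd _ (+) odd _); apply: eq_bigr => i _; by rewrite ffunE.
Qed.

Lemma sum_idx_cat (M : nmodType) k l (F : Idx (k + l) -> M) :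
  \sum_X F X = \sum_A \sum_B F (idx_cat A B).
Proof.
rewrite pair_big /= (reindex (fun AB : Idx k * Idx l => idx_cat AB.1 AB.2)) //=.
exists (fun X => (idxl X, idxr X)) => [[A B] _|X _] /=; by rewrite ?idxl_cat ?idxr_cat ?idx_catK.
Qed.

Lemma extend_ebasis k l (col : Idx k -> Vt l) A : extend col (ebasis R A) = col A.
Proof.
apply: funext => B; rewrite extendE (bigD1 A) //= big1 ?addr0 => [|A' nA].
  by rewrite ebasisE eqxx mulr1.
by rewrite ebasisE eq_sym (negPf nA) mulr0.
Qed.

Lemma extend_linear k l (col : Idx k -> Vt l) : lam_linear (extend col).
Proof.
split=> [v w|v mu]; apply: funext => B.
  rewrite vaddE !extendE -big_split; apply: eq_bigr => A _; by rewrite vaddE mulrDr.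
by rewrite vrmulE !extendE mulr_suml; apply: eq_bigr => A _; rewrite vrmulE mulrA.
Qed.

Lemma extend_inj k l (c d : Idx k -> Vt l) : extend c = extend d -> c = d.
Proof. by move=> e; apply: funext => A; rewrite -(extend_ebasis c) e extend_ebasis. Qed.

Lemma extend_comp k l p (d : Idx l -> Vt p) (c : Idx k -> Vt l) :
  extend d \o extend c = extend (fun A => extend d (c A)).
Proof.
apply: funext => v; apply: funext => B; rewrite /= !extendE.
under eq_bigr => D _ do rewrite extendE mulr_sumr.
rewrite exchange_big; apply: eq_bigr => A _ /=; rewrite extendE mulr_suml.
by apply: eq_bigr => D _; rewrite mulrA.
Qed.

Lemma lam_linear_extend k l (f : Vt k -> Vt l) :
  lam_linear f -> f = extend (fun A => f (ebasis R A)).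
Proof.
move=> [fD fM]; apply: funext => v; apply: funext => B; rewrite extendE.
have f0 : f (fun=> 0) = fun=> 0.
  have := fM (fun=> 0) 0; rewrite (_ : vrmul _ _ = fun=> 0) => [->|].
    by apply: funext => A; rewrite vrmulE mulr0.
  by apply: funext => A; rewrite vrmulE mulr0.
have fsum (s : seq (Idx k)) : f (fun X => \sum_(A <- s) vrmul (ebasis R A) (v A) X)
    = fun Y => \sum_(A <- s) f (ebasis R A) Y * v A.
  elim: s => [|A s IH].
    rewrite (_ : (fun X => _) = fun=> 0); last by apply: funext => X; rewrite big_nil.
    by rewrite f0; apply: funext => X; rewrite big_nil.
  rewrite (_ : (fun X => _) = vadd (vrmul (ebasis R A) (v A))
       (fun X => \sum_(A <- s) vrmul (ebasis R A) (v A) X)); last first.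
    by apply: funext => X; rewrite big_cons.
  rewrite fD IH fM; apply: funext => Y; by rewrite vaddE big_cons.
have := fsum (index_enum _); rewrite (_ : (fun X => _) = v); last first.
  apply: funext => X; rewrite (bigD1 X) //= big1 => [|A nA].
    by rewrite vrmulE ebasisE eqxx mul1r addr0.
  by rewrite vrmulE ebasisE (negPf nA) mul0r.
by move=> ->.
Qed.

Definition even_col k l (c : Idx k -> Vt l) : Prop :=
  forall A B, ghom (ipar A (+) ipar B) (c A B).

Definition tens_col k l k' l' (c : Idx k -> Vt l) (d : Idx k' -> Vt l') (X : Idx (k + k')) : Vt (l + l') :=
  fun Y => ginvn (ipar (idxr Y)) (c (idxl X) (idxl Y)) * d (idxr X) (idxr Y).

Lemma mpart_extend k l (d : Idx k -> Vt l) p B A :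
  mpart p (extend d) (ebasis R B) A = gpart (ipar A (+) ipar B (+) p) (d B A).
Proof. by rewrite /mpart !extend_ebasis. Qed.

(** The Koszul sign in [mtens] sits on the odd part of the second map, which is zero here. *)
Lemma mtens_even k l k' l' (c : Idx k -> Vt l) (d : Idx k' -> Vt l') : even_col d ->
  mtens (extend c) (extend d) = extend (tens_col c d).
Proof.
move=> d_even; congr extend; apply: funext => X; apply: funext => Y.
cbv beta zeta; rewrite -/(idxl X) -/(idxr X) !extend_ebasis vaddE.
have d0 : mpart false (extend d) (ebasis R (idxr X)) = d (idxr X).
  apply: funext => A; rewrite mpart_extend (gpart_hom _ (d_even _ _)).
  by rewrite addbF addbC eqxx.
have d1 : mpart true (extend d) (ebasis R (idxr X)) = fun=> 0.
  apply: funext => A; rewrite mpart_extend (gpart_hom _ (d_even _ _)) addbT addbC.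
  by case: (_ (+) _).
have z Z : vtens (c (idxl X)) (fun=> 0 : Grass) Z = 0 by rewrite vtensE mulr0.
by rewrite d0 d1 vtensE /tens_col; case: ifP => _; rewrite ?voppE z ?oppr0 addr0.
Qed.

Lemma tens_col_even k l k' l' (c : Idx k -> Vt l) (d : Idx k' -> Vt l') :
  even_col c -> even_col d -> even_col (tens_col c d).
Proof.
move=> ce de X Y; rewrite /tens_col 2!ipar_cat addbACA.
by apply: ghomM; [apply: ghom_inv; apply: ce|apply: de].
Qed.

(** Interchange law: an entry of d' from W to Y, of parity [W] + [Y], moves past an entry of c and
    changes its twist from [ginvn [W]] to [ginvn [Y]]. *)
Lemma tens_col_comp k l p k' l' p' (d : Idx l -> Vt p) (c : Idx k -> Vt l)
    (d' : Idx l' -> Vt p') (c' : Idx k' -> Vt l') :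
  even_col c -> even_col d' ->
  (fun X => extend (tens_col d d') (tens_col c c' X)) =
  tens_col (fun A => extend d (c A)) (fun A => extend d' (c' A)).
Proof.
move=> ce d'e; apply: funext => X; apply: funext => Y.
rewrite extendE sum_idx_cat /tens_col !extendE rmorph_sum /= mulr_suml.
apply: eq_bigr => U _; rewrite mulr_sumr; apply: eq_bigr => W _.
rewrite !idxl_cat !idxr_cat rmorphM /= -!mulrA; congr (_ * _); rewrite !mulrA; congr (_ * _).
rewrite (gmulC_hom _ (d'e _ _)) ginvnA; congr (ginvn _ _ * _).
by rewrite addbC addbA addbb.
Qed.

Definition id_col k : Idx k -> Vt k := fun A => ebasis R A.

Lemma extend_id k : extend (@id_col k) = id.
Proof.
apply: funext => v; apply: funext => B; rewrite extendE (bigD1 B) //= big1 ?addr0 => [|A nA].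
  by rewrite /id_col ebasisE eqxx mul1r.
by rewrite /id_col ebasisE (negPf nA) mul0r.
Qed.

End LambdaMatrices.

(** * The functor *)

Section DiagramMaps.
Local Open Scope ring_scope.

Lemma dweight_parity (B : superform) k l (D : Diag k l) (c : 'I_(k + l) -> sfT B) :
  dweight (sval D) c != 0 -> forall x, sfp (c (sval D x)) = sfp (c x).
Proof.
move=> nz; suff left x : x \in lefts (@posd k l) (sval D) -> sfp (c (sval D x)) = sfp (c x).
  move=> x; have [/left //|] := boolP (x \in lefts (@posd k l) (sval D)).
  rewrite inE -leqNgt leq_eqVlt => /orP[/eqP/posd_inj/eqP|lt].
    by rewrite (negPf (diag_neq _ _)).
  by rewrite -[in RHS](diagK D x); apply/esym/left; rewrite inE diagK.
move=> xL; apply/eqP; apply: contraNT nz => np; rewrite /dweight /weight /weight_on.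
by rewrite (bigD1 x) //= pairw_even ?mul0r // eq_sym.
Qed.

(** Nonzero weight forces equal parities at the two ends of each strand, so odd points come in
    pairs. *)
Lemma dweight_even (B : superform) k l (D : Diag k l) (c : 'I_(k + l) -> sfT B) :
  dweight (sval D) c != 0 -> odd (\sum_x sfp (c x)) = false.
Proof.
move=> /dweight_parity cD; rewrite (bigID (mem (lefts (@posd k l) (sval D)))) /=.
rewrite [X in (_ + X)%N](reindex_inj (can_inj (diagK D))) /=.
rewrite [X in (_ + X)%N](_ : _ = \sum_(x in lefts (@posd k l) (sval D)) sfp (c x))%N.
  by rewrite addnn odd_double.
apply: eq_big => [x|x _]; last by rewrite cD.
rewrite !inE diagK -leqNgt leq_eqVlt orbC; case: ltnP => //= _.
by apply/negbTE; apply: contra (diag_neq D x) => /eqP/posd_inj e; rewrite {2}e.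
Qed.

Variables (R : realType) (m n : nat).
Local Notation C := (R[i]).
Local Notation Grass := (Grass R).
Local Notation Vt := (Vt R m n).
Local Notation Idx := (Idx m n).
Local Notation osp := (ospform R m n).

Definition diag_coef k l (D : Diag k l) (A : Idx k) (B : Idx l) : C :=
  dweight (B := osp) (sval D) (join A B).

Lemma diag_coef_parity k l (D : Diag k l) A B :
  diag_coef D A B != 0 -> ipar A = ipar B.
Proof.
move=> nz; have := dweight_even (B := osp) nz; rewrite big_split_ord oddD /=.
under eq_bigr do rewrite join_lshift; under [X in _ (+) odd X]eq_bigr do rewrite join_rshift.
by rewrite -/(ipar A) -/(ipar B); case: (ipar A) (ipar B) => [] [].
Qed.

Definition diag_col k l (D : Diag k l) (A : Idx k) : Vt l := fun B => (diag_coef D A B)%:A.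

Lemma diag_col_even k l (D : Diag k l) : even_col (diag_col D).
Proof.
move=> A B; rewrite /diag_col.
have [->|/diag_coef_parity ->] := eqVneq (diag_coef D A B) 0; first by rewrite scale0r; apply: ghom0.
by rewrite addbb; apply: ghomZ; apply: ghom1.
Qed.

(** The coefficient [a D] multiplies from the left while coordinates stand to the right of e_B;
    [ginvn] is the sign of moving it past e_B. As [a D] may be odd, these maps need not be even. *)
Definition hom_col k l (a : HomB R k l) (A : Idx k) : Vt l :=
  fun B => \sum_(D : Diag k l) diag_coef D A B *: ginvn (ipar B) (a D).

Definition brauer_functor : FunctorType R m n := fun k l a => extend (hom_col a).
Local Notation F := brauer_functor.

Lemma bdiagE k l (D D' : Diag k l) : bdiag R (sval D) D' = (D' == D)%:R :> Grass.
Proof. by rewrite /bdiag -val_eqE; case: eqP. Qed.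

Lemma hom_col_diag k l (D : Diag k l) : hom_col (bdiag R (sval D)) = diag_col D.
Proof.
apply: funext => A; apply: funext => B; rewrite /hom_col (bigD1 D) //= big1 => [|D' nD].
  by rewrite bdiagE eqxx rmorph1 addr0.
by rewrite bdiagE (negPf nD) rmorph0 scaler0.
Qed.

Lemma hom_col_sum k l (a : HomB R k l) v B :
  F a v B = \sum_(D : Diag k l) ginvn (ipar B) (a D) * extend (diag_col D) v B.
Proof.
rewrite /brauer_functor extendE.
under eq_bigr => A _ do rewrite /hom_col mulr_suml.
rewrite exchange_big; apply: eq_bigr => D _ /=; rewrite extendE mulr_sumr.
apply: eq_bigr => A _; by rewrite /diag_col mulr_algl -scalerAr -scalerAl.
Qed.

Lemma functor_add k l (a b : HomB R k l) : F (addB a b) = madd (F a) (F b).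
Proof.
apply: funext => v; apply: funext => B; rewrite -[RHS]/(F a v B + F b v B) !hom_col_sum -big_split.
by apply: eq_bigr => D _; rewrite -[addB a b D]/(a D + b D) rmorphD mulrDl.
Qed.

Lemma functor_scale k l lam (a : HomB R k l) : F (scaleB lam a) = mscale lam (F a).
Proof.
apply: funext => v; apply: funext => B; rewrite -[RHS]/(ginvn (ipar B) lam * F a v B) !hom_col_sum mulr_sumr.
by apply: eq_bigr => D _; rewrite -[scaleB lam a D]/(lam * a D) rmorphM mulrA.
Qed.

Lemma functor_id k : F (@idB R k) = id.
Proof.
have [D DE] := id_diag k; rewrite /brauer_functor /idB -DE hom_col_diag -[RHS]extend_id; congr extend.
apply: funext => A; apply: funext => B.
rewrite /diag_col /diag_coef DE (dweight_id (B := osp)) /id_col ebasisE.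
by case: eqP => _; rewrite ?scale1r ?scale0r.
Qed.

(** A nonzero coefficient of D2 forces [E] = [B], so both scalars carry the same [ginvn], which
    combines to that of their product. The sum over E that is left is the one of
    [compose_dweight]. *)
Lemma functor_comp k l p (b : HomB R l p) (a : HomB R k l) :
  F (compB (m%:R - (n.*2)%:R) b a) = F b \o F a.
Proof.
rewrite /brauer_functor extend_comp; congr extend; apply: funext => A; apply: funext => B.
rewrite extendE /hom_col.
transitivity (\sum_(D1 : Diag k l) \sum_(D2 : Diag l p)
   (\sum_E diag_coef D1 A E * diag_coef D2 E B) *: ginvn (ipar B) (b D2 * a D1)); last first.
  under [RHS]eq_bigr => E _ do rewrite mulr_suml.
  under [RHS]eq_bigr => E _ do under eq_bigr => D2 _ do rewrite mulr_sumr.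
  rewrite [RHS]exchange_big [LHS]exchange_big; apply: eq_bigr => D2 _ /=.
  rewrite [RHS]exchange_big; apply: eq_bigr => D1 _ /=.
  rewrite scaler_suml; apply: eq_bigr => E _.
  have [->|/diag_coef_parity EB] := eqVneq (diag_coef D2 E B) 0.
    by rewrite mulr0 !scale0r mul0r.
  rewrite EB rmorphM; move: (diag_coef D1 A E) (diag_coef D2 E B) => c1 c2.
  by rewrite -scalerAr -scalerAl scalerA.
under eq_bigr => D _.
  rewrite /compB gsumE rmorph_sum scaler_sumr.
  over.
rewrite exchange_big /= [RHS]pair_big /=; apply: eq_bigr => -[D1 D2] _ /=.
have [D3 D3E compE] := compose_dweight D1 D2.
have -> : \sum_E diag_coef D1 A E * diag_coef D2 E B =
    (m%:R - (n.*2)%:R) ^+ nloops D1 D2 * diag_coef D3 A B by exact: (compE osp A B).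
rewrite (bigD1 D3) //= big1 => [|D nD].
  rewrite D3E eqxx addr0; move: (diag_coef D3 A B) => c.
  rewrite -[gscale _ _]/((m%:R - (n.*2)%:R) ^+ nloops D1 D2 *: (b D2 * a D1)).
  by rewrite ginvnZ scalerA mulrC.
by rewrite -D3E val_eqE (negPf nD) rmorph0 scaler0.
Qed.

Lemma diag_coef_tens k l k' l' (D1 : Diag k l) (D2 : Diag k' l') (D : Diag (k + k') (l + l')) X Y :
  sval D = rawtens D1 D2 ->
  diag_coef D X Y = diag_coef D1 (idxl X) (idxl Y) * diag_coef D2 (idxr X) (idxr Y).
Proof.
move=> DE; rewrite /diag_coef DE dweight_tens_join.
have -> : (fun i => X (lshift k' i)) = idxl X :> ('I_k -> _) by apply: funext => i; rewrite ffunE.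
have -> : (fun i => Y (lshift l' i)) = idxl Y :> ('I_l -> _) by apply: funext => i; rewrite ffunE.
have -> : (fun i => X (rshift k i)) = idxr X :> ('I_k' -> _) by apply: funext => i; rewrite ffunE.
by have -> : (fun i => Y (rshift l i)) = idxr Y :> ('I_l' -> _) by apply: funext => i; rewrite ffunE.
Qed.

(** Coefficients of b may be odd, so both parts of [mtens] contribute. Where the coefficient of D1
    is nonzero, [A] = [B], and the Koszul sign (-1)^[A] on the odd part of [b D2] amounts to [ginvn
    [B]]; with the [ginvn [B']] already present this is [ginvn [Y]]. *)
Lemma functor_tens k l k' l' (a : HomB R k l) (b : HomB R k' l') :
  F (tensB a b) = mtens (F a) (F b).
Proof.
congr extend; apply: funext => X; apply: funext => Y.
cbv beta zeta; rewrite -/(idxl X) -/(idxr X) /brauer_functor !extend_ebasis vaddE.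
set A := idxl X; set A' := idxr X; set B := idxl Y; set B' := idxr Y.
have partE p : mpart p (extend (hom_col b)) (ebasis R A') B'
    = \sum_D2 diag_coef D2 A' B' *: ginvn (ipar B') (gpart p (b D2)).
  rewrite mpart_extend /hom_col.
  have gpart_sum q (I : finType) (G : I -> Grass) : gpart q (\sum_i G i) = \sum_i gpart q (G i).
    by apply: (big_morph _ (gpartD q)); apply: grassP => S; rewrite gpartE gzeroE if_same.
  rewrite gpart_sum; apply: eq_bigr => D2 _; rewrite gpartZ.
  have [->|/diag_coef_parity ->] := eqVneq (diag_coef D2 A' B') 0; first by rewrite !scale0r.
  rewrite addbb addFb; congr (_ *: _); apply: grassP => S.
  by case: (ipar B'); rewrite /ginvn ?(gpartE, ginvE) //; case: eqP; rewrite ?mulr0.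
have -> : (if ipar A then vopp (m := m) (n := n) (r := l + l') else id)
     (vtens (hom_col a A) (mpart true (extend (hom_col b)) (ebasis R A'))) Y =
   (-1) ^+ ipar A *: vtens (hom_col a A) (mpart true (extend (hom_col b)) (ebasis R A')) Y.
  by case: (ipar A); rewrite ?voppE ?scaleN1r ?scale1r.
rewrite !vtensE -/A -/A' -/B -/B' !partE scalerAr -mulrDr.
rewrite /hom_col; transitivity (\sum_D1 \sum_D2 (diag_coef D1 A B * diag_coef D2 A' B') *:
    ginvn (ipar Y) (a D1 * b D2)); last first.
  rewrite rmorph_sum mulr_suml; apply: eq_bigr => D1 _ /=.
  rewrite scaler_sumr -big_split mulr_sumr; apply: eq_bigr => D2 _ /=.
  have [->|/diag_coef_parity AB] := eqVneq (diag_coef D1 A B) 0.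
    by rewrite mul0r !scale0r rmorph0 mul0r.
  rewrite ginvnZ ginvnA AB.
  have bE : ginvn (ipar B') (gpart false (b D2)) +
     (-1) ^+ ipar B *: ginvn (ipar B') (gpart true (b D2)) = ginvn (ipar Y) (b D2).
    rewrite (ipar_cat Y) -/B -/B' -ginvnA {3}(gpart_sum (b D2)) !rmorphD /=.
    rewrite (ginvn_hom (ipar B) (ghom_inv _ (ghom_part false _))) andbF scale1r.
    by rewrite (ginvn_hom (ipar B) (ghom_inv _ (ghom_part true _))) andbT.
  move: (diag_coef D1 A B) (diag_coef D2 A' B') => c1 c2.
  have -> (s : C) (x y : Grass) : c2 *: x + s *: (c2 *: y) = c2 *: (x + s *: y).
    by rewrite scalerDr !scalerA [s * c2]mulrC.
  rewrite bE.
  have -> : ipar B' (+) ipar B = ipar Y by rewrite (ipar_cat Y) addbC.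
  by rewrite rmorphM -scalerAl -scalerAr scalerA.
under eq_bigr => D _.
  rewrite /tensB gsumE rmorph_sum scaler_sumr.
  over.
rewrite exchange_big /= [RHS]pair_big /=; apply: eq_bigr => -[D1 D2] _ /=.
have [D3 D3E] := tens_diag D1 D2.
rewrite (bigD1 D3) //= big1 => [|D nD].
  by rewrite D3E eqxx addr0 (diag_coef_tens _ _ D3E).
by rewrite -D3E val_eqE (negPf nD) rmorph0 scaler0.
Qed.
End DiagramMaps.

(** * Values of the functor on the elementary diagrams *)

Section FunctorValues.
Local Open Scope ring_scope.
Variables (R : realType) (m n : nat).
Local Notation C := (R[i]).
Local Notation Grass := (Grass R).
Local Notation Vt := (Vt R m n).
Local Notation Idx := (Idx m n).
Local Notation idx := ('I_(Dm m n)).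
Local Notation bpar := (@bpar m n).
Local Notation F := (@brauer_functor R m n).
Local Notation eta := (Defs.eta R m n).

Definition idx1 (a : idx) : Idx 1 := [ffun=> a].
Definition idx2 (a b : idx) : Idx 2 := idx_cat (idx1 a) (idx1 b).

Lemma idx1K (A : Idx 1) : idx1 (A ord0) = A.
Proof. by apply/ffunP => i; rewrite ffunE (ord1 i). Qed.

Lemma idx2_0 a b : idx2 a b ord0 = a.
Proof.
have -> : ord0 = lshift 1 (ord0 : 'I_1) :> 'I_2 by apply: val_inj.
by rewrite ffunE join_lshift ffunE.
Qed.

Lemma idx2_1 a b : idx2 a b ord_max = b.
Proof.
have -> : ord_max = rshift 1 (ord0 : 'I_1) :> 'I_2 by apply: val_inj.
by rewrite ffunE join_rshift ffunE.
Qed.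

Lemma idxl1 (X : Idx 2) : idxl (k := 1) (l := 1) X = idx1 (X ord0).
Proof. by apply/ffunP => i; rewrite !ffunE; congr (X _); apply: val_inj; rewrite (ord1 i). Qed.

Lemma idxr1 (X : Idx 2) : idxr (k := 1) (l := 1) X = idx1 (X ord_max).
Proof. by apply/ffunP => i; rewrite !ffunE; congr (X _); apply: val_inj; rewrite (ord1 i). Qed.

Lemma idx2K (X : Idx 2) : idx2 (X ord0) (X ord_max) = X.
Proof. by rewrite /idx2 -idxl1 -idxr1 idx_catK. Qed.

Lemma sum_idx1 (M : nmodType) (G : Idx 1 -> M) : \sum_A G A = \sum_a G (idx1 a).
Proof.
rewrite (reindex idx1) //=; exists (fun A : Idx 1 => A ord0) => [a _|A _]; last exact: idx1K.
by rewrite ffunE.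
Qed.

Lemma sum_idx2 (M : nmodType) (G : Idx 2 -> M) : \sum_X G X = \sum_a \sum_b G (idx2 a b).
Proof.
rewrite (@sum_idx_cat _ _ _ 1 1) sum_idx1; apply: eq_bigr => a _; exact: sum_idx1.
Qed.

Lemma ipar1 a : ipar (idx1 a) = bpar a.
Proof. by rewrite /ipar big_ord1 ffunE oddb. Qed.

Lemma e1E a (B : Idx 1) : e1 R a B = (a == B ord0)%:R.
Proof.
rewrite /e1 ebasisE; congr (nat_of_bool _)%:R; apply/eqP/eqP => [<-|->]; first by rewrite ffunE.
exact: idx1K.
Qed.

Lemma vformE (v w : Vt 1) :
  vform v w = \sum_a \sum_b eta a b *: (ginvn (bpar b) (v (idx1 a)) * w (idx1 b)).
Proof. by rewrite /vform gsumE; apply: eq_bigr => a _; rewrite gsumE. Qed.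

Lemma diag_coef_X (D : Diag 2 2) (X Y : Idx 2) : sval D = rawX ->
  diag_coef R D X Y = (-1) ^+ (bpar (X ord0) && bpar (X ord_max))
    * ((X ord0 == Y ord_max) && (X ord_max == Y ord0))%:R.
Proof. by move=> DE; rewrite /diag_coef DE dweight_X. Qed.

Lemma diag_coef_A (D : Diag 2 0) (X : Idx 2) (Y : Idx 0) : sval D = rawA ->
  diag_coef R D X Y = eta (X ord0) (X ord_max).
Proof. by move=> DE; rewrite /diag_coef DE dweight_A. Qed.

Lemma diag_coef_U (D : Diag 0 2) (X : Idx 0) (Y : Idx 2) : sval D = rawU ->
  diag_coef R D X Y = eta (Y ord_max) (Y ord0).
Proof. by move=> DE; rewrite /diag_coef DE dweight_U. Qed.

Lemma functor_X : F (@Xb R) = @tau R m n.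
Proof.
have [D DE] := X_diag; rewrite /brauer_functor /Xb -DE hom_col_diag; congr extend.
apply: funext => X; apply: funext => Y; rewrite /diag_col (diag_coef_X _ _ DE).
have vE : vtens (e1 R (X ord_max)) (e1 R (X ord0)) Y =
    ((X ord0 == Y ord_max) && (X ord_max == Y ord0))%:R.
  rewrite (@vtensE R m n 1 1) idxl1 idxr1 !e1E !ffunE rmorph_nat -natrM mulnb.
  by rewrite andbC.
case: ifP => _; rewrite ?voppE vE; case: (_ && _); rewrite ?mulr1 ?mulr0 ?scale0r ?oppr0 ?scaleN1r //.
by rewrite expr0 scale1r.
Qed.

Lemma c0E (Y : Idx 2) : @c0 R m n Y = (eta (Y ord_max) (Y ord0))%:A.
Proof.
rewrite /c0 vsumE; under eq_bigr => ab _ do rewrite (@vtensE R m n 1 1) idxl1 idxr1 etainvE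
   -[gscale _ _]/(eta ab.2 ab.1 *: (e1 R ab.2 _)) !e1E !ffunE rmorph_nat.
rewrite (bigD1 (Y ord0, Y ord_max)) //= big1 => [|[a b]]; first by rewrite !eqxx mul1r addr0.
rewrite -pair_eqE /= negb_and => /orP[/negPf ->|/negPf ->]; first by rewrite mul0r.
by rewrite scaler0 mulr0.
Qed.

Lemma functor_U : F (@Ub R) = @Ccheck R m n.
Proof.
have [D DE] := U_diag; rewrite /brauer_functor /Ub -DE hom_col_diag; congr extend.
apply: funext => X; apply: funext => Y; by rewrite /diag_col (diag_coef_U _ _ DE) c0E.
Qed.

Lemma vform_e1 a b : vform (e1 R a) (e1 R b) = (eta a b)%:A.
Proof.
rewrite vformE (bigD1 a) //= [X in _ + X]big1 => [|a' na]; last first.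
  by rewrite big1 // => b' _; rewrite !e1E !ffunE eq_sym (negPf na) rmorph0 mul0r scaler0.
rewrite addr0 (bigD1 b) //= big1 => [|b' nb].
  by rewrite !e1E !ffunE !eqxx rmorph1 mul1r addr0.
by rewrite !e1E !ffunE [b == b']eq_sym (negPf nb) mulr0 scaler0.
Qed.

Lemma functor_A : F (@Ab R) = @Chat R m n.
Proof.
have [D DE] := A_diag; rewrite /brauer_functor /Ab -DE hom_col_diag; congr extend.
apply: funext => X; apply: funext => Y; by rewrite /diag_col (diag_coef_A _ _ DE) vform_e1.
Qed.
End FunctorValues.

(** * Composition and tensor product of basis diagrams *)

Section DiagramAlgebra.
Local Open Scope ring_scope.
Variable R : realType.
Local Notation Grass := (Grass R).

Lemma compB_diag (d : R[i]) k l p (D1 : Diag k l) (D2 : Diag l p) (D : Diag k p) :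
  sval D = rawcomp D1 D2 -> nloops D1 D2 = 0%N ->
  compB d (bdiag R (sval D2)) (bdiag R (sval D1)) = bdiag R (sval D).
Proof.
move=> DE n0; apply: funext => D'; rewrite /compB gsumE bdiagE.
rewrite (bigD1 (D1, D2)) //= big1 => [|[D1' D2']] /=.
  rewrite -DE val_eqE n0 -[gscale _ _]/(1 *: (bdiag R (sval D2) D2 * bdiag R (sval D1) D1)).
  by rewrite !bdiagE !eqxx scale1r mulr1 addr0; case: eqP.
case: ifP => // _; rewrite -[gscale _ _]/(_ *: (bdiag R (sval D2) D2' * bdiag R (sval D1) D1')).
by rewrite !bdiagE -pair_eqE /= negb_and => /orP[] /negPf ->; rewrite ?(mul0r, mulr0) scaler0.
Qed.

Lemma tensB_diag k l k' l' (D1 : Diag k l) (D2 : Diag k' l') (D : Diag (k + k') (l + l')) :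
  sval D = rawtens D1 D2 ->
  tensB (bdiag R (sval D1)) (bdiag R (sval D2)) = bdiag R (sval D).
Proof.
move=> DE; apply: funext => D'; rewrite /tensB gsumE bdiagE.
rewrite (bigD1 (D1, D2)) //= big1 => [|[D1' D2']] /=.
  rewrite -DE val_eqE -[gmul _ _]/(bdiag R (sval D1) D1 * bdiag R (sval D2) D2).
  by rewrite !bdiagE !eqxx mulr1 addr0; case: eqP.
case: ifP => // _; rewrite -[gmul _ _]/(bdiag R (sval D1) D1' * bdiag R (sval D2) D2').
by rewrite !bdiagE -pair_eqE /= negb_and => /orP[] /negPf ->; rewrite ?(mul0r, mulr0).
Qed.

Lemma hom_diag_ind k l (P : HomB R k l -> Prop) :
  P (fun=> 0) -> (forall a b, P a -> P b -> P (addB a b)) ->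
  (forall lam (D : Diag k l), P (scaleB lam (bdiag R (sval D)))) -> forall a, P a.
Proof.
move=> P0 PD PZ a.
suff H (s : seq (Diag k l)) : P (fun D' => \sum_(D <- s) scaleB (a D) (bdiag R (sval D)) D').
  have := H (index_enum _); rewrite (_ : (fun D' => _) = a) //; apply: funext => D'.
  rewrite (bigD1 D') //= big1 => [|D nD]; rewrite -[scaleB _ _ _]/(a _ * bdiag R _ _) bdiagE.
    by rewrite eqxx mulr1 addr0.
  by rewrite eq_sym (negPf nD) mulr0.
elim: s => [|D s IH].
  by rewrite (_ : (fun D' => _) = fun=> 0) //; apply: funext => D'; rewrite big_nil.
rewrite (_ : (fun D' => _) = addB (scaleB (a D) (bdiag R (sval D)))
   (fun D' => \sum_(D <- s) scaleB (a D) (bdiag R (sval D)) D')); first exact: PD.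
by apply: funext => D'; rewrite big_cons.
Qed.
End DiagramAlgebra.

(** * Equivariance under OSp(V) *)

Section Equivariance.
Local Open Scope ring_scope.
Variables (R : realType) (m n : nat) (g : Vt R m n 1 -> Vt R m n 1).
Hypothesis gOSp : in_OSp g.
Local Notation C := (R[i]).
Local Notation Grass := (Grass R).
Local Notation Vt := (Vt R m n).
Local Notation Idx := (Idx m n).
Local Notation idx := ('I_(Dm m n)).
Local Notation bpar := (@bpar m n).
Local Notation eta := (Defs.eta R m n).

Definition gcol (A : Idx 1) : Vt 1 := g (ebasis R A).
Definition gact_col r (A : Idx r) : Vt r := tpow (fun i => g (e1 R (A i))).

Lemma gcolE : g = extend gcol.
Proof. by have [glin _ _ _] := gOSp; apply: lam_linear_extend. Qed.

Lemma gcol_even : even_col gcol.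
Proof.
move=> A B; have [_ geven _ _] := gOSp.
have := geven (ipar A) (ebasis R A); rewrite /vhom => H; rewrite /ghom addbC; apply: H => A'.
rewrite ebasisE; case: eqVneq => [->|_]; last exact: ghom0.
by rewrite addbb; apply: ghom1.
Qed.

Lemma gact_colS r (X : Idx (1 + r)) :
  gact_col X = tens_col gcol (@gact_col r) X.
Proof.
apply: funext => Y; rewrite /gact_col /= /tens_col /gcol -[e1 R _]/(ebasis R (idx1 (X ord0))).
have -> : idx1 (X ord0) = idxl (k := 1) X.
  by apply/ffunP => i; rewrite !ffunE (ord1 i); congr (X _); apply: val_inj.
rewrite (@vtensE R m n 1 r); congr (_ * tpow _ _); apply: funext => i.
by rewrite ffunE; congr (g (e1 R (X _))); apply: val_inj.
Qed.

Lemma gact_col_even r : even_col (@gact_col r).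
Proof.
elim: r => [|r IH]; first by move=> A B; rewrite /ipar !big_ord0; apply: ghom1.
by move=> A B; rewrite gact_colS; apply: (tens_col_even gcol_even IH).
Qed.

(** [tpow] is nested to the right, hence the induction on k. Equivariance of a tensor product of
    diagrams can thereby be checked on its factors. *)
Lemma gact_col_add k l : @gact_col (k + l) = tens_col (@gact_col k) (@gact_col l).
Proof.
elim: k => [|k IH]; apply: funext => X; apply: funext => Y.
  rewrite /tens_col [gact_col (idxl X) _](_ : _ = 1) // rmorph1 mul1r.
  have r0 (Z : Idx (0 + l)) : idxr Z = Z.
    by apply/ffunP => i; rewrite ffunE; congr (Z _); apply: val_inj.
  by rewrite !r0.
rewrite [LHS](congr1 (fun c => c Y) (gact_colS X)) IH.
rewrite /tens_col (congr1 (fun c => c (idxl Y)) (gact_colS (idxl X))) /tens_col.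
have a1 (Z : Idx (1 + (k + l))) : idxl (idxl (k := 1 + k) (l := l) Z) = idxl Z.
  by apply/ffunP => i; rewrite !ffunE; congr (Z _); apply: val_inj.
have a2 (Z : Idx (1 + (k + l))) : idxr (idxl (k := 1 + k) (l := l) Z) = idxl (idxr Z).
  by apply/ffunP => i; rewrite !ffunE; congr (Z _); apply: val_inj.
have a3 (Z : Idx (1 + (k + l))) : idxr (k := 1 + k) (l := l) Z = idxr (idxr Z).
  by apply/ffunP => i; rewrite !ffunE; congr (Z _); apply: val_inj => /=; lia.
rewrite !a1 !a2 !a3 rmorphM /= ginvnA mulrA.
by rewrite (@ipar_cat _ _ k l (idxr (k := 1) Y)) addbC.
Qed.

Lemma gact_col1 : @gact_col 1 = gcol.
Proof.
apply: funext => X; apply: funext => Y; rewrite (congr1 (fun c => c Y) (@gact_colS 0 X)) /tens_col.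
rewrite [gact_col _ _](_ : _ = 1) // mulr1 [ipar _](_ : _ = false); last by rewrite /ipar big_ord0.
have l0 (Z : Idx (1 + 0)) : idxl Z = Z.
  by apply/ffunP => i; rewrite ffunE; congr (Z _); apply: val_inj.
by rewrite !l0.
Qed.

Lemma gact_col0 : @gact_col 0 = @id_col R m n 0.
Proof.
apply: funext => X; apply: funext => Y; rewrite /id_col ebasisE.
by rewrite (_ : X = Y) ?eqxx //; apply/ffunP => -[].
Qed.

Let M (c a : idx) : Grass := gcol (idx1 a) (idx1 c).

Lemma gact_col2 a b c d : gact_col (idx2 a b) (idx2 c d) = ginvn (bpar d) (M c a) * M d b.
Proof.
rewrite (congr1 (fun h => h _ _) (gact_col_add 1 1)) gact_col1 /tens_col.
by rewrite !idxl_cat !idxr_cat ipar1.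
Qed.

Lemma M_even c a : ghom (bpar a (+) bpar c) (M c a).
Proof. by rewrite -!ipar1; apply: gcol_even. Qed.

Lemma form_invariant a b :
  \sum_c \sum_d eta c d *: (ginvn (bpar d) (M c a) * M d b) = (eta a b)%:A.
Proof.
have [_ _ _ gform] := gOSp.
by rewrite -vform_e1 -gform vformE.
Qed.

(** The columns of N are the preimages of the basis vectors, and linearity of g makes this a matrix
    equation. [Grass] is not commutative, so determinants do not provide the inverse. *)
Lemma M_right_inverse : exists N : 'M[Grass]_(Dm m n), (\matrix_(c, a) M c a) *m N = 1%:M.
Proof.
have [_ _ [g' g'K gK] _] := gOSp.
exists (\matrix_(b, a) g' (e1 R a) (idx1 b)); apply/matrixP => c a; rewrite !mxE.
transitivity (g (g' (e1 R a)) (idx1 c)); last by rewrite gK e1E ffunE eq_sym; case: eqP.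
rewrite [in RHS]gcolE extendE sum_idx1; apply: eq_bigr => b _; by rewrite !mxE.
Qed.

(* Invariance of the form gives a left inverse of the matrix of g; since g is bijective it
   is also a right inverse, and this says that g preserves the dual form. *)
Lemma coform_invariant c d :
  \sum_a \sum_b eta b a *: (M c a * ginvn (bpar d) (M d b)) = (eta d c)%:A.
Proof.
pose Mx : 'M[Grass]_(Dm m n) := \matrix_(c, a) M c a.
pose Mt : 'M[Grass]_(Dm m n) := \matrix_(a, c) ginvn (bpar c) (M c a).
pose E : 'M[Grass]_(Dm m n) := \matrix_(a, b) (eta a b)%:A.
pose E' : 'M[Grass]_(Dm m n) := \matrix_(a, b) (eta b a)%:A.
have MxE x y : Mx x y = M x y by rewrite mxE.
have MtE x y : Mt x y = ginvn (bpar y) (M y x) by rewrite mxE.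
have EE x y : E x y = (eta x y)%:A by rewrite mxE.
have E'E x y : E' x y = (eta y x)%:A by rewrite mxE.
have oneE (x y : idx) : (1%:M : 'M[Grass]_(Dm m n)) x y = ((x == y)%:R)%:A.
  by rewrite mxE; case: eqP; rewrite ?scale1r ?scale0r.
have E'E1 : E' *m E = 1%:M.
  apply/matrixP => a b; rewrite mxE oneE.
  under eq_bigr => x _ do rewrite E'E EE mulr_algl scalerA.
  rewrite -scaler_suml; congr (_ *: _).
  transitivity ((-1) ^+ bpar a * \sum_x eta a x * eta x b).
    rewrite mulr_sumr; apply: eq_bigr => x _.
    have [e|e] := eqVneq (bpar x) (bpar a); first by rewrite [eta x a]eta_sym e mulrA.
    by rewrite [eta x a]eta_even // [eta a x]eta_even 1?eq_sym // !(mul0r, mulr0).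
  by rewrite eta_sq mulrA -expr2 sqrr_sign mul1r.
have EE'1 : E *m E' = 1%:M.
  apply/matrixP => a b; rewrite mxE oneE.
  under eq_bigr => x _ do rewrite E'E EE mulr_algl scalerA.
  rewrite -scaler_suml; congr (_ *: _).
  transitivity ((-1) ^+ bpar b * \sum_x eta a x * eta x b).
    rewrite mulr_sumr; apply: eq_bigr => x _.
    by rewrite [eta b x]eta_sym mulrCA.
  rewrite eta_sq; have [->|_] := eqVneq a b; last by rewrite !mulr0.
  by rewrite mulrA -expr2 sqrr_sign mul1r.
have MEM : Mt *m E *m Mx = E.
  apply/matrixP => a b; rewrite mxE EE -form_invariant [RHS]exchange_big /=; apply: eq_bigr => d' _.
  rewrite mxE mulr_suml; apply: eq_bigr => c' _; rewrite MtE EE MxE mulr_algr -scalerAl.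
  (* [Mt] twists by the parity of c', the invariance of the form by that of d'; [eta] vanishes
     unless they agree. *)
  have [-> //|e] := eqVneq (bpar c') (bpar d').
  by rewrite eta_even // !scale0r.
have [N MN] := M_right_inverse.
have LM : E' *m Mt *m E *m Mx = 1%:M by rewrite -!mulmxA [Mt *m _]mulmxA MEM.
have NE : E' *m Mt *m E = N by rewrite -[LHS]mulmx1 -MN mulmxA LM mul1mx.
have : Mx *m E' *m Mt = E'.
  by rewrite -[LHS]mulmx1 -EE'1 mulmxA -[Mx *m _ *m _ *m _]mulmxA -[Mx *m _ *m _]mulmxA
     [E' *m (Mt *m E)]mulmxA NE MN mul1mx.
move=> /matrixP/(_ c d); rewrite E'E => <-; rewrite mxE exchange_big /=.
apply: eq_bigr => b _; rewrite mxE mulr_suml; apply: eq_bigr => a _.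
by rewrite MxE MtE E'E mulr_algr -scalerAl.
Qed.
End Equivariance.

(** * Equivariance of the generators, existence and uniqueness *)

Section MainTheorem.
Local Open Scope ring_scope.
Variables (R : realType) (m n : nat).
Local Notation C := (R[i]).
Local Notation Grass := (Grass R).
Local Notation Vt := (Vt R m n).
Local Notation Idx := (Idx m n).
Local Notation bpar := (@bpar m n).
Local Notation eta := (Defs.eta R m n).
Local Notation F := (@brauer_functor R m n).

Section FixedIsometry.
Variable g : Vt 1 -> Vt 1.
Hypothesis gOSp : in_OSp g.
Local Notation M c a := (gcol g (idx1 a) (idx1 c)).
Local Notation G := (gact_col g).

(** X permutes basis tensors up to sign, so each side has a single term, and what is left is
    supercommutativity of two entries of g. *)
Lemma X_commutes (D : Diag 2 2) : sval D = rawX ->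
  (fun X => extend (diag_col R D) (G X)) = (fun X => extend (@G 2) (diag_col R D X)).
Proof.
move=> DE; apply: funext => X; apply: funext => Z; rewrite -(idx2K X) -(idx2K Z).
move: (X ord0) (X ord_max) (Z ord0) (Z ord_max) => x y z w.
rewrite !extendE !sum_idx2 (bigD1 w) //= [X in _ + X]big1 ?addr0 => [|a na]; last first.
  rewrite big1 // => b _; rewrite /diag_col (diag_coef_X _ _ _ DE) !idx2_0 !idx2_1 (negPf na).
  by rewrite mulr0 scale0r mul0r.
rewrite (bigD1 z) //= big1 ?addr0 => [|b nb]; last first.
  rewrite /diag_col (diag_coef_X _ _ _ DE) !idx2_0 !idx2_1 (negPf nb).
  by rewrite andbF mulr0 scale0r mul0r.
rewrite [RHS](bigD1 y) //= [X in _ + X]big1 ?addr0 => [|a na]; last first.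
  rewrite big1 // => b _; rewrite /diag_col (diag_coef_X _ _ _ DE) !idx2_0 !idx2_1.
  by rewrite [y == a]eq_sym (negPf na) andbF mulr0 scale0r mulr0.
rewrite [RHS](bigD1 x) //= big1 ?addr0 => [|b nb]; last first.
  rewrite /diag_col (diag_coef_X _ _ _ DE) !idx2_0 !idx2_1.
  by rewrite [x == b]eq_sym (negPf nb) mulr0 scale0r mulr0.
rewrite /diag_col !(diag_coef_X _ _ _ DE) !idx2_0 !idx2_1 !eqxx !mulr1 !gact_col2.
have ewx := M_even gOSp w x; have ezy := M_even gOSp z y.
rewrite (ginvn_hom _ ewx) (ginvn_hom _ ezy) mulr_algl mulr_algr -!scalerAl.
rewrite (gmulC_hom _ ewx) (ginvn_hom _ ezy) -scalerAl !scalerA -!signr_addb.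
congr ((-1) ^+ nat_of_bool _ *: _).
by case: (bpar x); case: (bpar y); case: (bpar z); case: (bpar w).
Qed.

Lemma A_commutes (D : Diag 2 0) : sval D = rawA ->
  (fun X => extend (diag_col R D) (G X)) = (fun X => extend (@G 0) (diag_col R D X)).
Proof.
move=> DE; apply: funext => X; rewrite gact_col0 extend_id; apply: funext => Z.
rewrite -(idx2K X); move: (X ord0) (X ord_max) => x y.
rewrite extendE sum_idx2 /diag_col (diag_coef_A _ _ _ DE) idx2_0 idx2_1 -(form_invariant gOSp).
apply: eq_bigr => a _; apply: eq_bigr => b _.
by rewrite (diag_coef_A _ _ _ DE) idx2_0 idx2_1 mulr_algl gact_col2.
Qed.

Lemma U_commutes (D : Diag 0 2) : sval D = rawU ->
  (fun X => extend (diag_col R D) (G X)) = (fun X => extend (@G 2) (diag_col R D X)).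
Proof.
move=> DE; apply: funext => X; rewrite gact_col0 extend_ebasis; apply: funext => Z.
rewrite -(idx2K Z); move: (Z ord0) (Z ord_max) => c d.
have dU Y (X' : Idx 0) : diag_col R D X' Y = (eta (Y ord_max) (Y ord0))%:A.
  by rewrite /diag_col (diag_coef_U _ _ _ DE).
rewrite extendE sum_idx2 dU idx2_0 idx2_1.
(* [gact_col2] twists the first entry of g, [coform_invariant] the second. This sign is the ratio of
   the two, and it is 1 wherever [eta d c] is nonzero. *)
apply/esym; transitivity ((-1) ^+ (bpar d && (bpar c (+) bpar d)) *: (eta d c)%:A : Grass); last first.
  have [->|ncd] := eqVneq (bpar d) (bpar c); first by rewrite addbb andbF expr0 scale1r.
  by rewrite eta_even // scale0r scaler0.
rewrite -(coform_invariant gOSp) scaler_sumr; apply: eq_bigr => a _.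
rewrite scaler_sumr; apply: eq_bigr => b _.
rewrite dU idx2_0 idx2_1 gact_col2 mulr_algr.
have [e|nab] := eqVneq (bpar b) (bpar a); last by rewrite eta_even // !scale0r scaler0.
have eca := M_even gOSp c a; have edb := M_even gOSp d b.
rewrite (ginvn_hom _ eca) (ginvn_hom _ edb) -scalerAl -scalerAr !scalerA -!mulrA mulrCA -signr_addb.
congr (_ * (-1) ^+ nat_of_bool _ *: _); rewrite e.
by case: (bpar a); case: (bpar c); case: (bpar d).
Qed.
End FixedIsometry.

Lemma functor_diag k l (D : Diag k l) : F (bdiag R (sval D)) = extend (diag_col R D).
Proof. by rewrite /brauer_functor hom_col_diag. Qed.

(** Induction over [generated]. In the tensor step the action is itself a tensor product, and the
    interchange law applies because diagrams and the action are even. *)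
Lemma diag_commutes k l (D : Diag k l) (g : Vt 1 -> Vt 1) : in_OSp g ->
  extend (diag_col R D) \o Defs.gact g = Defs.gact g \o extend (diag_col R D).
Proof.
move=> gOSp; elim: (diagrams_generated D) => {k l D}
  [k D DE|D DE|D DE|D DE|k l p D1 D2 D DE n0 _ IH1 _ IH2|k l k' l' D1 D2 D DE _ IH1 _ IH2].
- by rewrite -functor_diag DE -[bdiag R _]/(@idB R k) functor_id.
- by rewrite !extend_comp (X_commutes gOSp DE).
- by rewrite !extend_comp (A_commutes gOSp DE).
- by rewrite !extend_comp (U_commutes gOSp DE).
- have -> : extend (diag_col R D) = extend (diag_col R D2) \o extend (diag_col R D1) :> (Vt k -> Vt p).
    by rewrite -!functor_diag -(compB_diag (m%:R - (n.*2)%:R) DE n0) functor_comp.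
  by rewrite -compA IH1 compA IH2.
have -> : extend (diag_col R D) = extend (tens_col (diag_col R D1) (diag_col R D2)) :> (Vt _ -> Vt _).
  by rewrite -functor_diag -(tensB_diag _ DE) functor_tens !functor_diag mtens_even //; apply: diag_col_even.
rewrite -[@Defs.gact _ _ _ (k + k') g]/(extend (@gact_col _ _ _ g (k + k'))).
rewrite -[@Defs.gact _ _ _ (l + l') g]/(extend (@gact_col _ _ _ g (l + l'))).
rewrite !(gact_col_add) // !extend_comp.
rewrite (tens_col_comp _ _ (gact_col_even gOSp (r := k)) (@diag_col_even R m n _ _ D2)).
rewrite (tens_col_comp _ _ (@diag_col_even R m n _ _ D1) (gact_col_even gOSp (r := l'))).
move: IH1 IH2; rewrite -[Defs.gact g]/(extend (@gact_col _ _ _ g _)) !extend_comp.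
by move=> /extend_inj -> /extend_inj ->.
Qed.

(** Left scalars commute with the action of g, which is even: an entry of parity [A] + [B] changes
    [ginvn [A]] into [ginvn [B]]. This reduces the claim to single diagrams. *)
Lemma functor_equivariant k l (a : HomB R k l) : is_TG_mor (F a).
Proof.
split=> [|g gOSp v]; first exact: extend_linear.
apply: funext => B; rewrite hom_col_sum -[@Defs.gact _ _ _ l g]/(extend (@gact_col _ _ _ g l)) extendE.
transitivity (\sum_D ginvn (ipar B) (a D) * (extend (@gact_col _ _ _ g l) (extend (diag_col R D) v)) B).
  apply: eq_bigr => D _; congr (_ * _).
  by have /(congr1 (fun f => f v B)) := diag_commutes D gOSp.
under [RHS]eq_bigr => A _ do rewrite hom_col_sum mulr_sumr.
rewrite [RHS]exchange_big; apply: eq_bigr => D _ /=; rewrite extendE mulr_sumr.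
apply: eq_bigr => A _; rewrite !mulrA; congr (_ * _).
rewrite (gmulC_hom _ (gact_col_even gOSp _ _)) ginvnA; congr (ginvn _ _ * _).
by rewrite addbC addbA addbb.
Qed.

Lemma brauer_functorP : is_thm54_functor F.
Proof.
split; first exact: functor_equivariant.
split; first exact: functor_add.
split; first exact: functor_scale.
split; first exact: functor_id.
split; first exact: functor_comp.
split; last exact: functor_tens.
split; first exact: functor_id.
by split; [exact: functor_X | split; [exact: functor_U | exact: functor_A]].
Qed.

(** Each constructor of [generated] is an equation in the Brauer category that both functors
    respect; linearity extends the agreement from basis diagrams to all morphisms. *)
Lemma functor_unique (F1 F2 : FunctorType R m n) :
  is_thm54_functor F1 -> is_thm54_functor F2 -> F1 = F2.
Proof.
move=> [lin1 [add1 [scale1 [id1 [comp1 [[_ [X1 [U1 A1]]] tens1]]]]]].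
move=> [lin2 [add2 [scale2 [id2 [comp2 [[_ [X2 [U2 A2]]] tens2]]]]]].
have diagE k l (D : Diag k l) : F1 k l (bdiag R (sval D)) = F2 k l (bdiag R (sval D)).
  elim: (diagrams_generated D) => {k l D}
    [k D DE|D DE|D DE|D DE|k l p D1 D2 D DE n0 _ IH1 _ IH2|k l k' l' D1 D2 D DE _ IH1 _ IH2].
  - by rewrite DE -[bdiag R _]/(@idB R k) id1 id2.
  - by rewrite DE -[bdiag R _]/(@Xb R) X1 X2.
  - by rewrite DE -[bdiag R _]/(@Ab R) A1 A2.
  - by rewrite DE -[bdiag R _]/(@Ub R) U1 U2.
  - by rewrite -(compB_diag (m%:R - (n.*2)%:R) DE n0) comp1 comp2 IH1 IH2.
  - by rewrite -(tensB_diag _ DE) tens1 tens2 IH1 IH2.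
apply: functional_extensionality_dep => k; apply: functional_extensionality_dep => l; apply: funext => a.
elim/hom_diag_ind: a => [|a b IHa IHb|lam D].
(* The zero morphism is 0 times itself, so its image is determined by compatibility with scalars. *)
- have z : scaleB 0 (fun=> 0) = (fun=> 0) :> HomB R k l.
    by apply: funext => D; apply: mul0r.
  rewrite -z scale1 scale2; apply: funext => v; apply: funext => B.
  by rewrite /mscale !vlmulE rmorph0 !mul0r.
- by rewrite add1 add2 IHa IHb.
- by rewrite scale1 scale2 diagE.
Qed.
End MainTheorem.

(* G = OSp(V), d = m - 2n: there is a unique Lambda-linear covariant functor
   F : B(d) -> T_G(V) with F(r) = V^{(x)r}, F(I) = id_V, F(X) = tau,
   F(U) = C-check, F(A) = C-hat, and F(D (x) D') = F(D) (x) F(D'). *)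
Theorem theorem5p4 (R : realType) (m n : nat) :
  exists F : FunctorType R m n,
    is_thm54_functor F /\
    forall F' : FunctorType R m n, is_thm54_functor F' -> F' = F.
Proof.
exists (@brauer_functor R m n); split; first exact: brauer_functorP.
by move=> F' F'P; apply: (functor_unique F'P); apply: brauer_functorP.
Qed.
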